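(* Let $\alpha \in [1,\infty)$ and let $\mu$ be the exponential power distribution of parameter $\alpha$, i.e. the probability measure on $\mathbb{R}$ given by $$\mu(dx) = \frac{1}{2\alpha^{1/\alpha-1}\,\Gamma(1/\alpha)}\, e^{-|x|^\alpha/\alpha}\,dx .$$ Let $\mathcal{L}_\mu f(x) = f''(x) - |x|^{\alpha-2}x f'(x)$ be the associated classical Markovian diffusion operator. Then the spectral gap $\lambda_1(-\mathcal{L}_\mu)$ of $-\mathcal{L}_\mu$ in $L^2(\mu)$ satisfies the following estimates: (i) if $1 \le \alpha \le 2$, then $$\frac{\alpha^2}{4} \le \lambda_1(-\mathcal{L}_\mu) \le 2^{1-2/\alpha};$$ (ii) if $\alpha \ge 2$, then $$\frac{2(1+\alpha)^{1-2/\alpha}}{\alpha} \le \lambda_1(-\mathcal{L}_\mu) \le 3^{1-2/\alpha}.$$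
   Context: $\Gamma(z) = \int_0^\infty t^{z-1}e^{-t}\,dt$ for $z>0$ is the Gamma function. The operator $\mathcal{L}_\mu$ is given on $\mathcal{C}_0^\infty(\mathbb{R})$ (smooth compactly supported real functions) and the same notation is used for its self-adjoint extension in $L^2(\mu)$, whose Dirichlet form is $-\int_{\mathbb{R}} f \mathcal{L}_\mu f\,d\mu = \int_{\mathbb{R}} (f')^2\,d\mu$ with domain $H^1(\mathbb{R},\mu) = \{ f \in L^2(\mu) : \int_{\mathbb{R}} (f')^2\,d\mu < \infty\}$ ($f'$ being the weak derivative). The spectral gap $\lambda_1(-\mathcal{L}_\mu)$ is the largest real $\lambda$ such that the spectrum of $-\mathcal{L}_\mu$ lies in $\{0\}\cup[\lambda,+\infty)$; it is characterized by $$\lambda_1(-\mathcal{L}_\mu) = \inf\left\{ \frac{\int_{\mathbb{R}} (f')^2\,d\mu}{\mathrm{Var}_\mu(f)} : f \in H^1(\mathbb{R},\mu),\ f \ne \text{const}\right\},$$ where $\mathrm{Var}_\mu(f) = \int_{\mathbb{R}} f^2\,d\mu - \left(\int_{\mathbb{R}} f\,d\mu\right)^2$. *)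

(* Defs.v *)
From HB Require Import structures.
From mathcomp Require Import all_boot all_order all_algebra.
From mathcomp Require Import all_classical all_reals all_analysis.
From mathcomp Require Import measurable_realfun.
Set Implicit Arguments.
Unset Strict Implicit.
Unset Printing Implicit Defensive.
Import Order.TTheory GRing.Theory Num.Theory.
Import numFieldNormedType.Exports.

Local Open Scope classical_set_scope.
Local Open Scope ring_scope.

(* Unbounded operators on the real Hilbert space L^2(mu).  An operator is
   represented by its graph: [A f g] reads "f is in the domain of A and
   A f = g".  Elements of L^2(mu) are represented by square-integrable
   functions rather than by classes modulo mu-a.e. equality.  The graph of an
   adjoint, hence of any self-adjoint operator, is a linear subspace
   saturated for a.e. equality. *)
Section L2_operators.
Context d (T : measurableType d) (R : realType).
Variable mu : {measure set T -> \bar R}.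

Definition L2 (f : T -> R) : Prop := f \in Lfun mu 2%:E.

Definition L2norm (f : T -> R) : \bar R := 'N[mu]_2%:E[EFin \o f].

Definition L2inner (f g : T -> R) : R := (\int[mu]_x (f x * g x))%R.

Definition operator := (T -> R) -> (T -> R) -> Prop.

Definition opp_operator (A : operator) : operator := fun f g => A f (\- g).

Definition densely_defined (A : operator) : Prop :=
  forall h, L2 h -> forall e : R, 0 < e ->
    exists f g, A f g /\ (L2norm (h \- f)%R < e%:E)%E.

Definition adjoint (A : operator) : operator := fun f g =>
  [/\ L2 f, L2 g & forall u v, A u v -> L2inner v f = L2inner u g].

Definition self_adjoint (A : operator) : Prop :=
  densely_defined A /\ forall f g, A f g <-> adjoint A f g.

(* [A f (fun x => g x + l * f x)] says that (A - l) f = g, so that the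
   following says that A - l is a bijection from the domain of A onto L^2(mu)
   with bounded inverse. *)
Definition resolvent_set (A : operator) : set R :=
  [set l | exists C : R, forall g, L2 g ->
     exists f, [/\ A f (fun x => g x + l * f x),
       (L2norm f <= C%:E * L2norm g)%E &
       forall f', A f' (fun x => g x + l * f' x) -> {ae mu, forall x, f' x = f x}]].

(* The spectrum of a self-adjoint operator (that is, of its complexification)
   is real, so real spectral parameters suffice. *)
Definition spectrum (A : operator) : set R := ~` resolvent_set A.

(* If the set of all such l is nonempty and bounded above, then its supremum
   belongs to it (see spectral_gap_max); otherwise sup is 0. *)
Definition spectral_gap (A : operator) : R :=
  sup [set l | spectrum A `<=` [set 0] `|` [set x | l <= x]].

Lemma spectral_gap_max (A : operator) :
  has_sup [set l | spectrum A `<=` [set 0] `|` [set x | l <= x]] ->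
  spectrum A `<=` [set 0] `|` [set x | spectral_gap A <= x].
Proof.
move=> [S0 _] x sx; have [->|x0] := eqVneq x 0; first by left.
by right; apply: ge_sup => // l /(_ _ sx)[/eqP|//]; rewrite (negPf x0).
Qed.

End L2_operators.

Section exponential_power_distribution.
Context {R : realType}.
Local Notation leb := (@lebesgue_measure R).

Definition Gamma (z : R) : R :=
  (\int[leb]_(t in `]0, +oo[) (t `^ (z - 1) * expR (- t)))%R.

Definition exp_power_pdf (alpha x : R) : R :=
  (2 * alpha `^ (alpha^-1 - 1) * Gamma alpha^-1)^-1
  * expR (- (`|x| `^ alpha / alpha)).

Definition exp_power (alpha : R) : set (measurableTypeR R) -> \bar R :=
  fun A => (\int[leb]_(x in A) (exp_power_pdf alpha x)%:E)%E.

Variable alpha : R.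

Lemma Gamma_ge0 z : 0 <= Gamma z.
Proof.
by apply: Rintegral_ge0 => t _; rewrite mulr_ge0 ?powR_ge0 ?expR_ge0.
Qed.

Lemma exp_power_pdf_ge0 x : 0 <= exp_power_pdf alpha x.
Proof.
by rewrite mulr_ge0 ?expR_ge0// invr_ge0 !mulr_ge0 ?powR_ge0 ?Gamma_ge0.
Qed.

Lemma measurable_exp_power_pdf :
  measurable_fun [set: R] (exp_power_pdf alpha).
Proof.
apply: measurable_funM => //; apply: measurableT_comp => //.
apply: measurableT_comp => //; apply: measurable_funM => //.
by apply: (measurableT_comp (measurable_powR _)).
Qed.

Let exp_power0 : exp_power alpha set0 = 0%E.
Proof. by rewrite /exp_power integral_set0. Qed.

Let exp_power_ge0 A : (0 <= exp_power alpha A)%E.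
Proof. by apply: integral_ge0 => x _; rewrite lee_fin exp_power_pdf_ge0. Qed.

Let exp_power_sigma_additive : semi_sigma_additive (exp_power alpha).
Proof.
move=> F mF tF mUF; rewrite /exp_power ge0_integral_bigcup//=.
- apply: is_cvg_ereal_nneg_natsum_cond => n _ _.
  by apply: integral_ge0 => x _; rewrite lee_fin exp_power_pdf_ge0.
- apply: measurable_funTS.
  by apply/measurable_EFinP; exact: measurable_exp_power_pdf.
- by move=> x _; rewrite lee_fin exp_power_pdf_ge0.
Qed.

HB.instance Definition _ := isMeasure.Build _ _ _
  (exp_power alpha) exp_power0 exp_power_ge0 exp_power_sigma_additive.

End exponential_power_distribution.

Section diffusion.
Context {R : realType}.
Local Notation leb := (@lebesgue_measure R).

Definition test_function (f : R -> R) : Prop :=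
  (forall n x, derivable (derive1n n f) x 1) /\
  compact (closure [set x | f x != 0]).

Definition weak_derivative (f f' : R -> R) : Prop :=
  [/\ locally_integrable setT f, locally_integrable setT f' &
      forall phi, test_function phi ->
        (\int[leb]_x (f x * derive1 phi x) = - \int[leb]_x (f' x * phi x))%R].

(* f belongs to H^1(R, mu) and f' is its weak derivative *)
Definition H1 (mu : {measure set (measurableTypeR R) -> \bar R})
    (f f' : R -> R) : Prop :=
  [/\ L2 mu f, weak_derivative f f' & L2 mu f'].

(* L is the operator associated with the form E(f, h) = \int f' h' dmu with
   domain H^1(R, mu): the domain of L is contained in H^1(R, mu) and
   E(f, h) = - \int (L f) h dmu for f in the domain of L and h in H^1(R, mu).
   For L self-adjoint, this determines L by maximality of self-adjoint
   operators. *)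
Definition has_dirichlet_form
    (mu : {measure set (measurableTypeR R) -> \bar R})
    (L : operator (measurableTypeR R) R) : Prop :=
  forall f Lf, L f Lf -> exists f', H1 mu f f' /\
    forall h h', H1 mu h h' -> - L2inner mu h Lf = L2inner mu h' f'.

Definition exp_power_diffusion (alpha : R) (f : R -> R) : R -> R := fun x =>
  derive1n 2 f x - `|x| `^ (alpha - 2) * x * derive1 f x.

Definition is_exp_power_generator (alpha : R)
    (L : operator (measurableTypeR R) R) : Prop :=
  [/\ self_adjoint (exp_power alpha) L,
      forall f, test_function f -> L f (exp_power_diffusion alpha f) &
      has_dirichlet_form (exp_power alpha) L].

End diffusion.

(* Main.v *)
(* Let w(x) = exp(-|x|^alpha/alpha) and M(p) = int_0^oo x^p w(x) dx.

   For a self-adjoint operator A = -L with A 1 = 0, a Poincare inequality with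
   constant 1/lambda on the domain of A gives a lower bound for A - l on the
   orthogonal complement of the constants when l < lambda, hence a bounded
   inverse of A - l when moreover l <> 0.  Conversely the infimum of the
   Rayleigh quotient over this complement belongs to the spectrum.

   Upper bounds: the Rayleigh quotient of f(x) = x is M(0)/M(2).

   Lower bounds: for a positive even weight g, the Cauchy-Schwarz inequality
   gives |f(x) - f(0)|^2 <= G(x) |int_0^x f'^2/g| with G(x) = |int_0^x g|, and
   by Tonelli's theorem the Poincare inequality with constant C follows from
   int_s^oo G w <= C g(s) w(s) for s > 0.  For alpha >= 2 take g = 1 and
   C = M(1).  For alpha <= 2 take g = exp((1 - alpha/2) |x|^alpha/alpha) and
   C = 4/alpha^2: then G(x) <= C (alpha/2) x^(alpha-1) g(x), whose product with
   w is C times the derivative of -g w.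

   The moments satisfy M(p + alpha) = (p + 1) M(p) and are log-convex in p, so
   they are values of a function which behaves as the Gamma function; Kershaw's
   inequality bounds M(1), and M(0)/M(2) for alpha <= 2, while log-convexity
   alone bounds M(0)/M(2) for alpha >= 2. *)

Require Import Defs.
From mathcomp Require Import all_boot all_order all_algebra.
From mathcomp Require Import all_classical all_reals all_analysis.
From mathcomp Require Import measurable_realfun ring lra.
Import Order.TTheory GRing.Theory Num.Theory.
Import numFieldNormedType.Exports.
Set Implicit Arguments.
Unset Strict Implicit.
Unset Printing Implicit Defensive.
Local Open Scope classical_set_scope.
Local Open Scope ring_scope.

(** * Nonnegative self-adjoint operators on a pre-Hilbert space *)

(** Three obstacles shape the proof. Vectors are functions rather than classes, so the inner product
    is only semidefinite: solutions and limits are determined up to null vectors, and the graph of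
    [A] is shown to be insensitive to them. The function x lies in the form domain $H^1$, but its
    support is not compact, so it is not among the test functions on which [L] is prescribed. Its
    Rayleigh quotient reaches the spectrum after x is replaced by $(A + 1)^{-1} x$, which lies in
    the domain of the operator and obeys the same upper bound. Finally, an element of $H^1$ has no
    value at 0. The role of f(0) is played by a constant c such that, almost everywhere, |f(x) - c|
    is at most the integral of |f'| between 0 and x; for f of mean zero, subtracting a constant can
    only increase the norm, so a bound on f - c is enough. *)

Section pre_hilbert.
Context {R : realType} {V : lmodType R} (dot : V -> V -> R).
Hypothesis dotC : forall u v, dot u v = dot v u.
Hypothesis dotDl : forall u v w, dot (u + v) w = dot u w + dot v w.
Hypothesis dotZl : forall a u v, dot (a *: u) v = a * dot u v.
Hypothesis dot_ge0 : forall u, 0 <= dot u u.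

(** The discriminant criterion, read at the minimiser [- b / c]. When [c = 0], a nonzero [b] would
    let the affine function take the value -1. It serves for forms known only on the domain of [A]
    as well as for [dot]. *)
Lemma sqr_le_of_quadratic_ge0 (a b c : R) : 0 <= c ->
  (forall t, 0 <= a + 2 * t * b + t ^+ 2 * c) -> b ^+ 2 <= a * c.
Proof.
rewrite le_eqVlt => /predU1P[<-|c0] H.
  have [->|b0] := eqVneq b 0; first by rewrite expr0n mulr0.
  have := H (- (a + 1) / (2 * b)).
  have -> : a + 2 * (- (a + 1) / (2 * b)) * b + (- (a + 1) / (2 * b)) ^+ 2 * 0 = - 1.
    by field.
  by lra.
have := H (- b / c).
have -> : a + 2 * (- b / c) * b + (- b / c) ^+ 2 * c = (a * c - b ^+ 2) / c.
  by field; rewrite gt_eqF.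
by rewrite pmulr_lge0 ?invr_gt0// subr_ge0.
Qed.

Lemma dotDr u v w : dot u (v + w) = dot u v + dot u w.
Proof. by rewrite dotC dotDl !(dotC u). Qed.

Lemma dotZr a u v : dot u (a *: v) = a * dot u v.
Proof. by rewrite dotC dotZl dotC. Qed.

Lemma dotNl u v : dot (- u) v = - dot u v.
Proof. by rewrite -scaleN1r dotZl mulN1r. Qed.

Lemma dot0l u : dot 0 u = 0.
Proof. by rewrite -(scale0r 0) dotZl mul0r. Qed.

Lemma dotNr u v : dot u (- v) = - dot u v.
Proof. by rewrite dotC dotNl dotC. Qed.

Let dotE := (dotDl, dotDr, dotNl, dotNr, dotZl, dotZr).

Lemma dot_CS u v : dot u v ^+ 2 <= dot u u * dot v v.
Proof.
apply: sqr_le_of_quadratic_ge0 => // t.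
have := dot_ge0 (u + t *: v); rewrite !dotE (dotC v u).
by congr (_ <= _); ring.
Qed.

Lemma dot_null u v : dot u u = 0 -> dot v u = 0.
Proof.
move=> u0; have := dot_CS v u; rewrite u0 mulr0 => h.
by apply/eqP; rewrite -sqrf_eq0 eq_le h sqr_ge0.
Qed.

(** The parallelogram law for [h - u] and [h - v]. It makes a minimising sequence for the distance
    to [h] a Cauchy sequence. *)
Lemma dot_parallelogram h u v :
  dot (u - v) (u - v) = 2 * dot (h - u) (h - u) + 2 * dot (h - v) (h - v)
    - 4 * dot (h - 2^-1 *: (u + v)) (h - 2^-1 *: (u + v)).
Proof.
by rewrite !dotE (dotC u h) (dotC v h) (dotC v u); field.
Qed.

Lemma dot_triangle a u v :
  dot (u + a *: v) (u + a *: v) <= 2 * dot u u + 2 * a ^+ 2 * dot v v.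
Proof.
have := dot_ge0 (u - a *: v); rewrite !dotE (dotC v u); lra.
Qed.

Definition dot_cvg (u_ : nat -> V) (u : V) :=
  forall e, 0 < e -> exists N, forall n, (N <= n)%N ->
    dot (u_ n - u) (u_ n - u) <= e.

Definition dot_cauchy (u_ : nat -> V) :=
  forall e, 0 < e -> exists N, forall m n, (N <= m)%N -> (N <= n)%N ->
    dot (u_ m - u_ n) (u_ m - u_ n) <= e.

Lemma eq_of_sqr_le (a b C : R) : (forall e, 0 < e -> (a - b) ^+ 2 <= C * e) -> a = b.
Proof.
move=> H; apply/eqP; rewrite -subr_eq0 -sqrf_eq0 eq_le sqr_ge0 andbT.
apply/ler_addgt0Pr => e e0; rewrite add0r.
have C0 : 0 <= C.
  by have := le_trans (sqr_ge0 _) (H 1 ltr01); rewrite mulr1.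
have := H (e / (C + 1)) (divr_gt0 e0 _); move=> /(_ _)/le_trans; apply; first lra.
rewrite mulrA ler_pdivrMr; last lra.
by nra.
Qed.

Lemma dot_cvg_l u_ u v w :
  dot_cvg u_ u -> dot_cvg v w -> 
  (forall x y, (forall n, dot x (u_ n) = dot y (v n)) -> dot x u = dot y w).
Proof.
move=> uu vw x y H.
apply: (@eq_of_sqr_le _ _ (2 * dot x x + 2 * dot y y)) => e e0.
have [N1 /(_ (maxn N1 _) (leq_maxl _ _)) h1] := uu _ e0.
have [N2 h2] := vw _ e0.
have {}h1 := h1 N2.
have {}h2 := h2 (maxn N1 N2) (leq_maxr _ _).
set n := maxn N1 N2 in h1 h2.
have -> : dot x u - dot y w = dot y (v n - w) - dot x (u_ n - u).
  by rewrite !dotE H; ring.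
have c1 := dot_CS x (u_ n - u).
have c2 := dot_CS y (v n - w).
set a := dot y (v n - w) in c2 *.
set b := dot x (u_ n - u) in c1 *.
have d1 : dot x x * dot (u_ n - u) (u_ n - u) <= dot x x * e by apply: ler_wpM2l.
have d2 : dot y y * dot (v n - w) (v n - w) <= dot y y * e by apply: ler_wpM2l.
have := sqr_ge0 (a + b).
nra.
Qed.

Hypothesis dot_complete : forall u_, dot_cauchy u_ -> exists u, dot_cvg u_ u.

Section self_adjoint_operator.
Variable A : V -> V -> Prop.
Hypothesis A_sa : forall f g, A f g <-> forall u v, A u v -> dot v f = dot u g.

Lemma sa_sym f g u v : A f g -> A u v -> dot v f = dot u g.
Proof. by move=> /A_sa H /H. Qed.

Lemma sa_lin a f g u v : A f g -> A u v -> A (a *: f + u) (a *: g + v).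
Proof.
move=> fg uv; apply/A_sa => h k hk.
by rewrite !dotE (sa_sym fg hk) (sa_sym uv hk).
Qed.

(** The graph is cut out by pairings, and null vectors pair to zero with everything. This stands in
    for equality of vectors at null distance. *)
Lemma sa_ae f g g' : A f g -> dot (g' - g) (g' - g) = 0 -> A f g'.
Proof.
move=> fg g0; apply/A_sa => u v uv; rewrite (sa_sym fg uv).
have := dot_null u g0; rewrite !dotE; lra.
Qed.

Lemma sa_closed (f_ g_ : nat -> V) f g : (forall n, A (f_ n) (g_ n)) ->
  dot_cvg f_ f -> dot_cvg g_ g -> A f g.
Proof.
move=> fg ff gg; apply/A_sa => u v uv.
by apply: (dot_cvg_l ff gg) => n; exact: sa_sym.
Qed.

(* The orthogonal projection of h on the range of A - l, which is closed by
   the lower bound; the residual is orthogonal to the range, hence an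
   eigenvector by self-adjointness, hence null. *)
Lemma sa_surjective (l c : R) : 0 < c ->
  (forall f g, A f g -> c * dot f f <= dot (g - l *: f) (g - l *: f)) ->
  forall h, exists f, A f (h + l *: f).
Proof.
move=> c0 low h.
pose S := [set r | exists f g, A f g /\ r = dot (h - (g - l *: f)) (h - (g - l *: f))].
have A0 : A 0 0.
  by apply/A_sa => u v _; rewrite -[X in dot v X](scale0r 0) -[X in dot u X](scale0r 0) !dotZr !mul0r.
have infS : has_inf S.
  split; first by exists (dot (h - (0 - l *: 0)) (h - (0 - l *: 0))), 0, 0.
  by exists 0 => _ [f [g [_ ->]]].
pose d := inf S.
have dS f g : A f g -> d <= dot (h - (g - l *: f)) (h - (g - l *: f)).
  by move=> fg; apply: ge_inf; [exact: infS.2|exists f, g].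
have /choice[p pP] n : exists p : V * V, A p.1 p.2 /\
    dot (h - (p.2 - l *: p.1)) (h - (p.2 - l *: p.1)) < d + n.+1%:R^-1.
  have [|r [f [g [fg ->]] rd]] := @inf_adherent _ S n.+1%:R^-1 _ infS.
    by rewrite invr_gt0.
  by exists (f, g).
pose k n := (p n).2 - l *: (p n).1.
have kk m n : dot (k m - k n) (k m - k n) <= 2 * m.+1%:R^-1 + 2 * n.+1%:R^-1.
  have [Am lm] := pP m; have [An ln] := pP n.
  (* The midpoint of the two approximants must be tested against the infimum. Since [sa_lin] scales
     only its first argument, half of the second is obtained as [(2^-1 - 1)] times it plus
     itself. *)
  have := dS _ _ (sa_lin 2^-1 Am (sa_lin (2^-1 - 1) An An)).
  have -> : 2^-1 *: (p m).2 + ((2^-1 - 1) *: (p n).2 + (p n).2) -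
      l *: (2^-1 *: (p m).1 + ((2^-1 - 1) *: (p n).1 + (p n).1)) =
      2^-1 *: (k m + k n).
    rewrite /k !scalerBl !scale1r !subrK !scalerDr !scalerN !scalerA (mulrC l).
    by rewrite opprD addrACA.
  rewrite (dot_parallelogram h (k m)) => H.
  rewrite -/(k m) in lm; rewrite -/(k n) in ln.
  by move: (m.+1%:R^-1) (n.+1%:R^-1) lm ln => a b; lra.
have cvgN (e : R) : 0 < e -> exists N, forall n, (N <= n)%N -> n.+1%:R^-1 < e.
  move=> e0; exists (Num.truncn e^-1) => n Nn.
  rewrite -[ltRHS]invrK ltf_pV2 ?posrE ?invr_gt0//.
  by apply: lt_le_trans (truncnS_gt _) _; rewrite ler_nat ltnS.
have kC : dot_cauchy k.
  move=> e e0; have [|N Ne] := cvgN (e / 4); first lra.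
  exists N => m n Nm Nn; apply: le_trans (kk m n) _.
  have := Ne _ Nm; have := Ne _ Nn.
  by move: (m.+1%:R^-1) (n.+1%:R^-1) => a b; lra.
have fC : dot_cauchy (fun n => (p n).1).
  move=> e e0; have [N HN] := kC (c * e) (mulr_gt0 c0 e0).
  exists N => m n Nm Nn; rewrite -(ler_pM2l c0); apply: le_trans (HN m n Nm Nn).
  (* The lower bound, applied to differences, carries the Cauchy property from the range back to the
     domain. *)
  have := low _ _ (sa_lin (- 1) (pP n).1 (pP m).1).
  rewrite !scaleN1r (addrC _ (p m).1) (addrC _ (p m).2).
  suff -> : (p m).2 - (p n).2 - l *: ((p m).1 - (p n).1) = k m - k n by [].
  by rewrite /k scalerBr opprD addrACA -opprD.
have [k0 kk0] := dot_complete kC.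
have [f0 ff0] := dot_complete fC.
exists f0.
have Af0 : A f0 (k0 + l *: f0).
  apply: (@sa_closed (fun n => (p n).1) (fun n => k n + l *: (p n).1)) => //.
    by move=> n; rewrite /k subrK; have [] := pP n.
  move=> e e0; have e1 : 0 < e / 4 by lra.
  have l2 : 0 < l ^+ 2 + 1 by have := sqr_ge0 l; lra.
  have [N1 h1] := kk0 _ e1.
  have [N2 h2] := ff0 (e / 4 / (l ^+ 2 + 1)) (divr_gt0 e1 l2).
  exists (maxn N1 N2) => n; rewrite geq_max => /andP[/h1 {}h1 /h2 {}h2].
  have -> : k n + l *: (p n).1 - (k0 + l *: f0) = (k n - k0) + l *: ((p n).1 - f0).
    by rewrite scalerBr opprD addrACA.
  move: h2; rewrite ler_pdivlMr// => h2; apply: le_trans (dot_triangle _ _ _) _.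
  have := dot_ge0 ((p n).1 - f0); nra.
have orth u v : A u v -> dot (h - k0) (v - l *: u) = 0.
  move=> uv; set w := v - l *: u.
  (* Moving [k n] along [w] stays in the range, so the squared distance to [h] stays above [d],
     while at [k n] it exceeds [d] by less than [n.+1%:R^-1]. The discriminant of this quadratic in
     [t] gives the bound. *)
  have small n : dot (h - k n) w ^+ 2 <= n.+1%:R^-1 * dot w w.
    have [An ln] := pP n.
    rewrite -[leLHS]sqrrN; apply: sqr_le_of_quadratic_ge0 => // t.
    have := dS _ _ (sa_lin t uv An).
    have -> : t *: v + (p n).2 - l *: (t *: u + (p n).1) = t *: w + k n.
      by rewrite /w /k scalerDr scalerBr !scalerA (mulrC l) opprD addrACA.
    rewrite -/(k n) in ln; rewrite opprD addrCA addrC.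
    move: ln; move: (h - k n) w (n.+1%:R^-1) => y z a ln.
    rewrite !dotE (dotC z y); lra.
  apply: (@eq_of_sqr_le _ _ (4 * dot w w)) => e e0; rewrite subr0.
  have [N1 h1] := kk0 _ e0.
  have [N2 h2] := cvgN e e0.
  have {}h1 := h1 (maxn N1 N2) (leq_maxl _ _).
  have {}h2 := h2 (maxn N1 N2) (leq_maxr _ _).
  set n := maxn N1 N2 in h1 h2.
  have -> : dot (h - k0) w = dot (h - k n) w + dot (k n - k0) w by rewrite !dotE; ring.
  have aa : dot (k n - k0) w ^+ 2 <= e * dot w w.
    by apply: le_trans (dot_CS _ _) _; apply: ler_wpM2r.
  have bb : dot (h - k n) w ^+ 2 <= e * dot w w.
    by apply: le_trans (small n) _; apply: ler_wpM2r => //; apply: ltW.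
  have := sqr_ge0 (dot (h - k n) w - dot (k n - k0) w).
  nra.
have Ares : A (h - k0) (l *: (h - k0)).
  apply/A_sa => u v uv; have := orth _ _ uv.
  by rewrite (dotC _ (v - _)) dotDl dotNl dotZl dotZr => /eqP; rewrite subr_eq0 => /eqP.
have := low _ _ Ares; rewrite subrr dot0l => res0.
have {}res0 : dot (h - k0) (h - k0) = 0.
  apply/eqP; rewrite eq_le dot_ge0 andbT -(ler_pM2l c0); lra.
apply: sa_ae Af0 _; rewrite opprD addrACA subrr addr0.
exact: res0.
Qed.

Section spectral_bottom.
Variables (e : V) (lambda : R).
Hypothesis Ae0 : A e 0.
Hypothesis e_gt0 : 0 < dot e e.
Hypothesis lambda_gt0 : 0 < lambda.
Hypothesis gap : forall f g, A f g -> dot f e = 0 -> lambda * dot f f <= dot g f.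

Lemma sa_range_orth f g : A f g -> dot g e = 0.
Proof. by move=> fg; rewrite (sa_sym Ae0 fg) dotC dot0l. Qed.

(** The constant is the squared distance from [l] to the set made of 0 and $[\lambda, +\infty)$.
    Write f as [f0 + a *: e] with [f0] orthogonal to [e]: on [e] the operator A - l acts as -l, and
    on [f0] the gap and Cauchy-Schwarz give the factor [lambda - l]. The two images are orthogonal
    because the range of [A] is orthogonal to [e]. *)
Lemma sa_resolvent_bound l : l < lambda -> l != 0 -> exists2 c, 0 < c &
  forall f g, A f g -> c * dot f f <= dot (g - l *: f) (g - l *: f).
Proof.
move=> ll l0; pose d := Num.min (lambda - l) `|l|.
have d0 : 0 < d by rewrite lt_min subr_gt0 ll normr_gt0 l0.
have dl : d <= lambda - l by rewrite ge_min lexx.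
have dn : d <= `|l| by rewrite ge_min lexx orbT.
exists (d ^+ 2) => [|f g fg]; first by rewrite exprn_gt0.
have ge0 := sa_range_orth fg.
pose a := dot f e / dot e e; pose f0 := f - a *: e.
have f0e : dot f0 e = 0 by rewrite /f0 !dotE /a divfK ?subrr// gt_eqF.
have Af0 : A f0 g.
  have := sa_lin (- a) Ae0 fg; rewrite scaler0 add0r scaleNr.
  by rewrite addrC.
have gf0 := gap Af0 f0e.
have fE : f = f0 + a *: e by rewrite /f0 subrK.
clearbody f0 a.
have -> : dot (g - l *: f) (g - l *: f) =
    dot (g - l *: f0) (g - l *: f0) + l ^+ 2 * (a ^+ 2 * dot e e).
  by rewrite fE !dotE (dotC e f0) (dotC e g) f0e ge0; ring.
have -> : dot f f = dot f0 f0 + a ^+ 2 * dot e e.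
  by rewrite fE !dotE (dotC e f0) f0e; ring.
rewrite mulrDr; apply: lerD; last first.
  apply: ler_wpM2r; first by rewrite mulr_ge0 ?sqr_ge0 ?ltW.
  by rewrite -(real_normK (num_real l)) lerXn2r ?nnegrE ?normr_ge0// ltW.
have h1 : d * dot f0 f0 <= dot (g - l *: f0) f0.
  rewrite !dotE; apply: le_trans (ler_wpM2r (dot_ge0 f0) dl) _; lra.
have := dot_CS (g - l *: f0) f0.
have := dot_ge0 f0; rewrite le_eqVlt => /predU1P[<-|n0]; first by rewrite mulr0 => _; rewrite mulr0.
move=> cs; rewrite -(ler_pM2r n0); apply: le_trans cs.
rewrite -mulrA -expr2 -exprMn lerXn2r ?nnegrE//.
  by rewrite mulr_ge0 ?ltW.
by apply: le_trans h1; rewrite mulr_ge0 ?ltW.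
Qed.

Definition rayleigh : set R :=
  [set r | exists f g, [/\ A f g, dot f e = 0, 0 < dot f f & r = dot g f / dot f f]].

Lemma rayleigh_ge r : rayleigh r -> lambda <= r.
Proof.
by move=> [f [g [fg fe f0 ->]]]; rewrite ler_pdivlMr//; exact: gap.
Qed.

(* With g = (A - m)^-1 f, the Cauchy-Schwarz inequality for the nonnegative
   form <(A - m) f, g> gives |f|^4 <= <(A - m) f, f> <f, (A - m)^-1 f>. *)
Lemma rayleigh_inf_spectrum : rayleigh !=set0 ->
  ~ exists C, forall h, exists2 f, A f (h + inf rayleigh *: f) &
     dot f f <= C * dot h h.
Proof.
move=> ray0 [C0 HC0]; set m := inf rayleigh in HC0 *.
pose C := `|C0| + 1; have C_gt0 : 0 < C by rewrite ltr_wpDl.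
have HC h : exists2 f, A f (h + m *: f) & dot f f <= C * dot h h.
  have [f fh fC] := HC0 h; exists f => //; apply: le_trans fC _.
  by apply: ler_wpM2r => //; rewrite (le_trans (ler_norm _))// lerDl.
have infr : has_inf rayleigh by split => //; exists lambda => r /rayleigh_ge.
have m0 : 0 < m.
  by apply: lt_le_trans lambda_gt0 _; apply: lb_le_inf => // r /rayleigh_ge.
have mP f g : A f g -> dot f e = 0 -> 0 <= dot (g - m *: f) f.
  move=> fg fe; have [f0|f0] := eqVneq (dot f f) 0.
    by rewrite dotC dotDr !(dotC f) ?(dot_null _ f0) // dotNl dotZl f0 mulr0 subr0.
  have {}f0 : 0 < dot f f by rewrite lt_neqAle eq_sym f0 /=.
  rewrite !dotE subr_ge0 -ler_pdivlMr//; apply: ge_inf; first exact: infr.2.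
  by exists f, g.
(* With X = [dot f f] and Q = [dot (g - m *: f) f], the margin 1 / (2 C) gives 2 C Q < X, while the
   Cauchy-Schwarz bound below gives X^2 <= C Q X. These are incompatible for X > 0. *)
have [r [f [g [fg fe f0 ->]] rlt]] := inf_adherent (divr_gt0 ltr01 (mulr_gt0 (ltr0n _ 2) C_gt0)) infr.
have [u uf uC] := HC f.
have ue : dot u e = 0.
  have := sa_range_orth uf; rewrite !dotE fe add0r => /eqP.
  by rewrite mulf_eq0 gt_eqF//= => /eqP.
have gu : dot g u = dot f f + m * dot f u.
  by have := sa_sym fg uf; rewrite !dotE (dotC u f) (dotC u g) => <-.
have cs : dot (g - m *: f) u ^+ 2 <= dot (g - m *: f) f * dot f u.
  apply: sqr_le_of_quadratic_ge0.
    by have := mP _ _ uf ue; rewrite addrK.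
  move=> t.
  have := mP _ _ (sa_lin t uf fg); rewrite !dotE ue fe mulr0 addr0 => /(_ erefl).
  by rewrite (dotC u f) gu => H; apply: le_trans H _; rewrite le_eqVlt; apply/orP; left; apply/eqP; ring.
have E1 : dot (g - m *: f) u = dot f f by rewrite !dotE gu; ring.
have C_ge1 : 1 <= C by rewrite lerDr.
have fu : dot f u <= C * dot f f.
  have := le_trans (dot_CS f u) (ler_wpM2l (dot_ge0 f) uC).
  move: (dot f f) (dot f u) f0 => X y X0 yX.
  rewrite real_leNgt ?num_real//; apply/negP => H.
  have CX : 0 < C * X by rewrite mulr_gt0.
  have : (C * X) * (C * X) < y * y by apply: ltr_pM; rewrite ?ltW.
  have : C * (X * X) <= C * (C * (X * X)).
    by rewrite ler_peMl// !mulr_ge0 ?ltW.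
  nra.
have Q0 := mP _ _ fg fe.
have := le_trans cs (ler_wpM2l Q0 fu); rewrite E1.
have Q1 : 2 * C * dot (g - m *: f) f < dot f f.
  rewrite !dotE mulrC -ltr_pdivlMr ?mulr_gt0// ltrBlDl.
  by move: rlt; rewrite ltr_pdivrMr// mulrDl mul1r (mulrC (2 * C)^-1).
move: Q1; rewrite -(ltr_pM2r f0).
have := exprn_gt0 2 f0; move: (dot (g - m *: f) f) (dot f f) => Q X; lra.
Qed.

(* By the Cauchy-Schwarz inequality for the form of A + 1, the resolvent
   (A + 1)^-1 decreases the Rayleigh quotient; it maps the form domain, to
   which k belongs, to the domain of A. *)
Lemma rayleigh_le_form k q U : dot k e = 0 -> 0 < dot k k -> q <= U * dot k k ->
  0 <= U -> (forall f g, A f g -> dot g k ^+ 2 <= dot g f * q) ->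
  exists2 r, rayleigh r & r <= U.
Proof.
move=> ke k0 qU U0 form.
have [c c0 low] : exists2 c, 0 < c &
    forall f g, A f g -> c * dot f f <= dot (g - -1 *: f) (g - -1 *: f).
  apply: sa_resolvent_bound; last by rewrite oppr_eq0 oner_eq0.
  by rewrite (lt_trans _ lambda_gt0)// ltrN10.
have [f fk] := sa_surjective c0 low k.
rewrite scaleN1r in fk.
have fe : dot f e = 0.
  by have := sa_range_orth fk; rewrite !dotE ke sub0r => /eqP; rewrite oppr_eq0 => /eqP.
have := form _ _ fk; have := gap fk fe; have := dot_CS f k.
have := dot_ge0 f; rewrite !dotE (dotC k f).
have := @dot_null f k.
set N := dot k k in k0 qU *; set t := dot f k; set s := dot f f.
move=> null s0 cs sp fm.
have p0 : 0 <= t - s by apply: le_trans sp; rewrite mulr_ge0// ltW.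
have {}fm : (N - t) ^+ 2 <= (t - s) * (U * N).
  by apply: le_trans fm _; apply: ler_wpM2l.
have [s00|sN0] := eqVneq s 0.
  have t0 : t = 0 by rewrite /t dotC; exact: null.
  by move: fm; rewrite t0 s00; nra.
have {sN0}s_gt0 : 0 < s by rewrite lt_neqAle eq_sym sN0.
exists ((t - s) / s).
  by exists f, (k - f); split=> //; rewrite !dotE (dotC k f).
rewrite ler_pdivrMr//.
(* This is Cauchy-Schwarz for the form of A + 1, obtained by adding [fm], [cs] and the cross term
   [ab]; the latter is the arithmetic-geometric mean inequality applied to the product of the first
   two. Using [cs] once more turns it into [t <= (U + 1) * s]. *)
have main : N <= (U + 1) * t.
  suff : N * N <= (U + 1) * t * N by rewrite ler_pM2r.
  have ab : 2 * ((N - t) * t) <= (t - s) * N + s * (U * N).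
    have d0 : 0 <= (t - s) * N + s * (U * N) by rewrite addr_ge0 ?mulr_ge0// ltW.
    rewrite real_leNgt ?num_real//; apply/negP => H.
    have : ((t - s) * N + s * (U * N)) ^+ 2 < (2 * ((N - t) * t)) ^+ 2.
      by rewrite ltrXn2r// ?nnegrE// ltW// (le_lt_trans d0).
    have : (N - t) ^+ 2 * t ^+ 2 <= (t - s) * (U * N) * (s * N).
      by rewrite ler_pM ?sqr_ge0.
    have := sqr_ge0 ((t - s) * N - s * (U * N)); nra.
  nra.
have t_gt0 : 0 < t by nra.
suff : t <= (U + 1) * s by lra.
rewrite -(ler_pM2r t_gt0); nra.
Qed.

End spectral_bottom.
End self_adjoint_operator.
End pre_hilbert.

(** * The Hilbert space L^2 and the spectral gap *)

Section L2_space.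
Context d (T : measurableType d) (R : realType).
Variable mu : {measure set T -> \bar R}.
Local Notation V := (LfunType mu (lee1n 2 : (1 <= 2%:E)%E)).
Local Notation ip := (L2inner mu).

Lemma L2E (f : T -> R) : L2 mu f <->
  measurable_fun setT f /\ mu.-integrable setT (EFin \o (fun x => f x ^+ 2)).
Proof.
split=> [f2|[mf if2]].
  split; last exact: Lfun2_integrable_sqr.
  by move: f2; rewrite /L2 inE => /andP[/[!inE]].
rewrite /L2 inE; apply/andP; split; rewrite inE//= /finite_norm unlock.
apply: poweR_lty; move/integrableP : if2 => [_]; apply: le_lt_trans.
rewrite le_eqVlt; apply/orP; left; apply/eqP; apply: eq_integral => x _ /=.
by rewrite powR_mulrn// -normrX.
Qed.

Lemma L2_measurable f : L2 mu f -> measurable_fun setT f.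
Proof. by move=> /L2E[]. Qed.

Lemma L2_integrableM f g : L2 mu f -> L2 mu g ->
  mu.-integrable setT (EFin \o (f \* g)).
Proof. by move=> f2 g2; apply/Lfun1_integrable; exact: Lfun2_mul_Lfun1. Qed.

Lemma L2innerC f g : ip f g = ip g f.
Proof. by apply: eq_Rintegral => x _; rewrite mulrC. Qed.

Lemma L2innerDl f g h : L2 mu f -> L2 mu g -> L2 mu h ->
  ip (f + g) h = ip f h + ip g h.
Proof.
move=> f2 g2 h2; rewrite -RintegralD//; try exact: L2_integrableM.
by apply: eq_Rintegral => x _; rewrite -mulrDl.
Qed.

Lemma L2innerZl a f g : L2 mu f -> L2 mu g -> ip (a *: f) g = a * ip f g.
Proof.
move=> f2 g2; rewrite -RintegralZl//; last exact: L2_integrableM.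
by apply: eq_Rintegral => x _; rewrite mulrA.
Qed.

Lemma L2inner_ge0 f : 0 <= ip f f.
Proof. by apply: Rintegral_ge0 => x _; rewrite -expr2 sqr_ge0. Qed.

Lemma L2innerE f : L2 mu f -> (ip f f)%:E = (\int[mu]_x (f x ^+ 2)%:E)%E.
Proof.
move=> f2; rewrite fineK ?integrable_fin_num//.
exact: L2_integrableM.
Qed.

Lemma L2norm_inner f : L2 mu f -> L2norm mu f = (Num.sqrt (ip f f))%:E.
Proof.
move=> f2; rewrite /L2norm unlock.
under eq_integral do rewrite /= powR_mulrn// -normrX ger0_norm ?sqr_ge0//.
by rewrite -L2innerE// poweR_EFin powR12_sqrt// L2inner_ge0.
Qed.

Lemma L2inner_eq0 f : L2 mu f -> ip f f = 0 -> {ae mu, forall x, f x = 0}.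
Proof.
move=> f2 f0; have := L2innerE f2; rewrite f0 => /esym.
have [mf _] := (L2E f).1 f2.
have mf2 : measurable_fun setT (EFin \o (fun x => f x ^+ 2)).
  by apply/measurable_EFinP; exact: measurable_funX.
under eq_integral do rewrite -[X in X%:E]ger0_norm ?sqr_ge0// -abse_EFin.
move/(ae_eq_integral_abs mu measurableT mf2).
apply: filterS => x /(_ I)/= [] /eqP.
by rewrite sqrf_eq0 => /eqP.
Qed.

Lemma V_L2 (f : V) : L2 mu f.
Proof. exact: LfunP. Qed.

Definition L2_of (f : T -> R) (f2 : L2 mu f) : V :=
  @Lfun_Sub _ _ _ mu 2%:E (lee1n 2) f f2.

Let dot (f g : V) : R := L2inner mu f g.

Lemma V_dotC f g : dot f g = dot g f.
Proof. exact: L2innerC. Qed.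

Lemma V_dotDl f g h : dot (f + g) h = dot f h + dot g h.
Proof. by apply: L2innerDl; exact: V_L2. Qed.

Lemma V_dotZl a f g : dot (a *: f) g = a * dot f g.
Proof. by apply: L2innerZl; exact: V_L2. Qed.

Lemma V_dot_ge0 f : 0 <= dot f f.
Proof. exact: L2inner_ge0. Qed.

Lemma limn_einf_le_cst (w : (\bar R)^nat) (c : \bar R) K :
  (forall k, (K <= k)%N -> (w k <= c)%E) -> (limn_einf w <= c)%E.
Proof.
move=> wc; rewrite limn_einf_lim; apply: lime_le; first exact: is_cvg_einfs.
apply: nearW => n; apply: (@le_trans _ _ (w (maxn n K))).
  by apply: ereal_inf_lbound; exists (maxn n K) => //=; exact: leq_maxl.
by apply: wc; exact: leq_maxr.
Qed.

(** On a finite measure space, geometric decay of the increments in L^2 gives geometric decay in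
    L^1. Hence the telescoping series converges absolutely almost everywhere. *)
Lemma L2_fast_cvg (v : nat -> T -> R) : (mu setT < +oo)%E ->
  (forall k, L2 mu (v k)) ->
  (forall k, ip (v k.+1 - v k) (v k.+1 - v k) <= 4^-1 ^+ k) ->
  exists2 u : T -> R, measurable_fun setT u & {ae mu, forall x, v ^~ x @ \oo --> u x}.
Proof.
move=> muT v2 vk.
pose D k x : R := `|v k.+1 x - v k x|.
have mv k : measurable_fun setT (v k) by exact: L2_measurable.
have mD k : measurable_fun setT (D k).
  by apply: measurableT_comp => //; exact: measurable_funB.
pose M := fine (mu setT).
have ME : mu setT = M%:E by rewrite /M fineK// ge0_fin_numE.
have intD k : (\int[mu]_x (D k x)%:E <= ((1 + M) / (2 ^ (k + 0.+1))%:R)%:E)%E.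
  have d2 : L2 mu (v k.+1 - v k).
    exact: (V_L2 (L2_of (v2 k.+1) - L2_of (v2 k))).
  pose a : R := 2 ^+ k.
  have a0 : 0 < a by rewrite exprn_gt0.
  (* Young's inequality |d| <= (a d^2 + 1/a) / 2. The choice a = 2^k balances the bound 4^-k against
     the total mass and yields the term of a geometric series of ratio 1/2. *)
  apply: (@le_trans _ _ (\int[mu]_x ((a / 2)%:E * ((v k.+1 x - v k x) ^+ 2)%:E + (a^-1 / 2)%:E))%E).
    apply: ge0_le_integral => //.
    - by move=> x _; rewrite lee_fin normr_ge0.
    - exact/measurable_EFinP/mD.
    - apply: emeasurable_funD => //; apply: emeasurable_funM => //.
      apply/measurable_EFinP; apply: measurable_funX; exact: measurable_funB.
    - move=> x _; rewrite -EFinM -EFinD lee_fin -(real_normK (num_real (_ - _))) -/(D k x).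
      have := sqr_ge0 (a * D k x - 1).
      rewrite -(ler_pM2l (mulr_gt0 (ltr0n _ 2) a0)) => H.
      rewrite [leRHS](_ : _ = (a * D k x) ^+ 2 + 1); last by field; rewrite gt_eqF.
      lra.
  rewrite ge0_integralD//; last first.
  - by move=> x _; rewrite lee_fin ltW// divr_gt0 ?invr_gt0.
  - by apply: emeasurable_funM => //; apply/measurable_EFinP; apply: measurable_funX; exact: measurable_funB.
  - by move=> x _; rewrite -EFinM lee_fin mulr_ge0 ?sqr_ge0// ltW// divr_gt0.
  rewrite ge0_integralZl//; last 3 first.
  - by apply/measurable_EFinP; apply: measurable_funX; exact: measurable_funB.
  - by move=> x _; rewrite lee_fin sqr_ge0.
  - by rewrite lee_fin ltW// divr_gt0.
  rewrite -(L2innerE d2) integral_cst//= ME -!EFinM -EFinD lee_fin.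
  apply: (@le_trans _ _ (a / 2 * 4^-1 ^+ k + a^-1 / 2 * M)).
    by rewrite lerD2r ler_wpM2l// ltW// divr_gt0.
  rewrite le_eqVlt; apply/orP; left; apply/eqP.
  rewrite addn1 expnS natrM natrX -/a.
  have -> : 4^-1 ^+ k = a^-1 * a^-1 :> R.
    by rewrite -invfM -exprMn -exprVn; congr (_ ^+ _); lra.
  by field; rewrite gt_eqF.
have sumfin : (\int[mu]_x (\sum_(k <oo) (D k x)%:E) < +oo)%E.
  rewrite integral_nneseries//; last 2 first.
  - by move=> k; exact/measurable_EFinP/mD.
  - by move=> k x _; rewrite lee_fin normr_ge0.
  apply: le_lt_trans (ltry ((1 + M) / 2 ^+ 0)).
  rewrite -(cvg_lim _ (@cvg_geometric_eseries_half R (1 + M) 0))//.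
  apply: lee_nneseries => [k _ _|k _]; last exact: intD.
  by apply: integral_ge0 => x _; rewrite lee_fin normr_ge0.
have mS : measurable_fun setT (fun x => \sum_(k <oo) (D k x)%:E)%E.
  by apply: ge0_emeasurable_sum => // [k x _ _|k _]; [rewrite lee_fin normr_ge0|exact/measurable_EFinP/mD].
have intS : mu.-integrable setT (fun x => \sum_(k <oo) (D k x)%:E)%E.
  apply/integrableP; split=> //.
  under eq_integral => x _.
    rewrite gee0_abs; last by apply: nneseries_ge0 => k _ _; rewrite lee_fin normr_ge0.
    over.
  exact: sumfin.
pose E := [set x | (\sum_(k <oo) (D k x)%:E)%E \is a fin_num].
have mE : measurable E.
  by have := emeasurable_fin_num measurableT mS; rewrite setTI.
have cvgE x : E x -> cvgn (v ^~ x).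
  move=> Ex.
  have /cvg_ex[l vl] : cvgn (series (telescope (v ^~ x))).
    apply: normed_cvg; apply: nondecreasing_is_cvgn.
      apply/nondecreasing_seqP => n; rewrite /= /series/= big_nat_recr//=.
      by rewrite lerDl.
    exists (fine (\sum_(k <oo) (D k x)%:E)%E) => _ [n _ <-] /=.
    rewrite -lee_fin fineK// -sumEFin; apply: nneseries_lim_ge => k _ _.
    by rewrite lee_fin normr_ge0.
  apply/cvg_ex; exists (v 0%N x + l).
  rewrite (_ : v ^~ x = (fun n => v 0%N x + series (telescope (v ^~ x)) n)).
    by apply: cvgD => //; exact: cvg_cst.
  by apply/funext => n; rewrite -eq_sum_telescope.
(* Cutting off outside [E] makes the sequence converge at every point, so that its limit is
   measurable. *)
pose h k := v k \_ E.
pose u x := limn (h ^~ x).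
have hu x : h ^~ x @ \oo --> u x.
  rewrite /u /h; have [Ex|Ex] := pselect (E x).
    by rewrite (_ : (fun k => _) = v ^~ x); [exact: cvgE|apply/funext => k; rewrite patchE (mem_set Ex)].
  rewrite (_ : (fun k => _) = cst 0); first exact: is_cvg_cst.
  by apply/funext => k; rewrite patchE (memNset Ex).
exists u.
  apply: (@measurable_fun_cvg _ _ _ setT h) => // k.
  by apply/(measurable_restrictT _ mE); apply: measurable_funTS; exact: mv.
have := integrable_ae measurableT intS; apply: filterS => x /(_ I) Ex.
have := hu x; rewrite (_ : h ^~ x = v ^~ x)//.
by apply/funext => k; rewrite /h patchE (mem_set (Ex : E x)).
Qed.

End L2_space.

Section L2_complete.
Context d (T : measurableType d) (R : realType).
Variable mu : {measure set T -> \bar R}.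
Local Notation V := (LfunType mu (lee1n 2 : (1 <= 2%:E)%E)).
Hypothesis muT : (mu setT < +oo)%E.
Let dot (f g : V) : R := L2inner mu f g.

(** The Riesz-Fischer argument: a subsequence with geometric increments has an almost everywhere
    limit, and Fatou's lemma turns the Cauchy bounds into bounds on the distance to this limit. *)
Lemma V_complete (u_ : nat -> V) : dot_cauchy dot u_ -> exists u, dot_cvg dot u_ u.
Proof.
move=> uC.
have /choice[N NP] k : exists N, forall m n, (N <= m)%N -> (N <= n)%N ->
    dot (u_ m - u_ n) (u_ m - u_ n) <= 4^-1 ^+ k.
  by apply: uC; rewrite exprn_gt0// invr_gt0.
(* The sum puts both [phi k] and [phi k.+1] beyond [N k]; the summand [k] makes [phi] tend to
   infinity. *)
pose phi k := (k + \sum_(i < k.+1) N i)%N.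
have phiN k : (N k <= phi k)%N.
  by rewrite /phi big_ord_recr/= addnA leq_addl.
have phiNS k : (N k <= phi k.+1)%N.
  rewrite /phi big_ord_recr/= big_ord_recr/=.
  apply: leq_trans (leq_addl _ _); apply: leq_trans (leq_addr _ _).
  exact: leq_addl.
pose v k : T -> R := u_ (phi k).
have [u mu_ vu] : exists2 u : T -> R, measurable_fun setT u &
    {ae mu, forall x, v ^~ x @ \oo --> u x}.
  apply: L2_fast_cvg => // k; first exact: V_L2.
  exact: (NP k).
(* Fatou's lemma along the subsequence with [n] fixed. This single bound gives both the
   square-integrability of [u] and the convergence. *)
have fat e : 0 < e -> exists N, forall n, (N <= n)%N ->
    (\int[mu]_x ((u_ n x - u x) ^+ 2)%:E <= e%:E)%E.
  move=> e0; have [M MP] := uC e e0; exists M => n Mn.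
  have mun : measurable_fun setT (u_ n) by apply: L2_measurable; exact: V_L2.
  have mv k : measurable_fun setT (v k) by apply: L2_measurable; exact: V_L2.
  pose f k x := ((u_ n x - v k x) ^+ 2)%:E.
  have mf k : measurable_fun setT (f k).
    by apply/measurable_EFinP/measurable_funX/measurable_funB.
  have -> : (\int[mu]_x ((u_ n x - u x) ^+ 2)%:E = \int[mu]_x limn_einf (f ^~ x))%E.
    apply: ae_eq_integral => //.
    - by apply/measurable_EFinP/measurable_funX/measurable_funB.
    - rewrite (_ : (fun x => _) = (fun x => - limn_esup ((fun k => \- f k) ^~ x))%E).
        apply: measurableT_comp => //; apply: measurable_fun_limn_esup => k.
        by apply: measurableT_comp => //; exact: mf.
      by apply/funext => x; rewrite -[LHS]oppeK -limn_esupN.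
    - apply: filterS vu => x vx _; rewrite (cvg_limn_einf_sup (l := ((u_ n x - u x) ^+ 2)%:E))//.
      apply: cvg_EFin; first exact: nearW.
      rewrite (_ : fine \o _ = fun k => (u_ n x - v k x) * (u_ n x - v k x)) ?expr2//.
      by apply: cvgM; apply: cvgB => //; exact: cvg_cst.
  apply: le_trans (fatou mu measurableT mf _) _.
    by move=> k x _; rewrite lee_fin sqr_ge0.
  apply: (@limn_einf_le_cst _ _ _ M) => k Mk.
  rewrite -(L2innerE (V_L2 (u_ n - u_ (phi k)))) lee_fin.
  apply: MP => //; apply: leq_trans Mk _; exact: leq_addr.
have u2 : L2 mu u.
  have [M /(_ M (leqnn _)) MP] := fat 1 ltr01.
  have d2 : L2 mu (fun x => u_ M x - u x).
    have mM : measurable_fun setT (u_ M) by apply: L2_measurable; exact: V_L2.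
    apply/L2E; split; first exact: measurable_funB.
    apply/integrableP; split.
      by apply/measurable_EFinP/measurable_funX/measurable_funB.
    apply: le_lt_trans (ltry 1); apply: le_trans MP.
    by under eq_integral do rewrite /= ger0_norm ?sqr_ge0//.
  have -> : u = u_ M - L2_of d2.
    by apply/funext => x /=; rewrite fctE /= opprB addrC subrK.
  exact: V_L2.
exists (L2_of u2) => e /fat[M MP]; exists M => n /MP.
by rewrite -lee_fin /dot L2innerE//; exact: V_L2.
Qed.

End L2_complete.

(** * Spectral gap of a self-adjoint operator given by its graph *)

Section spectral_gap_bounds.
Context d (T : measurableType d) (R : realType).
Variable mu : {measure set T -> \bar R}.
Local Notation V := (LfunType mu (lee1n 2 : (1 <= 2%:E)%E)).
Local Notation ip := (L2inner mu).
Hypothesis muT : (mu setT < +oo)%E.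
Variables (L : operator T R) (lambda U : R) (k : T -> R) (q : R).
Let one : T -> R := fun=> 1.
Hypothesis L_sa : forall f g, L f g <-> adjoint mu L f g.
Hypothesis L_one : L one (fun=> 0).
Hypothesis one_gt0 : 0 < ip one one.
Hypothesis lambda_gt0 : 0 < lambda.
Hypothesis gap : forall f g, L f g -> ip f one = 0 ->
  lambda * ip f f <= - ip g f.
Hypothesis k2 : L2 mu k.
Hypothesis k_one : ip k one = 0.
Hypothesis k_gt0 : 0 < ip k k.
Hypothesis qU : q <= U * ip k k.
Hypothesis U_ge0 : 0 <= U.
Hypothesis form : forall f g, L f g -> ip g k ^+ 2 <= - ip g f * q.

Let dot (f g : V) : R := ip f g.
Let A (f g : V) := L f (- g).

Lemma L2innerNl f g : L2 mu f -> L2 mu g -> ip (- f) g = - ip f g.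
Proof. by move=> f2 g2; rewrite -scaleN1r L2innerZl// mulN1r. Qed.

Lemma generator_sa (f g : V) : A f g <-> forall u v, A u v -> dot v f = dot u g.
Proof.
split=> [/L_sa[_ _ H] u v /H|H].
  rewrite L2innerNl; [|exact: V_L2|exact: V_L2].
  rewrite (L2innerC _ u) L2innerNl; [|exact: V_L2|exact: V_L2].
  by rewrite (L2innerC _ g) => /oppr_inj.
apply/L_sa; split; [exact: V_L2|exact: (V_L2 (- g))|].
move=> u v uv; have [u2 v2 _] := (L_sa u v).1 uv.
have /(H (L2_of u2) (- L2_of v2)) : A (L2_of u2) (- L2_of v2).
  by rewrite /A opprK.
rewrite /dot L2innerNl//; last exact: V_L2.
move=> /(congr1 -%R); rewrite opprK => ->.
rewrite [RHS]L2innerC [ip (L2_of u2) g]L2innerC.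
by apply/esym; exact: (L2innerNl (V_L2 g) u2).
Qed.

Let one2 : L2 mu one.
Proof.
apply/L2E; split; first exact: measurable_cst.
apply/integrableP; split; first by apply/measurable_EFinP; exact: measurable_funX (measurable_cst _).
under eq_integral do rewrite /= expr1n normr1.
by rewrite integral_cst// mul1e.
Qed.

Let dotC := @V_dotC _ _ _ mu.
Let dotDl := @V_dotDl _ _ _ mu.
Let dotZl := @V_dotZl _ _ _ mu.
Let dot_ge0 := @V_dot_ge0 _ _ _ mu.
Let dot_complete := V_complete muT.

Let Agap (f g : V) : A f g -> dot f (L2_of one2) = 0 -> lambda * dot f f <= dot g f.
Proof.
move=> fg f1; apply: le_trans (gap fg f1) _.
by rewrite L2innerNl ?opprK//; exact: V_L2.
Qed.

Let A_one : A (L2_of one2) 0.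
Proof. by rewrite /A oppr0. Qed.

(** Norm bounds become bounds on squared norms, whence the square and the square root of the
    constants. Uniqueness of the solution almost everywhere is recovered from solvability and
    symmetry. *)
Let resP l : resolvent_set mu (opp_operator L) l <->
  exists C, forall h : V, exists2 f, A f (h + l *: f) & dot f f <= C * dot h h.
Proof.
split=> [[C HC]|[C HC]].
  exists (C ^+ 2) => h; have [f [fh fC _]] := HC _ (V_L2 h).
  have [f2 _ _] := (L_sa _ _).1 fh.
  exists (L2_of f2) => //.
  move: fC; rewrite !L2norm_inner//; last exact: V_L2.
  rewrite -EFinM lee_fin => fC.
  rewrite /dot -[leLHS]sqr_sqrtr ?L2inner_ge0// -[X in _ * X]sqr_sqrtr ?L2inner_ge0//.
  rewrite -exprMn lerXn2r// nnegrE ?sqrtr_ge0//.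
  exact: le_trans fC.
pose C' := Num.max C 0; exists (Num.sqrt C') => g g2.
have [f fg fC] := HC (L2_of g2).
exists f; split=> //.
  rewrite !L2norm_inner//; last exact: V_L2.
  rewrite -EFinM lee_fin -sqrtrM ?le_max ?lexx ?orbT// ler_wsqrtr//.
  by apply: le_trans fC _; rewrite ler_wpM2r ?L2inner_ge0// le_max lexx.
move=> f' f'g; have [f'2 _ _] := (L_sa _ _).1 f'g.
have Aw : A (L2_of f'2 - f) (l *: (L2_of f'2 - f)).
  have f'g' : A (L2_of f'2) (L2_of g2 + l *: L2_of f'2) by [].
  have -> : L2_of f'2 - f = -1 *: f + L2_of f'2 by rewrite scaleN1r addrC.
  have -> : l *: (-1 *: f + L2_of f'2) =
      -1 *: (L2_of g2 + l *: f) + (L2_of g2 + l *: L2_of f'2).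
    by rewrite !scaleN1r opprD addrACA addNr add0r scalerDr scalerN.
  exact: (sa_lin dotC dotDl dotZl generator_sa (- 1) fg f'g').
set w := L2_of f'2 - f in Aw.
(* The difference [w] of two solutions satisfies (A - l) w = 0. Solving (A - l) u = w and moving A -
   l to the other side gives <w, w> = <(A - l) w, u> = 0. *)
have w0 : dot w w = 0.
  have [u uw _] := HC w.
  have := sa_sym generator_sa Aw uw.
  have E1 : dot (w + l *: u) w = dot w w + l * dot u w.
    by apply: etrans (dotDl _ _ _) _; congr (_ + _); exact: dotZl.
  have E2 : dot u (l *: w) = l * dot u w.
    by apply: etrans (dotC _ _) _; apply: etrans (dotZl _ _ _) _; rewrite (dotC w u).
  by rewrite E1 E2 => /(congr1 (fun z => z - l * dot u w)); rewrite addrK subrr.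
have := L2inner_eq0 (V_L2 w) w0; apply: filterS => x /eqP.
by rewrite subr_eq0 => /eqP.
Qed.

Lemma spectral_gap_bounds : lambda <= spectral_gap mu (opp_operator L) <= U.
Proof.
set S := [set l | spectrum mu (opp_operator L) `<=` [set 0] `|` [set x | l <= x]].
have Slambda : S lambda.
  move=> l /= sl; have [->|l0] := eqVneq l 0; [by left|right].
  rewrite /= real_leNgt ?num_real//; apply/negP => llam; apply: sl; apply/resP.
  have [c c0 low] := sa_resolvent_bound dotC dotDl dotZl dot_ge0 generator_sa A_one one_gt0 Agap llam l0.
  exists c^-1 => h.
  have [f fh] := sa_surjective dotC dotDl dotZl dot_ge0 dot_complete generator_sa c0 low h.
  by exists f => //; rewrite ler_pdivlMl//; have := low _ _ fh; rewrite addrK.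
have [r rr rU] : exists2 r, rayleigh dot A (L2_of one2) r & r <= U.
  apply: (rayleigh_le_form dotC dotDl dotZl dot_ge0 dot_complete generator_sa A_one one_gt0 lambda_gt0 Agap (k := L2_of k2) (q := q)) => //.
  move=> f g fg; have := form fg.
  have E1 := L2innerNl (V_L2 g) k2; have E2 := L2innerNl (V_L2 g) (V_L2 f).
  by rewrite E1 E2 sqrrN opprK.
have rge := rayleigh_ge Agap.
have SU : ubound S U.
  move=> l Sl; set m := inf (rayleigh dot A (L2_of one2)).
  have mU : m <= U.
    by apply: le_trans rU; apply: ge_inf => //; exists lambda => ? /rge.
  have lm : lambda <= m by apply: lb_le_inf; [exists r|move=> ? /rge].
  apply: le_trans mU; have /Sl : spectrum mu (opp_operator L) m.
    move=> /resP; apply: (rayleigh_inf_spectrum dotC dotDl dotZl dot_ge0 generator_sa A_one lambda_gt0 Agap).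
    by exists r.
  (* The infimum lies in the spectrum and is at least [lambda], hence nonzero, so it can only fall
     in the half-line starting at [l]. *)
  by case=> // m0; move: lm; rewrite m0 real_leNgt ?num_real// lambda_gt0.
apply/andP; split; first by apply: ub_le_sup => //; exists U.
by apply: ge_sup => //; exists lambda.
Qed.

End spectral_gap_bounds.

(** * Kershaw's inequality *)

Section pointwise_derivatives.
Context {R : realType}.
Implicit Types (f g : R -> R) (x a b c : R).

Lemma derD f g x a b : is_derive x 1 f a -> is_derive x 1 g b ->
  is_derive x 1 (fun y => f y + g y) (a + b).
Proof. exact: is_deriveD. Qed.

Lemma derB f g x a b : is_derive x 1 f a -> is_derive x 1 g b ->
  is_derive x 1 (fun y => f y - g y) (a - b).
Proof. exact: is_deriveB. Qed.

Lemma derN f x a : is_derive x 1 f a -> is_derive x 1 (fun y => - f y) (- a).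
Proof. exact: is_deriveN. Qed.

Lemma derM f g x a b : is_derive x 1 f a -> is_derive x 1 g b ->
  is_derive x 1 (fun y => f y * g y) (a * g x + f x * b).
Proof.
move=> fa gb; have h := @is_deriveM _ _ f g x 1 a b fa gb.
by apply: is_derive_eq; rewrite addrC (mulrC a).
Qed.

Lemma derZ c f x a : is_derive x 1 f a -> is_derive x 1 (fun y => c * f y) (c * a).
Proof. by move=> fa; exact: (@is_deriveZ _ _ _ f c x 1 a fa). Qed.

Lemma der_comp f g x a b : is_derive (g x) 1 f a -> is_derive x 1 g b ->
  is_derive x 1 (fun y => f (g y)) (a * b).
Proof. exact: is_derive1_comp. Qed.

Lemma der_cst c x : is_derive x 1 (fun=> c) 0.
Proof. exact: is_derive_cst. Qed.

Lemma der_id x : is_derive x 1 (fun y : R => y) 1.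
Proof. exact: is_derive_id. Qed.

Lemma le_of_derive_ge0 f df a b : a <= b ->
  (forall x, a <= x <= b -> is_derive x 1 f (df x)) ->
  (forall x, a <= x <= b -> 0 <= df x) -> f a <= f b.
Proof.
move=> ab fd d0; have [| |c cab fE] := @MVT_segment R f df a b ab.
- move=> x; rewrite in_itv/= => /andP[ax xb]; apply: fd.
  by rewrite !ltW.
- apply: derivable_within_continuous => x; rewrite in_itv/= => /fd h.
  exact: ex_derive.
- rewrite -subr_ge0 fE mulr_ge0 ?subr_ge0//; apply: d0.
  by move: cab; rewrite in_itv.
Qed.

End pointwise_derivatives.

Section kershaw.
Context {R : realType}.
Implicit Types (f df : R -> R) (a b x t q r c s : R).

(** The function ln((1 + s) / (1 - s)) is convex on [0, 1) and vanishes at 0. Here the difference of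
    the two sides, as a function of [r], vanishes at 0 and has a nonnegative derivative. *)
Lemma ln_ratio_contract r q : 0 <= r < 1 -> 0 <= q <= 1 ->
  ln (1 + q * r) - ln (1 - q * r) <= q * (ln (1 + r) - ln (1 - r)).
Proof.
move=> /andP[r0 r1] /andP[q0 q1]; rewrite -subr_ge0.
(* The factors 1 and -1 are kept so that all four logarithms are instances of [dln]. *)
pose f s : R := q * (ln (1 + 1 * s) - ln (1 + -1 * s)) -
  (ln (1 + q * s) - ln (1 + - q * s)).
pose df s : R := q * (1 * (1 + 1 * s)^-1 - -1 * (1 + -1 * s)^-1)
  - (q * (1 + q * s)^-1 - - q * (1 + - q * s)^-1).
have f0 : f 0 = 0 by rewrite /f !mulr0 addr0 !subrr mulr0 subr0.
have -> : q * (ln (1 + r) - ln (1 - r)) - (ln (1 + q * r) - ln (1 - q * r)) = f r.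
  by rewrite /f !mulNr !mul1r.
have dln c s : 0 < 1 + c * s ->
    is_derive s 1 (fun x => ln (1 + c * x)) (c * (1 + c * s)^-1).
  move=> cs; rewrite mulrC; apply: (@der_comp _ (@ln R)); first exact: is_derive1_ln.
  apply: is_derive_eq (derD (der_cst 1 s) (derZ c (der_id s))) _.
  by rewrite add0r mulr1.
rewrite -f0; apply: (@le_of_derive_ge0 _ f df) => // s /andP[s0 sr];
  have qs : q * s <= s by rewrite ler_piMl.
all: have qs0 : 0 <= q * s by rewrite mulr_ge0.
  by apply: derB; [apply: derZ|]; apply: derB; apply: dln; lra.
have -> : df s = 2 * q * (s ^+ 2 * (1 - q ^+ 2)) / ((1 + s) * (1 - s) * ((1 + q * s) * (1 - q * s))).
  by rewrite /df; field; rewrite !gt_eqF//; lra.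
by rewrite divr_ge0 ?mulr_ge0 ?subr_ge0 ?sqr_ge0 ?exprn_ile1//; lra.
Qed.

(** Taking logarithms reduces this to [ln_ratio_contract] at r = 1 / (2 a). It compares the endpoint
    ratios of two intervals with common midpoint [a], of lengths [q] and 1. *)
Lemma powR_ratio_contract a q : 2^-1 < a -> 0 <= q <= 1 ->
  (a + q / 2) / (a - q / 2) <= ((a + 2^-1) / (a - 2^-1)) `^ q.
Proof.
move=> a2 /andP[q0 q1].
have ha : 0 < (a + 2^-1) / (a - 2^-1) by rewrite divr_gt0; lra.
have hq : 0 < (a + q / 2) / (a - q / 2) by rewrite divr_gt0; lra.
rewrite -ler_ln ?posrE ?powR_gt0// ln_powR.
have a0 : a != 0 by rewrite gt_eqF; lra.
have E u : 0 <= u <= 1 -> ln ((a + u / 2) / (a - u / 2)) =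
    ln (1 + u * (2 * a)^-1) - ln (1 - u * (2 * a)^-1).
  move=> /andP[u0 u1]; have h : u * (2 * a)^-1 < 1.
    by rewrite ltr_pdivrMr; lra.
  have h0 : 0 <= u * (2 * a)^-1 by rewrite mulr_ge0 ?invr_ge0; lra.
  rewrite -ln_div ?posrE//; [|lra|lra].
  by congr ln; field; rewrite !gt_eqF//; lra.
rewrite E ?q0// -[X in ln ((a + X) / (a - X))]mul1r E ?ler01 ?lexx// !mul1r.
apply: ln_ratio_contract; last by rewrite q0.
by rewrite invr_ge0 invf_lt1; lra.
Qed.

(** The weighted arithmetic-geometric mean inequality for [z] and 1. With m their weighted mean, ln
    y <= y - 1 is used at z / m and 1 / m, where the weighted right-hand sides sum to zero. *)
Lemma powR_le_affine z t : 0 <= z -> 0 <= t <= 1 -> z `^ t <= 1 - t + t * z.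
Proof.
rewrite le_eqVlt => /predU1P[<-|z0] /andP[t0 t1].
  have [->|tN0] := eqVneq t 0; first by rewrite powRr0; lra.
  by rewrite powR0//; lra.
have m0 : 0 < 1 - t + t * z by nra.
rewrite -ler_ln ?posrE ?powR_gt0// ln_powR.
have lnB x : 0 < x -> ln x <= x - 1.
  by move=> x0; have := @le_ln1Dx R (x - 1); rewrite (_ : 1 + (x - 1) = x); [apply; lra|ring].
have h1 := lnB _ (divr_gt0 z0 m0); have h2 := lnB _ (divr_gt0 ltr01 m0).
rewrite !ln_div ?posrE// ln1 in h1 h2.
have E : t * (z / (1 - t + t * z)) + (1 - t) * (1 / (1 - t + t * z)) = 1.
  by field; rewrite gt_eqF.
have k1 := ler_wpM2l t0 h1.
have k2 : (1 - t) * (0 - ln (1 - t + t * z)) <= (1 - t) * (1 / (1 - t + t * z) - 1).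
  by apply: ler_wpM2l => //; lra.
move: k1 k2 E.
move: (ln z) (ln (1 - t + t * z)) (z / _) (1 / _) => a b c d; lra.
Qed.

Variables (G : R -> R) (u0 : R).
Hypothesis u0_gt0 : 0 < u0.
Hypothesis G_gt0 : forall u, u0 <= u -> 0 < G u.
Hypothesis G_succ : forall u, u0 <= u -> G (u + 1) = u * G u.
Hypothesis G_interp : forall u t, u0 <= u -> 0 <= t <= 1 -> G (u + t) <= G u * u `^ t.

(* Kershaw's inequality: r n below is increasing in n, and its values are at
   most 1 + 1 / (x + n) by log-convexity. *)
Lemma kershaw x t : u0 <= x -> 0 <= t <= 1 ->
  G (x + t) * (x + t / 2) `^ (1 - t) <= G (x + 1).
Proof.
move=> ux /andP[t0 t1]; have x0 := lt_le_trans u0_gt0 ux.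
pose r n := G (x + n%:R + t) * (x + n%:R + t / 2) `^ (1 - t) / G (x + n%:R + 1).
have n0 n : 0 <= n%:R :> R by [].
have Gp n : 0 < G (x + n%:R + 1) by apply: G_gt0; have := n0 n; lra.
have r_inc n : r n <= r n.+1.
  have nn := n0 n.
  rewrite /r ler_pdivrMr// mulrAC ler_pdivlMr; last exact: Gp.
  have -> : x + n.+1%:R + t = (x + n%:R + t) + 1 by rewrite -natr1; ring.
  have -> : x + n.+1%:R + 1 = (x + n%:R + 1) + 1 by rewrite -natr1; ring.
  rewrite (@G_succ (x + n%:R + 1)); last lra.
  rewrite (@G_succ (x + n%:R + t)); last lra.
  have -> : x + n.+1%:R + t / 2 = (x + n%:R + t / 2) + 1 by rewrite -natr1; ring.
  set y := x + n%:R.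
  have y0 : 0 < y by rewrite /y; lra.
  (* After the functional equation, monotonicity of [r] compares the endpoint ratio of
     [y + t, y + 1] with that of [y + t/2, y + t/2 + 1]. Both intervals have midpoint y + (1 + t) /
     2. *)
  have := @powR_ratio_contract (y + (1 + t) / 2) (1 - t).
  have -> : y + (1 + t) / 2 + (1 - t) / 2 = y + 1 by field.
  have -> : y + (1 + t) / 2 - (1 - t) / 2 = y + t by field.
  have -> : y + (1 + t) / 2 + 2^-1 = y + t / 2 + 1 by field.
  have -> : y + (1 + t) / 2 - 2^-1 = y + t / 2 by field.
  move=> /(_ _ _)/wrap[]; [lra|lra|].
  rewrite powRM ?invr_ge0; [|lra|lra].
  have -> : (y + t / 2)^-1 `^ (1 - t) = ((y + t / 2) `^ (1 - t))^-1.
    by rewrite -powR_inv1 -?powRrM ?mulN1r ?powRN//; lra.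
  rewrite ler_pdivrMr; last lra.
  rewrite mulrAC ler_pdivlMr; last by apply: powR_gt0; lra.
  move=> H; have G1 := G_gt0 (_ : u0 <= y + t); have G2 := Gp n; rewrite -/y in G2.
  have : 0 <= G (y + t) * G (y + 1) by rewrite mulr_ge0// ltW// G1//; rewrite /y; lra.
  move=> /(ler_wpM2l)/(_ _ _ H).
  by congr (_ <= _); ring.
have r_le n : r n <= 1 + (x + n%:R)^-1.
  have nn := n0 n; set y := x + n%:R; have y0 : 0 < y by rewrite /y; lra.
  have uy : u0 <= y by rewrite /y; lra.
  have Gy := G_gt0 uy.
  rewrite /r -/y ler_pdivrMr//; last exact: Gp.
  rewrite G_succ//.
  apply: (@le_trans _ _ (G y * y `^ t * (y + t / 2) `^ (1 - t))).
    by apply: ler_wpM2r; rewrite ?powR_ge0// G_interp// t0.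
  rewrite mulrA [leRHS]mulrC -mulrA ler_pM2l//.
  have -> : (1 + y^-1) * y = y + 1 by field; rewrite gt_eqF.
  apply: (@le_trans _ _ ((y + 1) `^ t * (y + 1) `^ (1 - t))).
    by apply: ler_pM; rewrite ?powR_ge0//; apply: ge0_ler_powR; rewrite ?nnegrE; lra.
  rewrite -powRD; last by apply/implyP => _; rewrite gt_eqF//; lra.
  by rewrite (_ : t + (1 - t) = 1) ?powRr1//; [lra|ring].
have r0 n : r 0%N <= 1 + (x + n%:R)^-1.
  apply: le_trans (r_le n); elim: n => // n ih.
  exact: le_trans ih (r_inc n).
have : r 0%N <= 1.
  apply/ler_addgt0Pr => e e0; apply: le_trans (r0 (Num.truncn e^-1).+1) _.
  rewrite lerD2l -[leRHS]invrK lef_pV2 ?posrE ?invr_gt0//; last first.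
    by have := n0 (Num.truncn e^-1).+1; lra.
  by apply: ltW; rewrite (lt_le_trans (truncnS_gt _))// lerDr ltW.
by rewrite /r !addr0 ler_pdivrMr ?mul1r//; have := Gp 0%N; rewrite addr0.
Qed.

End kershaw.

(** * A two-sided weighted Hardy inequality *)

Section hardy.
Context {R : realType}.
Local Notation leb := (@lebesgue_measure R).
Implicit Types (x s : R) (a u g w : R -> R).

Lemma ge0_integralT_reflect (f : R -> \bar R) :
  measurable_fun setT f -> (forall x, 0 <= f x)%E ->
  (\int[leb]_x f (- x)%R = \int[leb]_x f x)%E.
Proof.
move=> mf f0; rewrite -[in LHS](preimage_setT (-%R : R -> measurableTypeR R)).
rewrite -(ge0_integral_pushforward (phi := (-%R : measurableTypeR R -> measurableTypeR R)))//.
by apply: eq_measure_integral => //= A mA AS; exact: lebesgue_measureN.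
Qed.

(** One kernel for both half-lines: integrating against its indicator gives the unsigned integral
    between 0 and x whatever the sign of x, and Tonelli's theorem applies on the whole plane at
    once. *)
Definition btw x s := (0 <= s <= x) || (x <= s <= 0).

Definition btwE (x s : R) : R := (btw x s)%:R.

Lemma measurable_btwE2 :
  measurable_fun setT (fun z : measurableTypeR R * measurableTypeR R => btwE z.1 z.2).
Proof.
rewrite /btwE /btw; apply: measurableT_comp => //.
by apply: measurable_or; apply: measurable_and; apply: measurable_fun_ler.
Qed.

Lemma measurable_btwE_l s : measurable_fun setT (btwE ^~ s : measurableTypeR R -> R).
Proof. exact: (measurableT_comp measurable_btwE2 (measurable_pair2 _)). Qed.

Lemma measurable_btwE_r x : measurable_fun setT (btwE x : measurableTypeR R -> R).
Proof. exact: (measurableT_comp measurable_btwE2 (measurable_pair1 _)). Qed.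

Definition btw_int u x : \bar R := (\int[leb]_s (u s * btwE x s)%:E)%E.

Lemma btw_int_ge0 u x : (forall s, 0 <= u s) -> (0 <= btw_int u x)%E.
Proof. by move=> u0; apply: integral_ge0 => s _; rewrite lee_fin mulr_ge0. Qed.

Lemma measurable_btw_int u : measurable_fun setT u -> (forall s, 0 <= u s) ->
  measurable_fun setT (btw_int u).
Proof.
move=> mu u0; apply: (@measurable_fun_fubini_tonelli_F _ _ (measurableTypeR R) (measurableTypeR R) R leb
  (fun z => (u z.2 * btwE z.1 z.2)%:E)).
- apply/measurable_EFinP; apply: measurable_funM; last exact: measurable_btwE2.
  exact: measurableT_comp.
- by move=> z; rewrite lee_fin mulr_ge0.
Qed.

Lemma btw_int_swap a (b : R -> \bar R) : measurable_fun setT a -> (forall s, 0 <= a s) ->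
  measurable_fun setT b -> (forall x, 0 <= b x)%E ->
  (\int[leb]_x (b x * btw_int a x) =
   \int[leb]_s ((a s)%:E * \int[leb]_x (b x * (btwE x s)%:E)))%E.
Proof.
move=> ma a0 mb b0.
have mab : measurable_fun setT (fun z : measurableTypeR R * measurableTypeR R =>
    (b z.1 * (a z.2 * btwE z.1 z.2)%:E)%E).
  apply: emeasurable_funM; first exact: measurableT_comp.
  apply/measurable_EFinP; apply: measurable_funM; last exact: measurable_btwE2.
  exact: measurableT_comp.
transitivity (\int[leb]_x \int[leb]_s (b x * (a s * btwE x s)%:E))%E.
  apply: eq_integral => x _; rewrite ge0_integralZl//.
  - apply/measurable_EFinP; apply: measurable_funM => //; exact: measurable_btwE_r.
  - by move=> s _; rewrite lee_fin mulr_ge0.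
have /= -> := @fubini_tonelli _ _ _ _ R leb leb _ mab; last first.
  by move=> z; rewrite mule_ge0// lee_fin mulr_ge0.
apply: eq_integral => s _ /=; rewrite -ge0_integralZl//.
- by apply: eq_integral => x _; rewrite muleCA EFinM.
- apply: emeasurable_funM => //; apply/measurable_EFinP; exact: measurable_btwE_l.
- by move=> x _; rewrite mule_ge0// lee_fin.
- by rewrite lee_fin.
Qed.

Lemma measurable_invr_gt0 g : measurable_fun setT g -> (forall s, 0 < g s) ->
  measurable_fun setT (fun s => (g s)^-1).
Proof.
move=> mg g0; rewrite (_ : (fun s => _) = (fun s => g s `^ -1)).
  exact: (measurableT_comp (measurable_powR _)).
by apply/funext => s; rewrite powR_inv1// ltW.
Qed.

Lemma measurable_btw_int_l (b : R -> \bar R) : measurable_fun setT b ->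
  (forall x, 0 <= b x)%E ->
  measurable_fun setT (fun s => \int[leb]_x (b x * (btwE x s)%:E))%E.
Proof.
move=> mb b0; apply: (@measurable_fun_fubini_tonelli_G _ _ (measurableTypeR R) (measurableTypeR R) R leb
  (fun z => b z.1 * (btwE z.1 z.2)%:E)%E).
- apply: emeasurable_funM; first exact: measurableT_comp.
  by apply/measurable_EFinP; exact: measurable_btwE2.
- by move=> z; rewrite mule_ge0// lee_fin.
Qed.

(** Cauchy-Schwarz in the extended reals. The pointwise inequality 2 t |u| <= t^2 g + u^2 / g is
    integrated, then optimised at t = I / A, where A is the integral of [g] and I that of |u|;
    degenerate and infinite values are treated apart. *)
Lemma btw_int_CS g u x : measurable_fun setT g -> (forall s, 0 < g s) ->
  measurable_fun setT u -> (btw_int g x < +oo)%E ->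
  (btw_int (fun s => `|u s|%R) x * btw_int (fun s => `|u s|%R) x <=
   btw_int g x * btw_int (fun s => (u s ^+ 2 / g s)%R) x)%E.
Proof.
move=> mg g0 mu gfin.
have mgx : measurable_fun setT (fun s => (g s * btwE x s)%:E).
  by apply/measurable_EFinP; apply: measurable_funM => //; exact: measurable_btwE_r.
have mux : measurable_fun setT (fun s => (`|u s| * btwE x s)%:E).
  apply/measurable_EFinP; apply: measurable_funM; last exact: measurable_btwE_r.
  exact: measurableT_comp.
have mugx : measurable_fun setT (fun s => (u s ^+ 2 / g s * btwE x s)%:E).
  apply/measurable_EFinP; apply: measurable_funM; last exact: measurable_btwE_r.
  apply: measurable_funM; first exact: measurable_funX.
  exact: measurable_invr_gt0.
have A0 : (0 <= btw_int g x)%E by apply: btw_int_ge0 => s; rewrite ltW.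
have I0 : (0 <= btw_int (fun s => `|u s|%R) x)%E by exact: btw_int_ge0.
have B0 : (0 <= btw_int (fun s => (u s ^+ 2 / g s)%R) x)%E.
  by apply: btw_int_ge0 => s; rewrite divr_ge0 ?sqr_ge0// ltW.
have young t : 0 <= t -> ((2 * t)%:E * btw_int (fun s => `|u s|%R) x <=
    (t ^+ 2)%:E * btw_int g x + btw_int (fun s => (u s ^+ 2 / g s)%R) x)%E.
  move=> t0; rewrite /btw_int -!ge0_integralZl//=; last 4 first.
  - by move=> s _; rewrite lee_fin mulr_ge0// ltW.
  - by rewrite lee_fin sqr_ge0.
  - by move=> s _; rewrite lee_fin mulr_ge0.
  - by rewrite lee_fin mulr_ge0.
  rewrite -ge0_integralD//; last 3 first.
  - by move=> s _; rewrite lee_fin !mulr_ge0 ?sqr_ge0// ltW.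
  - by apply: emeasurable_funM.
  - by move=> s _; rewrite lee_fin mulr_ge0// divr_ge0 ?sqr_ge0// ltW.
  apply: ge0_le_integral => //.
  - by move=> s _; rewrite lee_fin !mulr_ge0.
  - by apply: emeasurable_funM.
  - by apply: emeasurable_funD => //; apply: emeasurable_funM.
  - move=> s _; rewrite -!EFinM -EFinD lee_fin !mulrA -mulrDl.
    apply: ler_wpM2r => //; rewrite -(real_normK (num_real (u s))).
    have gs := g0 s; rewrite -(ler_pM2r gs) mulrDl divfK ?gt_eqF//.
    have := sqr_ge0 (t * g s - `|u s|); lra.
(* If the integral of [g] is zero, positivity of [g] makes the kernel vanish almost everywhere, so
   the integral of |u| is zero too. The right-hand side is then 0 even against an infinite
   factor. *)
move: A0; rewrite le_eqVlt => /predU1P[A0|A0].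
  have : ae_eq leb setT (fun s => (g s * btwE x s)%:E) (cst 0%E).
    apply/(ae_eq_integral_abs leb measurableT mgx); rewrite A0.
    by apply: eq_integral => s _; rewrite /= ger0_norm// mulr_ge0// ltW.
  move=> ae0; suff -> : btw_int (fun s => `|u s|%R) x = 0%E by rewrite -A0 !mul0e.
  rewrite /btw_int (@ae_eq_integral _ _ _ leb setT (cst 0%E))//; first by rewrite integral0.
  apply: filterS ae0 => s /(_ I)[] /eqP; rewrite mulf_eq0 gt_eqF//= => /eqP -> _.
  by rewrite mulr0.
move: A0 gfin B0 I0 young.
case: (btw_int g x) => [A| |]//; case: (btw_int (fun s => (u s ^+ 2 / g s)%R) x) => [B| |]//; last first.
  by move=> A0 _ _ _ _; rewrite gt0_muley// leey.
move=> A0 _ B0; case: (btw_int (fun s => `|u s|%R) x) => [I'| |]//; last first.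
  move=> _ /(_ 1 ler01); rewrite mulr1 gt0_muley; last by rewrite lte_fin.
  by rewrite -EFinM -EFinD leye_eq.
rewrite !lte_fin !lee_fin in A0 B0 * => I0 young.
have /young : 0 <= I' / A by rewrite divr_ge0// ltW.
rewrite -!EFinM -EFinD !lee_fin -(ler_pM2r A0).
have -> : 2 * (I' / A) * I' * A = 2 * I' ^+ 2 by field; rewrite gt_eqF.
have -> : ((I' / A) ^+ 2 * A + B) * A = I' ^+ 2 + A * B by field; rewrite gt_eqF.
lra.
Qed.

(** The weight condition excludes [s = 0], where [btwE x 0] is 1 for every x and the integral would
    count both tails. This point is null for the outer integral. *)
Lemma hardy w g (C : R) u : 0 <= C -> measurable_fun setT w -> (forall x, 0 <= w x) ->
  measurable_fun setT g -> (forall s, 0 < g s) -> (forall x, btw_int g x < +oo)%E ->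
  (forall s, s != 0 ->
    (\int[leb]_x ((w x)%:E * btw_int g x * (btwE x s)%:E) <= (C * (g s * w s))%:E)%E) ->
  measurable_fun setT u ->
  (\int[leb]_x ((w x)%:E * (btw_int (fun s => `|u s|%R) x * btw_int (fun s => `|u s|%R) x)) <=
   C%:E * \int[leb]_x (u x ^+ 2 * w x)%:E)%E.
Proof.
move=> C0 mw w0 mg g0 gfin wC mu.
have mv : measurable_fun setT (fun s => u s ^+ 2 / g s).
  by apply: measurable_funM; [exact: measurable_funX|exact: measurable_invr_gt0].
have v0 s : 0 <= u s ^+ 2 / g s by rewrite divr_ge0 ?sqr_ge0// ltW.
have g0' s : 0 <= g s by rewrite ltW.
have mG := measurable_btw_int mg g0'.
have mU : measurable_fun setT (btw_int (fun s => `|u s|%R)).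
  by apply: measurable_btw_int => //; exact: measurableT_comp.
apply: (@le_trans _ _ (\int[leb]_x ((w x)%:E * btw_int g x * btw_int (fun s => (u s ^+ 2 / g s)%R) x))%E).
  apply: ge0_le_integral => //.
  - by move=> x _; rewrite !mule_ge0 ?lee_fin ?btw_int_ge0.
  - by apply: emeasurable_funM; [exact/measurable_EFinP|exact: emeasurable_funM].
  - apply: emeasurable_funM; last exact: measurable_btw_int.
    by apply: emeasurable_funM => //; exact/measurable_EFinP.
  - move=> x _; rewrite -muleA; apply: lee_wpmul2l; first by rewrite lee_fin.
    exact: btw_int_CS.
rewrite btw_int_swap//; last 2 first.
- by apply: emeasurable_funM => //; exact/measurable_EFinP.
- by move=> x; rewrite mule_ge0 ?lee_fin ?btw_int_ge0.
rewrite -ge0_integralZl//; last 2 first.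
- by apply/measurable_EFinP; apply: measurable_funM => //; exact: measurable_funX.
- by move=> x _; rewrite lee_fin mulr_ge0 ?sqr_ge0.
apply: ae_ge0_le_integral => //.
- move=> s _; rewrite mule_ge0 ?lee_fin//; apply: integral_ge0 => x _.
  by rewrite !mule_ge0 ?lee_fin ?btw_int_ge0.
- apply: emeasurable_funM; first exact/measurable_EFinP.
  apply: measurable_btw_int_l => [|x]; last by rewrite mule_ge0 ?lee_fin ?btw_int_ge0.
  by apply: emeasurable_funM => //; exact/measurable_EFinP.
- by move=> s _; rewrite lee_fin mulr_ge0// mulr_ge0 ?sqr_ge0.
- by apply: emeasurable_funM => //; apply/measurable_EFinP; apply: measurable_funM => //; exact: measurable_funX.
- exists [set 0]; split=> //; first exact: lebesgue_measure_set1.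
  move=> s /=; apply: contra_notP => /eqP s0 _.
  apply: le_trans (lee_wpmul2l _ (wC s s0)) _; first by rewrite lee_fin.
  rewrite -!EFinM lee_fin le_eqVlt; apply/orP; left; apply/eqP.
  by field; rewrite gt_eqF.
Qed.

End hardy.

(** * Smooth steps and absolute continuity of weakly differentiable functions *)

Section smooth_step.
Context {R : realType}.
Implicit Types (f g : R -> R) (x c : R).

Lemma is_derive0_of_sqr_bound f c : (forall h, `|f h| <= c * h ^+ 2) ->
  is_derive (0 : R) 1 f 0.
Proof.
move=> fc; have f0 : f 0 = 0.
  by have := fc 0; rewrite expr0n/= mulr0 normr_le0 => /eqP.
have H : (fun h : R => h^-1 *: ((f \o shift 0) (h *: (1 : R)) - f 0)) @ 0^' --> (0 : R).
  apply/cvgr0Pnorm_le => e e0; near=> h.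
  have h0 : h != 0 by near: h; exact: nbhs_dnbhs_neq.
  rewrite /= addr0 f0 subr0 normrZ normfV ler_pdivrMl ?normr_gt0//.
  rewrite [h *: 1]mulr1; apply: le_trans (fc h) _.
  have he : `|h| <= e / (`|c| + 1).
    near: h; apply: dnbhs0_le; apply: divr_gt0 => //; exact: ltr_wpDl.
  rewrite -(real_normK (num_real h)) expr2 mulrCA; apply: ler_wpM2l => //.
  apply: (@le_trans _ _ ((`|c| + 1) * `|h|)).
    by apply: ler_wpM2r => //; rewrite (le_trans (ler_norm _))// lerDl.
  by rewrite mulrC -ler_pdivlMr// ltr_wpDl.
apply: DeriveDef; first by apply/cvg_ex; exists 0.
exact: cvg_lim H.
Unshelve. all: by end_near. Qed.

(** The functions x^-k exp(-1/x), extended by zero. The span of this family is stable under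
    differentiation, which makes its members smooth. *)
Definition flat (k : nat) x : R :=
  if 0 < x then x `^ (- k%:R) * expR (- x `^ (-1)) else 0.

(** The Taylor term of order k + 2 of exp(1/h) absorbs h^-k and leaves h^2, enough for a zero
    derivative at 0. *)
Lemma flat_bound k h : `|flat k h| <= (k.+2)`!%:R * h ^+ 2.
Proof.
rewrite /flat; case: ifPn => [h0|_]; last by rewrite normr0 mulr_ge0 ?sqr_ge0.
rewrite ger0_norm ?mulr_ge0 ?powR_ge0 ?expR_ge0// powRN powR_mulrn ?(ltW h0)// powR_inv1 ?(ltW h0)//.
have e0 := expR_gt0 h^-1.
rewrite expRN ler_pdivrMr// -[h ^- k]mulr1 ler_pdivrMl ?exprn_gt0//.
have hi : 0 <= h^-1 by rewrite invr_ge0 ltW.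
have H : h^-1 ^+ k.+2 / (k.+2)`!%:R <= expR h^-1.
  by apply: le_trans (expR_ge1Dxn k.+1 hi); rewrite lerDr.
rewrite ler_pdivrMr ?ltr0n ?fact_gt0// in H.
rewrite -[leLHS](@mulfV _ (h ^+ k.+2)) ?expf_neq0 ?gt_eqF// -exprVn.
have -> : h ^+ k * ((k.+2)`!%:R * h ^+ 2 * expR h^-1) = h ^+ k.+2 * (expR h^-1 * (k.+2)`!%:R).
  by rewrite -addn2 exprD; ring.
by apply: ler_wpM2l; rewrite ?exprn_ge0// ltW.
Qed.

Lemma is_derive_flat k x :
  is_derive x 1 (flat k) (- k%:R * flat k.+1 x + flat k.+2 x).
Proof.
have [x0|x0|->] := ltgtP x 0.
- apply: (@near_eq_is_derive _ _ _ (fun=> 0)).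
    by near=> y; rewrite /flat ltNge ltW//; near: y; exact: lt_nbhsl.
  by apply: is_derive_eq (der_cst 0 x) _; rewrite /flat ltNge ltW//= mulr0 addr0.
- apply: (@near_eq_is_derive _ _ _ (fun y => y `^ (- k%:R) * expR (- y `^ (-1)))).
    by near=> y; rewrite /flat ifT//; near: y; exact: lt_nbhsr.
  have d1 := is_derive1_powR (- k%:R) x0.
  have d2 := derN (is_derive1_powR (-1) x0).
  have d3 := @der_comp _ expR (fun y => - y `^ (-1)) x _ _ (is_derive_expR _) d2.
  apply: is_derive_eq (derM d1 d3) _.
  rewrite /flat x0.
  have -> : - k%:R - 1 = - k.+1%:R :> R by rewrite -natr1 opprD.
  have -> : -1 - 1 = - 2%:R :> R by ring.
  rewrite mulN1r opprK !mulrA; congr (_ + _).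
  rewrite mulrAC -powRD; last by apply/implyP => _; rewrite gt_eqF.
  by congr (_ `^ _ * _); rewrite -opprD -natrD addn2.
- rewrite [X in is_derive _ _ _ X](_ : _ = 0).
    exact: is_derive0_of_sqr_bound (flat_bound k).
  by rewrite /flat ltxx mulr0 addr0.
Unshelve. all: by end_near. Qed.

(** A syntactic class whose constructors allow the derivative of each member to be written inside
    the class. Derivatives of all orders then follow by iteration, with no formula for them. *)
Inductive smooth : (R -> R) -> Prop :=
| smooth_flat k : smooth (flat k)
| smooth_cst c : smooth (fun=> c)
| smoothD f g : smooth f -> smooth g -> smooth (fun x => f x + g x)
| smoothM f g : smooth f -> smooth g -> smooth (fun x => f x * g x)
| smooth_affine a b f : smooth f -> smooth (fun x => f (a * x + b))
| smoothV f : smooth f -> (forall x, 0 < f x) -> smooth (fun x => (f x)^-1).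

Lemma is_deriveV_gt0 f x a : (forall y, 0 < f y) -> is_derive x 1 f a ->
  is_derive x 1 (fun y => (f y)^-1) (- a * ((f x)^-1 * (f x)^-1)).
Proof.
move=> f0 fa; have fx := f0 x.
have -> : (fun y => (f y)^-1) = (fun y => f y `^ (-1)).
  by apply/funext => y; rewrite powR_inv1// ltW.
apply: is_derive_eq (der_comp (is_derive1_powR (-1) fx) fa) _.
have -> : -1 - 1 = - 2%:R :> R by ring.
by rewrite powRN powR_mulrn ?ltW// mulN1r expr2 invfM mulrC mulrN mulNr.
Qed.

Lemma smooth_derive f : smooth f ->
  exists2 g, smooth g & forall x, is_derive x 1 f (g x).
Proof.
elim=> {f} [k|c|f g _ [f' sf' df] _ [g' sg' dg]|f g sf [f' sf' df] sg [g' sg' dg]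
  |a b f _ [f' sf' df]|f sf [f' sf' df] f0].
- exists (fun x => - k%:R * flat k.+1 x + flat k.+2 x); last exact: is_derive_flat.
  by apply: smoothD; [apply: smoothM|]; [exact: smooth_cst|exact: smooth_flat|exact: smooth_flat].
- by exists (fun=> 0); [exact: smooth_cst|move=> x; exact: der_cst].
- by exists (fun x => f' x + g' x); [exact: smoothD|move=> x; exact: derD].
- exists (fun x => f' x * g x + f x * g' x); last by move=> x; exact: derM.
  by apply: smoothD; exact: smoothM.
- exists (fun x => f' (a * x + b) * a).
    by apply: smoothM; [exact: smooth_affine|exact: smooth_cst].
  move=> x; apply: (@der_comp _ f) => //.
  by apply: is_derive_eq (derD (derZ a (der_id x)) (der_cst b x)) _; rewrite mulr1 addr0.
- exists (fun x => -1 * f' x * ((f x)^-1 * (f x)^-1)).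
    by do !apply: smoothM => //; [exact: smooth_cst|exact: smoothV|exact: smoothV].
  by move=> x; rewrite mulN1r; exact: is_deriveV_gt0.
Qed.

Lemma smooth_derivable f x : smooth f -> derivable f x 1.
Proof. by move=> /smooth_derive[g _ /(_ x) h]; exact: ex_derive. Qed.

Lemma smooth_derive1 f : smooth f -> smooth (derive1 f).
Proof.
move=> /smooth_derive[g sg fg]; suff -> : derive1 f = g by [].
by apply/funext => x; rewrite derive1E; have h := fg x; exact: derive_val.
Qed.

Lemma smooth_derive1n f n : smooth f -> smooth (derive1n n f).
Proof.
by move=> sf; elim: n => [//|n ih]; rewrite derive1nS; exact: smooth_derive1.
Qed.

Lemma smooth_continuous f : smooth f -> continuous f.
Proof.
by move=> sf x; apply/differentiable_continuous/derivable1_diffP/smooth_derivable.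
Qed.

Definition step x : R := flat 0 (1 + x) / (flat 0 (1 + x) + flat 0 (1 - x)).

Lemma flat0_ge0 x : 0 <= flat 0 x.
Proof. by rewrite /flat; case: ifP => // _; rewrite mulr_ge0 ?powR_ge0 ?expR_ge0. Qed.

Lemma flat0_gt0 x : 0 < x -> 0 < flat 0 x.
Proof. by move=> x0; rewrite /flat x0 mulr_gt0 ?powR_gt0 ?expR_gt0. Qed.

Lemma flat0_eq0 x : x <= 0 -> flat 0 x = 0.
Proof. by rewrite /flat leNgt => /negbTE ->. Qed.

Lemma step_denom_gt0 x : 0 < flat 0 (1 + x) + flat 0 (1 - x).
Proof.
have [x0|x0] := leP 0 x.
  by apply: ltr_wpDr; [exact: flat0_ge0|apply: flat0_gt0; lra].
by apply: ltr_wpDl; [exact: flat0_ge0|apply: flat0_gt0; lra].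
Qed.

Lemma smooth_step : smooth step.
Proof.
have s1 : smooth (fun x => flat 0 (1 + x)).
  have := smooth_affine 1 1 (smooth_flat 0).
  by congr smooth; apply/funext => x; rewrite mul1r addrC.
have s2 : smooth (fun x => flat 0 (1 - x)).
  have := smooth_affine (-1) 1 (smooth_flat 0).
  by congr smooth; apply/funext => x; rewrite mulN1r addrC.
by apply: smoothM => //; apply: smoothV => [|x]; [exact: smoothD|exact: step_denom_gt0].
Qed.

Lemma step0 x : x <= -1 -> step x = 0.
Proof. by move=> x1; rewrite /step flat0_eq0 ?mul0r//; lra. Qed.

Lemma step1 x : 1 <= x -> step x = 1.
Proof.
move=> x1; rewrite /step [flat 0 (1 - x)]flat0_eq0; last lra.
by rewrite addr0 divff// gt_eqF// flat0_gt0//; lra.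
Qed.

Lemma step_itv x : 0 <= step x <= 1.
Proof.
have d0 := step_denom_gt0 x; rewrite /step divr_ge0 ?flat0_ge0 ?(ltW d0)//=.
by rewrite ler_pdivrMr// mul1r lerDl flat0_ge0.
Qed.

End smooth_step.

(** * Mollified averages at Lebesgue points *)

Section lebesgue_point_average.
Context {R : realType}.
Local Notation leb := (@lebesgue_measure R).
Implicit Types (f : R -> R) (x a b c m : R).

(** A continuous bump supported in [-1, 1] with integral 1; its rescalings form an approximate
    identity with [step] as explicit primitive. *)
Let theta : R -> R := derive1 (@step R).

Lemma theta_continuous : continuous theta.
Proof. exact/smooth_continuous/smooth_derive1/smooth_step. Qed.

Lemma theta_eq0 x : 1 < `|x| -> theta x = 0.
Proof.
move=> x1; rewrite /theta derive1E.
have [x0|x0] := leP 0 x.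
  rewrite ger0_norm// in x1.
  rewrite -(derive_cst (1 : R) x (1 : R)); apply: near_eq_derive.
  near=> y; rewrite step1//; apply: ltW; near: y; exact: lt_nbhsr.
rewrite ltr0_norm// in x1.
rewrite -(derive_cst (0 : R) x (1 : R)); apply: near_eq_derive.
near=> y; rewrite step0//; apply: ltW; near: y; apply: lt_nbhsl; lra.
Unshelve. all: by end_near. Qed.

Lemma theta_bounded : exists2 B, 0 < B & forall x, `|theta x| <= B.
Proof.
have c1 : {within `[-1, 1 : R], continuous (fun x => `|theta x|)}.
  apply: continuous_subspaceT => x; apply: cvg_norm; exact: theta_continuous.
have [|c _ cP] := EVT_max _ c1; first lra.
exists (`|theta c| + 1) => [|x]; first by rewrite ltr_wpDl.
have [x1|x1] := leP `|x| 1; last by rewrite theta_eq0 // normr0 addr_ge0.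
rewrite (le_trans (cP x _)) ?lerDl//.
by rewrite in_itv/= -ler_norml.
Qed.

Lemma is_derive_step_affine m b x :
  is_derive x 1 (fun y => step (m * y + b)) (m * theta (m * x + b)).
Proof.
rewrite mulrC; apply: (@der_comp _ step (fun y => m * y + b)).
  rewrite /theta derive1E; apply: derivableP.
  exact/smooth_derivable/smooth_step.
by apply: is_derive_eq (derD (derZ m (der_id x)) (der_cst b x)) _; rewrite mulr1 addr0.
Qed.

Lemma integrable_itv_loc f a b : locally_integrable setT f ->
  leb.-integrable `[a, b] (EFin \o f).
Proof.
move=> [mf _ lf]; apply/integrableP; split.
  by apply/measurable_EFinP; exact: measurable_funTS.
by apply: lf => //; exact: segment_compact.
Qed.

Lemma locally_integrable_cst c : locally_integrable setT (cst c : R -> R).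
Proof.
split=> //; first exact: openT.
move=> A _ cA; rewrite /= integral_cst; last exact: compact_measurable.
by rewrite lte_mul_pinfty// ?lee_fin//; exact: compact_finite_measure.
Qed.

Lemma theta_affine_bounded m b : exists2 B, 0 < B & forall x, `|m * theta (m * x + b)| <= B.
Proof.
have [B B0 HB] := theta_bounded; exists (`|m| * B + 1) => [|x].
  by rewrite ltr_wpDl// mulr_ge0// ltW.
by rewrite normrM (@le_trans _ _ (`|m| * B)) ?ler_wpM2l// lerDl.
Qed.

Lemma theta_affine_measurable m b : measurable_fun setT (fun x => m * theta (m * x + b)).
Proof.
apply: continuous_measurable_fun => x; apply: cvgM; first exact: cvg_cst.
apply: continuous_comp; last exact: theta_continuous.
by apply: cvgD; [apply: cvgM; [exact: cvg_cst|exact: cvg_id]|exact: cvg_cst].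
Qed.

Lemma theta_affine_patch m b c d f : 0 < m -> m * c + b < -1 -> 1 < m * d + b ->
  (fun x => f x * (m * theta (m * x + b))) =
  (fun x => f x * (m * theta (m * x + b))) \_ `[c, d].
Proof.
move=> m0 cb db; apply/funext => x; rewrite patchE; case: ifPn => //.
rewrite notin_setE/= in_itv/= => /negP; rewrite negb_and -!ltNge => xcd.
rewrite theta_eq0 ?mulr0//; case/orP: xcd => h.
  have : m * x < m * c by rewrite ltr_pM2l.
  by move=> h2; rewrite ltr0_norm; lra.
have : m * d < m * x by rewrite ltr_pM2l.
by move=> h2; rewrite gtr0_norm; lra.
Qed.

Lemma integrable_theta_affine f m b c d : locally_integrable setT f ->
  leb.-integrable `[c, d] (EFin \o (fun x => f x * (m * theta (m * x + b)))).
Proof.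
move=> lf; have := integrable_itv_loc c d lf.
have [B B0 HB] := theta_affine_bounded m b.
move=> /(@integrableMl _ _ _ leb _ _ _ (fun x => m * theta (m * x + b))).
apply => //.
  by apply: measurable_funTS; exact: theta_affine_measurable.
exists B; split; first exact: num_real.
by move=> M BM x _; exact: le_trans (HB x) (ltW BM).
Qed.

Lemma integrableT_theta_affine f m b : 0 < m -> locally_integrable setT f ->
  leb.-integrable setT (EFin \o (fun x => f x * (m * theta (m * x + b)))).
Proof.
move=> m0 lf; rewrite (@theta_affine_patch m b ((-2 - b) / m) ((2 - b) / m))//; last 2 first.
- by rewrite mulrC divfK ?gt_eqF//; lra.
- by rewrite mulrC divfK ?gt_eqF//; lra.
rewrite -restrict_EFin; apply/integrable_restrict => //; rewrite setTI.
exact: integrable_theta_affine.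
Qed.

(** The bumps may be off centre by at most their own half-width, which the ramps used below require.
    The error is still controlled by the mean oscillation of [f] on balls centred at [a]. *)
Lemma lebesgue_pt_average f a (b : nat -> R) : locally_integrable setT f ->
  lebesgue_pt f a -> (forall n, `|b n| <= 1) ->
  \int[leb]_x (f x * (n.+1%:R * theta (n.+1%:R * x + (b n - n.+1%:R * a))))
    @[n --> \oo] --> f a.
Proof.
move=> lf fa b1; have [B B0 HB] := theta_bounded.
have mf : measurable_fun setT f by case: lf.
have key n : let m := n.+1%:R in (`|\int[leb]_x (f x * (m * theta (m * x + (b n - m * a)))) - f a|%:E
    <= (8 * B)%:E * davg f a (4 / m))%E.
  move=> m; have m0 : 0 < m by rewrite ltr0n.
  (* The bump lives within 2/m of [a]; the segment of radius 3/m contains its support strictly and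
     lies in the open ball of radius 4/m. That ball has length 8/m and the kernel is at most m B,
     whence the constant [8 * B]. *)
  set c := b n - m * a; pose l := a - 3 / m; pose r := a + 3 / m.
  have lr : l < r by rewrite /l /r ltrD2l gtrN// divr_gt0.
  have /andP[bl br] : -1 <= b n <= 1 by rewrite -ler_norml.
  have ml : m * l + c < -1.
    have -> : m * l + c = b n - 3 by rewrite /l /c; field; rewrite gt_eqF.
    by lra.
  have mr : 1 < m * r + c.
    have -> : m * r + c = b n + 3 by rewrite /r /c; field; rewrite gt_eqF.
    by lra.
  rewrite (theta_affine_patch _ m0 ml mr) -Rintegral_mkcond.
  pose K x := m * theta (m * x + c).
  have KB x : `|K x| <= m * B by rewrite /K normrM gtr0_norm// ler_pM2l.
  have mK : measurable_fun setT K by exact: theta_affine_measurable.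
  have iK : leb.-integrable `[l, r] (EFin \o K).
    have := @integrable_theta_affine (fun=> 1) m c l r.
    under [X in integrable _ _ (EFin \o X)]eq_fun do rewrite mul1r.
    by apply; exact: locally_integrable_cst.
  have intK : \int[leb]_(x in `[l, r]) K x = 1.
    rewrite /Rintegral (@continuous_FTC2 _ K (fun x => step (m * x + c)) l r lr).
    - by rewrite (step1 (ltW mr)) (step0 (ltW ml)) /= subr0.
    - apply: continuous_subspaceT => x.
      apply: cvgM; first exact: cvg_cst.
      apply: continuous_comp; last exact: theta_continuous.
      by apply: cvgD; [apply: cvgM; [exact: cvg_cst|exact: cvg_id]|exact: cvg_cst].
    - have cs x : {for x, continuous (fun x => step (m * x + c))}.
        apply/differentiable_continuous/derivable1_diffP.
        by have h := is_derive_step_affine m c x; exact: ex_derive.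
      split; [|exact: cvg_at_right_filter (cs l)|exact: cvg_at_left_filter (cs r)].
      by move=> x _; have h := is_derive_step_affine m c x; exact: ex_derive.
    - by move=> x _; rewrite derive1E; have h := is_derive_step_affine m c x; exact: derive_val.
  have ifK := @integrable_theta_affine f m c l r lf.
  have iD : leb.-integrable `[l, r] (EFin \o (fun x => `|f x - f a| * (m * B))).
    rewrite (_ : EFin \o _ = (fun x => (EFin \o (fun x => `|f x - f a|%R)) x * (m * B)%:E)%E)//.
    apply: integrableZr => //.
    rewrite (_ : EFin \o _ = abse \o ((EFin \o f) \- (EFin \o cst (f a)))%E)//.
    apply/integrable_abse/integrableB => //; first exact: integrable_itv_loc.
    by apply: integrable_itv_loc; exact: locally_integrable_cst.
  have ifaK : leb.-integrable `[l, r] (EFin \o (fun x => f a * K x)).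
    rewrite (_ : EFin \o _ = (fun x => (f a)%:E * (EFin \o K) x)%E)//.
    exact: integrableZl.
  have -> : f a = \int[leb]_(x in `[l, r]) (f a * K x) by rewrite RintegralZl// intK mulr1.
  rewrite -RintegralB//.
  apply: le_trans (_ : ((\int[leb]_(x in `[l, r]) (`|f x - f a| * (m * B)))%:E <= _)%E); last first.
    have r0 : 0 < 4 / m by rewrite divr_gt0.
    rewrite fineK; last exact: integrable_fin_num.
    rewrite /davg /iavg lebesgue_measure_ball ?(ltW r0)// inver mulrn_eq0/= (gt_eqF r0).
    rewrite muleA -EFinM.
    have -> : 8 * B * (4 / m *+ 2)^-1 = m * B by rewrite -mulr_natr; field; rewrite gt_eqF.
    have mfa : measurable_fun setT (fun x => `|f x - f a|%:E).
      by apply/measurable_EFinP/measurableT_comp => //; exact: measurable_funB.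
    have -> : (\int[leb]_(x in `[l, r]) (`|f x - f a| * (m * B))%:E =
        \int[leb]_(x in `[l, r]) ((m * B)%:E * `|f x - f a|%:E))%E.
      by apply: eq_integral => x _; rewrite -EFinM mulrC.
    rewrite ge0_integralZl//; last 2 first.
    - exact: measurable_funTS.
    - by rewrite lee_fin mulr_ge0// ltW.
    apply: lee_wpmul2l; first by rewrite lee_fin mulr_ge0// ltW.
    apply: ge0_subset_integral => //.
    - exact: measurable_ball.
    - exact: measurable_funTS.
    - move=> x /=; rewrite in_itv/= /l /r => /andP[lx xr].
      rewrite /ball/= distrC ltr_norml.
      have : 3 / m < 4 / m by rewrite ltr_pM2r ?invr_gt0//; lra.
      by move: (3 / m) (4 / m) lx xr => u v ? ? ?; apply/andP; split; lra.
  have iS : leb.-integrable `[l, r] (EFin \o (fun x => f x * K x - f a * K x)).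
    rewrite (_ : EFin \o _ = (EFin \o (f \* K)%R) \- (EFin \o (cst (f a) \* K)%R))%E//.
    exact: integrableB.
  rewrite lee_fin; apply: le_trans (le_normr_Rintegral _ iS) _ => //.
  apply: le_Rintegral => //.
  - exact: integrable_abse iS.
  - by move=> x _; rewrite -mulrBl normrM ler_wpM2l.
apply/cvgrPdist_le => e e0.
have /fine_cvgP[dfin dcvg] : davg f a (4 / n.+1%:R) @[n --> \oo] --> 0%E.
  move/cvge_at_rightP: fa; apply; split=> [n|]; first by rewrite divr_gt0.
  rewrite -(mulr0 4); apply: cvgM; [exact: cvg_cst|exact: cvg_harmonic].
have eB : 0 < e / (8 * B) by rewrite divr_gt0// mulr_gt0.
move/cvgrPdist_le : dcvg => /(_ _ eB) dcvg.
near=> n; rewrite distrC -lee_fin; apply: le_trans (key n) _.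
have dn : davg f a (4 / n.+1%:R) \is a fin_num by near: n.
rewrite -(fineK dn) -EFinM lee_fin mulrC -ler_pdivlMr ?mulr_gt0//.
have : `|0 - fine (davg f a (4 / n.+1%:R))| <= e / (8 * B) by near: n.
by rewrite sub0r normrN; apply: le_trans; exact: ler_norm.
Unshelve. all: end_near.
Qed.

End lebesgue_point_average.

(** * Pointwise bounds from a weak derivative *)

Section weak_derivative_AC.
Context {R : realType}.
Local Notation leb := (@lebesgue_measure R).
Implicit Types (f g : R -> R) (x a b m : R).

Let theta : R -> R := derive1 (@step R).

Definition ramp m b x : R := step (m * x) - step (m * x + b).

Lemma is_derive_ramp m b x :
  is_derive x 1 (ramp m b) (m * theta (m * x + 0) - m * theta (m * x + b)).
Proof.
have -> : ramp m b = (fun x => step (m * x + 0) - step (m * x + b)).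
  by apply/funext => y; rewrite /ramp addr0.
by apply: derB; exact: is_derive_step_affine.
Qed.

Lemma smooth_ramp m b : smooth (ramp m b).
Proof.
have -> : ramp m b = (fun x => step (m * x + 0) + -1 * step (m * x + b)).
  by apply/funext => y; rewrite /ramp addr0 mulN1r.
apply: smoothD; first exact: smooth_affine smooth_step.
by apply: smoothM; [exact: smooth_cst|exact: smooth_affine smooth_step].
Qed.

Lemma ramp_le1 m b x : `|ramp m b x| <= 1.
Proof.
have /andP[h1 h2] := step_itv (m * x); have /andP[h3 h4] := step_itv (m * x + b).
rewrite /ramp; move: (step _) (step _) h1 h2 h3 h4 => u v *.
by rewrite ler_norml; apply/andP; split; lra.
Qed.

(* The offset puts the second step just inside the segment between 0 and a,
   so that the ramp vanishes outside this segment and [-1/m, 1/m]. *)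
Lemma ramp_eq0 m a x : 0 < m -> 1 <= m * `|a| -> ~~ btw a x -> 1 < m * `|x| ->
  ramp m (Num.sg a - m * a) x = 0.
Proof.
move=> m0 ma; rewrite /btw negb_or !negb_and -!ltNge => /andP[h1 h2] mx.
have a0 : a != 0.
  by apply: contraTneq ma => ->; rewrite normr0 mulr0 -ltNge ltr01.
have [x0|x0] := leP 0 x.
  rewrite ger0_norm// in mx.
  rewrite /ramp [step (m * x)]step1 ?(ltW mx)// step1 ?subrr//.
  have [a_gt0|a_lt0] := ltrP 0 a.
    have ax : a < x by case/orP: h1 => //; rewrite ltNge x0.
    by rewrite gtr0_sg//; have : m * a < m * x; [rewrite ltr_pM2l|lra].
  have {}a_lt0 : a < 0 by rewrite lt_neqAle a0.
  rewrite ltr0_sg//; rewrite ltr0_norm// in ma; lra.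
rewrite ltr0_norm// in mx.
rewrite /ramp [step (m * x)]step0; last lra.
rewrite step0 ?subrr//.
have [a_gt0|a_lt0] := ltrP 0 a.
  by rewrite gtr0_sg//; rewrite gtr0_norm// in ma; lra.
have {}a_lt0 : a < 0 by rewrite lt_neqAle a0.
have ax : x < a by case/orP: h2 => //; rewrite ltNge (ltW x0).
by rewrite ltr0_sg//; have : m * x < m * a; [rewrite ltr_pM2l|lra].
Qed.

Lemma test_ramp m a : 0 < m -> 1 <= m * `|a| ->
  test_function (ramp m (Num.sg a - m * a)).
Proof.
move=> m0 ma; split=> [n x|].
  exact/smooth_derivable/smooth_derive1n/smooth_ramp.
pose M := `|a| + m^-1.
apply: (@subclosed_compact _ _ `[- M, M]).
- exact: closed_closure.
- exact: segment_compact.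
- rewrite (_ : `[- M, M]%classic = closure `[- M, M]%classic).
    apply: closure_subset => x /= rx; rewrite in_itv/= -ler_norml leNgt.
    apply: contra rx => Mx; apply/eqP; apply: ramp_eq0 => //.
      apply/negP => /orP[] /andP[h1 h2]; move: Mx; rewrite ltNge => /negP; apply;
      rewrite /M ler_wpDr ?invr_ge0 ?(ltW m0)//.
        by rewrite ger0_norm// (le_trans h2)// ler_norm.
      by rewrite ler0_norm// -(normrN a) (le_trans _ (ler_norm (- a)))// lerN2.
    rewrite mulrC -ltr_pdivrMr// mul1r; apply: le_lt_trans Mx.
    by rewrite /M lerDr.
  exact/closure_id/interval_closed.
Qed.

(* Test functions converging to the indicator of the segment between 0 and a
   compare the averages of f near a with those near 0; at a Lebesgue point a of
   f the former converge to f a, and c is the lower limit of the latter. *)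
Lemma weak_derivative_AC f g : weak_derivative f g ->
  exists c, {ae leb, forall x, (`|f x - c|%:E <= btw_int (fun s => `|g s|%R) x)%E}.
Proof.
move=> [lf lg fg].
have mg : measurable_fun setT g by case: lg.
pose I0 n := \int[leb]_x (f x * (n.+1%:R * theta (n.+1%:R * x + 0))).
(* The neighbourhood of 0 where the first step of the ramp may spill out of the segment between 0
   and a. The mass [eps n] of |g| on it tends to zero. *)
pose ind n x : R := (n.+1%:R * `|x| <= 1)%R%:R.
have mind n : measurable_fun setT (ind n).
  apply: measurableT_comp => //; apply: measurable_fun_ler => //.
  by apply: measurable_funM => //; exact: measurableT_comp.
have mgi n : measurable_fun setT (fun x => (`|g x| * ind n x)%:E).
  by apply/measurable_EFinP; apply: measurable_funM => //; exact: measurableT_comp.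
pose eps n : \bar R := (\int[leb]_x (`|g x| * ind n x)%:E)%E.
have eps_cvg : eps @ \oo --> 0%E.
  have ig : leb.-integrable setT (fun x => (`|g x| * ind 0%N x)%:E).
    have -> : (fun x => (`|g x| * ind 0%N x)%:E) = (abse \o (EFin \o g)) \_ `[-1, 1].
      apply/funext => x; rewrite patchE /ind mem_setE/= in_itv/= mul1r -ler_norml.
      by case: (`|x| <= 1); rewrite ?mulr1 ?mulr0.
    apply/integrable_restrict => //; rewrite setTI; apply: integrable_abse.
    exact: integrable_itv_loc.
  have [] := @dominated_convergence _ _ _ leb setT measurableT
    (fun n x => (`|g x| * ind n x)%:E) (cst 0%E) (fun x => (`|g x| * ind 0%N x)%:E) mgi _ _ ig _.
  - exact: measurable_cst.
  - exists [set 0]; split=> //; first exact: lebesgue_measure_set1.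
    move=> x /=; apply: contra_notP => /eqP x0 _.
    apply: cvg_near_cst; near=> n.
    rewrite /ind; suff -> : (n.+1%:R * `|x| <= 1) = false by rewrite mulr0.
    apply/negbTE; rewrite -ltNge mulrC -ltr_pdivrMl ?normr_gt0// mulr1.
    apply: (@lt_trans _ _ n%:R); last by rewrite ltr_nat.
    by near: n; exact: nbhs_infty_gtr.
  - apply: aeW => x n _; rewrite /= lee_fin ger0_norm ?mulr_ge0//.
    apply: ler_wpM2l => //; rewrite /ind ler_nat.
    have [h|//] := leP (n.+1%:R * `|x|) 1.
    by rewrite mul1r (le_trans _ h)// ler_peMl// ler1n.
  - by move=> _ _; rewrite integral0.
pose Ia a n := \int[leb]_x (f x * (n.+1%:R * theta (n.+1%:R * x + (Num.sg a - n.+1%:R * a)))).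
have diff a n : a != 0 -> 1 <= n.+1%:R * `|a| ->
    (`|I0 n - Ia a n|%:E <= btw_int (fun s => `|g s|%R) a + eps n)%E.
  move=> a0 na; set m : R := n.+1%:R; have m0 : 0 < m by rewrite ltr0n.
  pose phi := ramp m (Num.sg a - m * a).
  have := fg phi (test_ramp m0 na).
  have -> : \int[leb]_x (f x * derive1 phi x) = I0 n - Ia a n.
    rewrite -RintegralB//; last 2 first.
    - exact: integrableT_theta_affine.
    - exact: integrableT_theta_affine.
    apply: eq_Rintegral => x _; rewrite -mulrBr derive1E.
    by have h := is_derive_ramp m (Num.sg a - m * a) x; rewrite (derive_val (is_derive := h)).
  move=> ->; rewrite normrN.
  have mphi : measurable_fun setT phi.
    by apply: continuous_measurable_fun; exact/smooth_continuous/smooth_ramp.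
  have mb : measurable_fun setT (fun s => (`|g s| * btwE a s)%:E).
    apply/measurable_EFinP; apply: measurable_funM; first exact: measurableT_comp.
    exact: measurable_btwE_r.
  have fineb (X : \bar R) : (`|fine X|%:E <= `|X|)%E.
    by case: X => //=; rewrite normr0 leey.
  have mgp : measurable_fun setT (EFin \o (g \* phi)).
    by apply/measurable_EFinP; exact: measurable_funM.
  apply: le_trans (fineb _) _; apply: le_trans (le_abse_integral leb measurableT mgp) _.
  rewrite /eps /btw_int -ge0_integralD//; last 3 first.
  - by move=> x _; rewrite lee_fin mulr_ge0.
  - by move=> x _; rewrite lee_fin mulr_ge0.
  - exact: mgi.
  apply: ge0_le_integral => //.
  - by apply: measurableT_comp => //; exact: mgp.
  - by apply: emeasurable_funD => //; exact: mgi.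
  move=> x _; rewrite /= -EFinD lee_fin -mulrDr normrM; apply: ler_wpM2l => //.
  have [h|h] := boolP (btw a x).
    by rewrite /btwE h (le_trans (ramp_le1 _ _ _))// lerDl.
  rewrite /ind -/m; have [h2|h2] := leP (m * `|x|) 1.
    by rewrite (le_trans (ramp_le1 _ _ _))// lerDr.
  by rewrite /phi ramp_eq0// normr0 addr_ge0.
(* The point 0 need not be a Lebesgue point. A lower limit is always defined and does not depend on
   [a]; its finiteness is proved wherever the bound to be shown is finite. *)
exists (fine (limn_einf (EFin \o I0))).
have ae_pt := lebesgue_differentiation lf.
have ae0 : {ae leb, forall x : measurableTypeR R, x != 0}.
  exists [set 0]; split=> //; first exact: lebesgue_measure_set1.
  by move=> s /=; apply: contra_notP => /eqP.
have Ia_cvg a : lebesgue_pt f a -> Ia a @ \oo --> f a.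
  move=> pa; apply: (lebesgue_pt_average (b := fun=> Num.sg a)) => // _.
  by rewrite normr_sg; case: (_ != _).
clearbody I0 Ia eps.
have near_I0 (a e : R) : a != 0 -> lebesgue_pt f a -> 0 < e ->
    (btw_int (fun s => `|g s|%R) a < +oo)%E ->
    \forall n \near \oo, `|f a - I0 n| <= fine (btw_int (fun s => `|g s|%R) a) + e.
  move=> a0 pa e0 bfin.
  have b0 : (0 <= btw_int (fun s => `|g s|%R) a)%E by exact: btw_int_ge0.
  have /cvgrPdist_le/(_ (e / 2)) IA := Ia_cvg a pa.
  have e2 : 0 < e / 2 by rewrite divr_gt0.
  have {}IA := IA e2.
  have /fine_cvgP[efin /cvgrPdist_le/(_ _ e2) ecvg] := eps_cvg.
  near=> n.
  have n1 : 1 <= n.+1%:R * `|a|.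
    rewrite mulrC -ler_pdivrMl ?normr_gt0// mulr1.
    apply: (@le_trans _ _ n%:R); last by rewrite ler_nat.
    by near: n; exact: nbhs_infty_ger.
  have := diff a n a0 n1.
  have ef : eps n \is a fin_num by near: n.
  rewrite -(fineK ef) -[X in (_ <= X + _)%E]fineK ?ge0_fin_numE// -EFinD lee_fin => H.
  have h1 : `|f a - Ia a n| <= e / 2 by near: n.
  have h2 : `|0 - fine (eps n)| <= e / 2 by near: n.
  rewrite sub0r normrN in h2.
  have h3 := le_trans (ler_norm _) h2.
  have h4 : `|f a - I0 n| <= `|f a - Ia a n| + `|I0 n - Ia a n|.
    by rewrite (distrC (I0 n) (Ia a n)); exact: ler_distD.
  apply: le_trans h4 _; apply: le_trans (lerD h1 (le_trans H (lerD (lexx _) h3))) _.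
  by rewrite addrCA -splitr.
apply: (@filterS2 _ _ (ae_filter_ringOfSetsType leb) _ _ _ _ ae_pt ae0) => a pa a0.
have b0 : (0 <= btw_int (fun s => `|g s|%R) a)%E by exact: btw_int_ge0.
have [bfin|] := ltP (btw_int (fun s => `|g s|%R) a) +oo%E; last first.
  by rewrite leye_eq => /eqP ->; rewrite leey.
rewrite -[leRHS]fineK ?ge0_fin_numE// lee_fin.
apply/ler_addgt0Pr => e e0.
have [N _ NP] := near_I0 a e a0 pa e0 bfin.
set beta := fine _ in NP *.
have up : (limn_einf (EFin \o I0) <= (f a + beta + e)%:E)%E.
  apply: (@limn_einf_le_cst _ _ _ N) => k Nk; rewrite lee_fin.
  have := NP k Nk; clear -e0; move: (I0 k) (f a) beta => ? ? ?.
  by rewrite ler_norml => /andP[]; lra.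
have lo : ((f a - beta - e)%:E <= limn_einf (EFin \o I0))%E.
  rewrite limn_einf_lim; apply: lime_ge; first exact: is_cvg_einfs.
  near=> k; apply: le_ereal_inf_tmp => _ [m /= km <-]; rewrite lee_fin.
  have Nm : (N <= m)%N by apply: leq_trans km; near: k; exact: nbhs_infty_ge.
  have := NP m Nm; clear -e0; move: (I0 m) (f a) beta => ? ? ?.
  by rewrite ler_norml => /andP[]; lra.
have cf : limn_einf (EFin \o I0) \is a fin_num.
  by rewrite fin_numElt (lt_le_trans _ lo) ?ltNyr// (le_lt_trans up) ?ltry.
move: up lo; rewrite -[limn_einf _]fineK// !lee_fin.
clear -e0; clearbody beta; move: (fine (limn_einf _)) (f a) => ? ? ? ?.
by rewrite /= ler_norml; apply/andP; split; lra.
Unshelve. all: end_near.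
Qed.

End weak_derivative_AC.

(** * Moments of the exponential power distribution *)

Section power_integrals.
Context {R : realType}.
Local Notation leb := (@lebesgue_measure R).
Implicit Types (x s p c : R).

Lemma continuous_normr_powR p : 0 <= p -> continuous (fun x => `|x| `^ p : R).
Proof.
rewrite le_eqVlt => /predU1P[<-|p0].
  by rewrite (_ : (fun x => _) = cst 1); [exact: cst_continuous|apply/funext => x; rewrite powRr0].
have cvg0 : (fun y : R => `|y| `^ p) y @[y --> (0 : R)] --> (`|0 : R| `^ p : R).
  apply/cvgrPdist_le => e e0.
  have ne : \forall y \near (0 : R), `|y| <= e `^ p^-1 by apply: nbhs0_le; rewrite powR_gt0.
  apply: filterS ne => y hy.
  rewrite normr0 powR0 ?gt_eqF// sub0r normrN ger0_norm ?powR_ge0//.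
  rewrite -[leRHS](@powRr1 _ e) ?(ltW e0)// -(mulVf (lt0r_neq0 p0)) powRrM.
  by apply: ge0_ler_powR; rewrite ?nnegrE ?powR_ge0 ?(ltW p0).
move=> x; have [->|x0] := eqVneq x 0; first exact: cvg0.
apply: (@continuous_comp R R R Num.norm (fun y => y `^ p)); first exact: norm_continuous.
apply/differentiable_continuous/derivable1_diffP.
have nx : 0 < `|x| by rewrite normr_gt0.
by have h := is_derive1_powR p nx; exact: ex_derive.
Qed.

Lemma is_derive_normr_powR p x : 0 < x ->
  is_derive x 1 (fun y => `|y| `^ p : R) (p * `|x| `^ (p - 1)).
Proof.
move=> x0; apply: (@near_eq_is_derive _ _ _ (fun y => y `^ p)).
  by near=> y; rewrite gtr0_norm//; near: y; exact: lt_nbhsr.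
by rewrite gtr0_norm//; exact: is_derive1_powR.
Unshelve. all: by end_near. Qed.

Variable alpha : R.
Hypothesis alpha_ge1 : 1 <= alpha.

Let alpha_gt0 : 0 < alpha. Proof. exact: lt_le_trans alpha_ge1. Qed.

(** The factor [c] makes one family of the unnormalised density (c = 1), the Hardy weight for alpha
    <= 2 (c = alpha/2 - 1) and their product (c = alpha/2). *)
Definition expw c x : R := expR (- (c * (`|x| `^ alpha / alpha))).

Lemma expw_gt0 c x : 0 < expw c x. Proof. exact: expR_gt0. Qed.

Lemma expw_ge0 c x : 0 <= expw c x. Proof. exact: expR_ge0. Qed.

Lemma expwN c x : expw c (- x) = expw c x.
Proof. by rewrite /expw normrN. Qed.

Lemma continuous_expw c : continuous (expw c).
Proof.
move=> x; apply: (@continuous_comp _ _ _ (fun x => - (c * (`|x| `^ alpha / alpha))) expR); last exact: continuous_expR.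
apply: cvgN; apply: cvgM; first exact: cvg_cst.
apply: cvgM; last exact: cvg_cst.
by apply: continuous_normr_powR; exact: ltW.
Qed.

Lemma is_derive_expw c x : 0 < x ->
  is_derive x 1 (expw c) (- (c * `|x| `^ (alpha - 1) * expw c x)).
Proof.
move=> x0.
have h1 := is_derive_normr_powR alpha x0.
have h2 := derN (derZ c (derZ alpha^-1 h1)).
have h3 := @der_comp _ expR _ x _ _ (is_derive_expR _) h2.
rewrite (_ : expw c = fun y => expR (- (c * (alpha^-1 * `|y| `^ alpha)))); last first.
  by apply/funext => y; rewrite /expw (mulrC alpha^-1).
apply: is_derive_eq h3 _ => /=.
by field; rewrite gt_eqF.
Qed.

Lemma expw_cvgy c : 0 < c -> expw c x @[x --> +oo] --> 0.
Proof.
move=> c0; apply: (@cvg_comp _ _ _ (fun x => c * (`|x| `^ alpha / alpha)) (fun y => expR (- y)) _ (pinfty_nbhs R)); last exact: cvgr_expR.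
apply/cvgryPge => A; near=> x.
have x1 : 1 <= x by near: x; exact: nbhs_pinfty_ge.
have xA : alpha * A / c <= x by near: x; apply: nbhs_pinfty_ge; rewrite num_real.
rewrite mulrA ler_pdivlMr// mulrC mulrC -ler_pdivrMl//.
rewrite ger0_norm ?(le_trans ler01)//.
by rewrite (le_trans _ (le1r_powR x1 alpha_ge1)).
Unshelve. all: by end_near. Qed.

Lemma integral_tail c s : 0 < c -> 0 <= s ->
  (\int[leb]_(x in `[s, +oo[) (c * `|x| `^ (alpha - 1) * expw c x)%:E = (expw c s)%:E)%E.
Proof.
move=> c0 s0; have a1 : 0 <= alpha - 1 by rewrite subr_ge0.
rewrite (@ge0_continuous_FTC2y _ _ (fun x => - expw c x) s 0).
- by rewrite sub0e EFinN oppeK.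
- by move=> x _; rewrite !mulr_ge0 ?expw_ge0 ?powR_ge0 ?(ltW c0).
- apply: continuous_subspaceT => x; apply: cvgM; last exact: continuous_expw.
  by apply: cvgM; [exact: cvg_cst|exact: continuous_normr_powR].
- by rewrite -oppr0; apply: cvgN; exact: expw_cvgy.
- move=> x sx; have h := derN (is_derive_expw c (le_lt_trans s0 sx)).
  exact: ex_derive.
- by apply: cvg_at_right_filter; apply: cvgN; exact: continuous_expw.
- move=> x; rewrite in_itv/= andbT => sx.
  have h := derN (is_derive_expw c (le_lt_trans s0 sx)).
  by rewrite derive1E; rewrite (derive_val (is_derive := h)) opprK.
Qed.

Lemma integral_powR p x : 0 <= p -> 0 <= x ->
  (\int[leb]_(s in `[0%R, x]) (`|s| `^ p)%:E = (x `^ (p + 1) / (p + 1))%:E)%E.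
Proof.
move=> p0; rewrite le_eqVlt => /predU1P[<-|x0].
  by rewrite set_itv1 integral_set1 powR0 ?mul0r// gt_eqF//; lra.
have p1 : p + 1 != 0 by rewrite gt_eqF//; lra.
have cF : continuous (fun s => (p + 1)^-1 * `|s| `^ (p + 1)).
  by move=> s; apply: cvgM; [exact: cvg_cst|apply: continuous_normr_powR; lra].
rewrite (@continuous_FTC2 _ _ (fun s => (p + 1)^-1 * `|s| `^ (p + 1)) 0 x)//.
- by rewrite normr0 powR0// mulr0 sube0 gtr0_norm// mulrC.
- by apply: continuous_subspaceT => s; exact: continuous_normr_powR.
- split; [|exact: cvg_at_right_filter (cF 0)|exact: cvg_at_left_filter (cF x)].
  move=> s; rewrite in_itv/= => /andP[s0 _].
  by have h := derZ (p + 1)^-1 (is_derive_normr_powR (p + 1) s0); exact: ex_derive.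
- move=> s; rewrite in_itv/= => /andP[s0 _].
  have h := derZ (p + 1)^-1 (is_derive_normr_powR (p + 1) s0).
  by rewrite derive1E (derive_val (is_derive := h)) mulKf// addrK.
Qed.

End power_integrals.

Section even_functions.
Context {R : realType}.
Local Notation leb := (@lebesgue_measure R).
Implicit Types (x s : R) (h : R -> \bar R) (u : R -> R).

Lemma ge0_even_integralT h : measurable_fun setT h -> (forall x, 0 <= h x)%E ->
  (forall x, h (- x) = h x) ->
  (\int[leb]_x h x = 2%:E * \int[leb]_(x in `[0%R, +oo[) h x)%E.
Proof.
move=> mh h0 hN.
have -> : [set: measurableTypeR R] = (`]-oo, 0%R[ `|` `[0%R, +oo[)%classic.
  by apply/seteqP; split=> x //= _; rewrite !in_itv/= andbT; case: (ltP x 0); [left|right].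
rewrite ge0_integral_setU//=; last 2 first.
- exact: measurable_funTS.
- by apply/disj_set2P/seteqP; split=> x //=; rewrite !in_itv/= andbT ltNge => -[/negP].
rewrite integral_itv_bndo_bndc; last exact: measurable_funTS.
rewrite mule_natl mule2n; congr (_ + _)%E.
rewrite ge0_integration_by_substitution0//.
by apply: eq_integral => x _; rewrite hN.
Qed.

Lemma btwEN x s : btwE (- x) s = btwE x (- s).
Proof.
by rewrite /btwE /btw !oppr_ge0 !oppr_le0 lerNl lerNr orbC andbC [X in _ || X]andbC.
Qed.

Lemma btwE_tail h s : 0 < s ->
  (fun x => h x * (btwE x s)%:E)%E = h \_ `[s, +oo[.
Proof.
move=> s0; apply/funext => x; rewrite patchE mem_setE/= in_itv/= andbT /btwE /btw.
rewrite (ltW s0) /= [s <= 0]leNgt s0 andbF orbF.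
by case: (s <= x); rewrite ?mule1 ?mule0.
Qed.

Lemma btw_tail h s : measurable_fun setT h -> (forall x, 0 <= h x)%E ->
  (forall x, h (- x) = h x) -> s != 0 ->
  (\int[leb]_x (h x * (btwE x s)%:E) = \int[leb]_(x in `[`|s|%R, +oo[) h x)%E.
Proof.
move=> mh h0 hN; rewrite neq_lt => /orP[s0|s0]; last first.
  by rewrite btwE_tail// -integral_mkcond gtr0_norm.
rewrite -(@ge0_integralT_reflect _ (fun x => h x * (btwE x s)%:E)%E).
- under eq_integral do rewrite hN btwEN.
  by rewrite btwE_tail ?oppr_gt0// -integral_mkcond ltr0_norm.
- apply: emeasurable_funM => //; apply/measurable_EFinP; exact: measurable_btwE_l.
- by move=> x; rewrite mule_ge0// lee_fin.
Qed.

Lemma btw_int_even u x : measurable_fun setT u -> (forall s, 0 <= u s) ->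
  (forall s, u (- s) = u s) ->
  btw_int u x = (\int[leb]_(s in `[0%R, `|x|%R]) (u s)%:E)%E.
Proof.
move=> mu u0 uN.
have E y : 0 <= y -> (fun s => (u s * btwE y s)%:E) = (EFin \o u) \_ `[0, y].
  move=> y0; apply/funext => s; rewrite patchE mem_setE/= in_itv/= /btwE /btw.
  have [->|] := eqVneq ((0 <= s <= y)) true; first by rewrite mulr1.
  case: (0 <= s <= y) / andP => // h _ /=.
  suff -> : (y <= s <= 0) = false by rewrite mulr0.
  apply/negP => /andP[ys s0]; apply: h; split; first exact: le_trans ys.
  exact: le_trans y0.
rewrite /btw_int; have [x0|x0] := leP 0 x; first by rewrite E// -integral_mkcond ger0_norm.
rewrite -(@ge0_integralT_reflect _ (fun s => (u s * btwE x s)%:E)).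
- under eq_integral do rewrite uN -btwEN.
  by rewrite E ?oppr_ge0 ?ltW// -integral_mkcond ltr0_norm.
- by apply/measurable_EFinP; apply: measurable_funM => //; exact: measurable_btwE_r.
- by move=> s; rewrite lee_fin mulr_ge0.
Qed.

Lemma powRD_ge0 (a r s : R) : 0 <= r -> 0 <= s -> a `^ (r + s) = a `^ r * a `^ s.
Proof.
move=> r0 s0; have [->|a0] := eqVneq a 0; last by rewrite powRD// a0 implybT.
have [->|rN0] := eqVneq r 0; first by rewrite powRr0 mul1r add0r.
have r1 : 0 < r by rewrite lt_neqAle eq_sym rN0.
by rewrite (powR0 rN0) powR0 ?mul0r// gt_eqF// ltr_wpDr.
Qed.

End even_functions.

Section moments.
Context {R : realType}.
Local Notation leb := (@lebesgue_measure R).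
Variable alpha : R.
Hypothesis alpha_ge1 : 1 <= alpha.
Implicit Types (p q x s t : R).

Let alpha_gt0 : 0 < alpha. Proof. exact: lt_le_trans alpha_ge1. Qed.
Let w := expw alpha 1.

Definition momf p x : R := `|x| `^ p * w x.

Definition emom p : \bar R := (\int[leb]_(x in `[0%R, +oo[) (momf p x)%:E)%E.

Definition mom p : R := fine (emom p).

Lemma momf_ge0 p x : 0 <= momf p x.
Proof. by rewrite mulr_ge0 ?powR_ge0 ?expw_ge0. Qed.

Lemma measurable_normr_powR p : measurable_fun setT (fun x : R => `|x| `^ p).
Proof. by apply: (measurableT_comp (measurable_powR _)). Qed.

Lemma measurable_w : measurable_fun setT w.
Proof. by apply: continuous_measurable_fun; exact: (continuous_expw alpha_ge1). Qed.

Lemma measurable_momf p : measurable_fun setT (EFin \o momf p).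
Proof.
apply/measurable_EFinP; apply: measurable_funM; last exact: measurable_w.
exact: measurable_normr_powR.
Qed.

Lemma integral_momfT p : (\int[leb]_x (momf p x)%:E = 2%:E * emom p)%E.
Proof.
apply: ge0_even_integralT; first exact: measurable_momf.
- by move=> x; rewrite lee_fin momf_ge0.
- by move=> x; rewrite /momf normrN /w expwN.
Qed.

Lemma momf_tail s : 0 <= s ->
  (\int[leb]_(x in `[s, +oo[) (momf (alpha - 1) x)%:E = (w s)%:E)%E.
Proof.
move=> s0; rewrite -(integral_tail alpha_ge1 ltr01 s0).
by apply: eq_integral => x _; rewrite mul1r.
Qed.

Lemma btw_int_powR p x : 0 <= p ->
  btw_int (fun s => (`|s| `^ p)%R) x = (`|x| `^ (p + 1) / (p + 1))%:E.
Proof.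
move=> p0; rewrite btw_int_even ?integral_powR//; first exact: measurable_normr_powR.
by move=> s; rewrite normrN.
Qed.

(** Integration by parts carried out as Tonelli: the double integral of s^p x^(alpha - 1) w(x) over
    s between 0 and x is evaluated in both orders. It holds in the extended reals, so it can be used
    to prove finiteness. *)
Lemma emom_rec p : 0 <= p -> emom (p + alpha) = ((p + 1)%:E * emom p)%E.
Proof.
move=> p0.
have p1 : 0 < p + 1 by rewrite ltr_wpDl.
have m0 x : (0 <= (momf (alpha - 1) x)%:E)%E by rewrite lee_fin momf_ge0.
have : (\int[leb]_x ((momf (alpha - 1) x)%:E * btw_int (fun s => (`|s| `^ p)%R) x) =
        \int[leb]_s (momf p s)%:E)%E.
  rewrite btw_int_swap//; last 2 first.
  - exact: measurable_normr_powR.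
  - exact: measurable_momf.
  apply: ae_eq_integral => //.
  - apply: emeasurable_funM; first by apply/measurable_EFinP; exact: measurable_normr_powR.
    by apply: measurable_btw_int_l => //; exact: measurable_momf.
  - exact: measurable_momf.
  - exists [set 0]; split=> //; first exact: lebesgue_measure_set1.
    move=> s /=; apply: contra_notP => /eqP s0 _.
    rewrite (btw_tail _ _ _ s0).
    - by rewrite (momf_tail (normr_ge0 s)) -EFinM /momf /w /expw normr_id.
    - exact: measurable_momf.
    - by move=> x; rewrite lee_fin momf_ge0.
    - by move=> x; rewrite /momf normrN /w expwN.
have -> : (\int[leb]_x ((momf (alpha - 1) x)%:E * btw_int (fun s => (`|s| `^ p)%R) x) =
    (p + 1)^-1%:E * \int[leb]_x (momf (p + alpha) x)%:E)%E.
  rewrite -ge0_integralZl//; last 3 first.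
  - exact: measurable_momf.
  - by move=> x _; rewrite lee_fin momf_ge0.
  - by rewrite lee_fin invr_ge0 ltW.
  apply: eq_integral => x _; rewrite btw_int_powR// -!EFinM; congr EFin.
  have -> : p + alpha = (p + 1) + (alpha - 1) by ring.
  by rewrite /momf (@powRD_ge0 _ _ (p + 1)) ?subr_ge0 ?(ltW p1)//; ring.
rewrite !integral_momfT => /(congr1 (fun z => (p + 1)%:E * (2^-1%:E * z)))%E.
rewrite !muleA -!EFinM.
have -> : (p + 1) * 2^-1 * (p + 1)^-1 * 2 = 1 by field; rewrite gt_eqF.
by rewrite mul1e mulfVK.
Qed.

Lemma emom_alphaB1 : emom (alpha - 1) = 1%E.
Proof. by rewrite /emom momf_tail// /w /expw normr0 powR0 ?gt_eqF// mul0r mulr0 oppr0 expR0. Qed.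

Lemma emom_ge0 p : (0 <= emom p)%E.
Proof. by apply: integral_ge0 => x _; rewrite lee_fin momf_ge0. Qed.

Lemma expw_le1 x : w x <= 1.
Proof.
rewrite /w /expw -[leRHS]expR0 ler_expR oppr_le0 mul1r divr_ge0 ?powR_ge0//.
exact: ltW.
Qed.

(** Finiteness climbs by steps of [alpha] from the exact value at [alpha - 1]. An intermediate [p]
    is dominated through x^p <= 1 on [0, 1] and x^p <= x^q beyond. *)
Lemma emom_fin p : 0 <= p -> (emom p < +oo)%E.
Proof.
move=> p0.
have fin n : (emom (alpha - 1 + n%:R * alpha) < +oo)%E.
  elim: n => [|n ih]; first by rewrite mul0r addr0 emom_alphaB1 ltry.
  have -> : alpha - 1 + n.+1%:R * alpha = (alpha - 1 + n%:R * alpha) + alpha.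
    by rewrite -natr1; ring.
  have n0 : 0 <= alpha - 1 + n%:R * alpha.
    by rewrite addr_ge0 ?subr_ge0// mulr_ge0// ltW.
  by rewrite emom_rec// lte_mul_pinfty// lee_fin (addr_ge0 n0).
pose n := (Num.truncn p).+1; pose q := alpha - 1 + n%:R * alpha.
have pq : p <= q.
  have pn : p <= n%:R by rewrite ltW// truncnS_gt.
  rewrite /q (le_trans pn)// ler_wpDl ?subr_ge0//.
  by rewrite ler_peMr.
apply: (@le_lt_trans _ _ (\int[leb]_(x in `[0%R, +oo[) ((\1_(`[0, 1]) x)%:E + (momf q x)%:E))%E).
  apply: ge0_le_integral => //.
  - by move=> x _; rewrite lee_fin momf_ge0.
  - by apply: measurable_funTS; exact: measurable_momf.
  - apply: emeasurable_funD; last by apply: measurable_funTS; exact: measurable_momf.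
    by apply/measurable_EFinP; exact: measurable_indic.
  - move=> x /=; rewrite in_itv/= andbT => x0; rewrite -EFinD lee_fin indicE mem_setE/= in_itv/= x0/=.
    have [x1|x1] := leP x 1.
      rewrite (@le_trans _ _ 1)//; last by rewrite lerDl momf_ge0.
      rewrite /momf mulr_ile1 ?powR_ge0 ?expw_ge0 ?expw_le1//.
      by rewrite ger0_norm//; have := @ge0_ler_powR _ p p0 x 1; rewrite powR1 !nnegrE; exact.
    rewrite add0r ler_wpM2r ?expw_ge0// ler_powR// ger0_norm//; exact: ltW.
rewrite ge0_integralD//; last 2 first.
- by move=> x _; rewrite lee_fin momf_ge0.
- by apply: measurable_funTS; exact: measurable_momf.
apply: lte_add_pinfty; last exact: fin.
rewrite integral_indic//.
apply: (@le_lt_trans _ _ (leb `[0, 1])).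
  by apply: le_measure; rewrite ?inE//=; exact: measurableI.
by rewrite /= lebesgue_measure_itv/= lte_fin ltr01 -EFinB ltry.
by apply/measurable_EFinP; exact: measurable_indic.
Qed.

Lemma momE p : 0 <= p -> emom p = (mom p)%:E.
Proof. by move=> p0; rewrite /mom fineK// ge0_fin_numE ?emom_fin// emom_ge0. Qed.

Lemma mom_gt0 p : 0 <= p -> 0 < mom p.
Proof.
move=> p0; rewrite -lte_fin -momE//.
apply: (@lt_le_trans _ _ (\int[leb]_(x in `[1%R, 2%R]) (w 2)%:E)%E).
  rewrite integral_cst//= lebesgue_measure_itv/= lte_fin ltr1n -EFinB -EFinM lte_fin.
  by rewrite mulr_gt0 ?expw_gt0// subr_gt0 ltr1n.
apply: (@le_trans _ _ (\int[leb]_(x in `[1%R, 2%R]) (momf p x)%:E)%E).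
  apply: ge0_le_integral => //.
  - by move=> x _; rewrite lee_fin expw_ge0.
  - by apply: measurable_funTS; exact: measurable_momf.
  - move=> x /=; rewrite in_itv/= => /andP[x1 x2]; rewrite lee_fin /momf.
    have x0 : 0 <= x by rewrite (le_trans ler01).
    apply: (@le_trans _ _ (1 * w x)).
      rewrite mul1r /w /expw !mul1r ler_expR lerN2 ler_pM2r ?invr_gt0//.
      by rewrite ge0_ler_powR ?nnegrE ?normr_ge0 ?(ltW alpha_gt0)// !ger0_norm.
    apply: ler_wpM2r; first exact: expw_ge0.
    by rewrite -(powRr0 x) ger0_norm// ler_powR.
apply: ge0_subset_integral => //.
- by apply: measurable_funTS; exact: measurable_momf.
- by move=> x _; rewrite lee_fin momf_ge0.
- by move=> x /=; rewrite !in_itv/= => /andP[x1 _]; rewrite (le_trans ler01).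
Qed.

Lemma mom_rec p : 0 <= p -> mom (p + alpha) = (p + 1) * mom p.
Proof.
move=> p0; apply: EFin_inj; rewrite EFinM -!momE ?emom_rec// addr_ge0//.
exact: ltW.
Qed.

Lemma mom_alphaB1 : mom (alpha - 1) = 1.
Proof. by rewrite /mom emom_alphaB1. Qed.

(** Apply z^t <= 1 - t + t z to z = |x|^alpha / c and integrate. The normalisation c = p + 1 gives z
    mean 1 under the density of the moment [p], by [mom_rec], so the affine side integrates to
    [mom p] exactly. *)
Lemma mom_interp p t : 0 <= p -> 0 <= t <= 1 ->
  mom (p + alpha * t) <= (p + 1) `^ t * mom p.
Proof.
move=> p0 /andP[t0 t1]; set c := p + 1.
have c0 : 0 < c by rewrite ltr_wpDl.
have at0 : 0 <= alpha * t by rewrite mulr_ge0// ltW.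
rewrite -lee_fin -momE ?addr_ge0//.
apply: (@le_trans _ _ (\int[leb]_(x in `[0%R, +oo[)
   ((c `^ t * (1 - t))%:E * (momf p x)%:E + (c `^ t * (t / c))%:E * (momf (p + alpha) x)%:E))%E).
  apply: ge0_le_integral => //.
  - by move=> x _; rewrite lee_fin momf_ge0.
  - by apply: measurable_funTS; exact: measurable_momf.
  - by apply: emeasurable_funD; apply: emeasurable_funM => //; apply: measurable_funTS; exact: measurable_momf.
  - move=> x _; rewrite -!EFinM -EFinD lee_fin /momf !mulrA -mulrDl.
    apply: ler_wpM2r; first exact: expw_ge0.
    rewrite !powRD_ge0 ?(ltW alpha_gt0)// powRrM.
    have h : (`|x| `^ alpha / c) `^ t <= 1 - t + t * (`|x| `^ alpha / c).
      by apply: powR_le_affine; rewrite ?t0// divr_ge0 ?powR_ge0// ltW.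
    have E : (`|x| `^ alpha) `^ t = c `^ t * (`|x| `^ alpha / c) `^ t.
      by rewrite -powRM ?divr_ge0 ?powR_ge0 ?(ltW c0)// mulrC divfK// gt_eqF.
    rewrite E; apply: le_trans (_ : `|x| `^ p * (c `^ t * (1 - t + t * (`|x| `^ alpha / c))) <= _).
      by apply: ler_wpM2l; rewrite ?powR_ge0//; apply: ler_wpM2l; rewrite ?powR_ge0.
    by rewrite le_eqVlt; apply/orP; left; apply/eqP; ring.
rewrite ge0_integralD//; last 4 first.
- by move=> x _; rewrite mule_ge0// lee_fin ?momf_ge0// mulr_ge0 ?powR_ge0 ?subr_ge0.
- by apply: emeasurable_funM => //; apply: measurable_funTS; exact: measurable_momf.
- by move=> x _; rewrite mule_ge0// lee_fin ?momf_ge0// mulr_ge0 ?powR_ge0 ?divr_ge0 ?(ltW c0).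
- by apply: emeasurable_funM => //; apply: measurable_funTS; exact: measurable_momf.
rewrite !ge0_integralZl//; first last.
all: try by [move=> x _; rewrite lee_fin momf_ge0|apply: measurable_funTS; exact: measurable_momf|rewrite lee_fin mulr_ge0 ?powR_ge0 ?subr_ge0 ?divr_ge0 ?(ltW c0)].
rewrite -/(emom p) -/(emom (p + alpha)) !momE ?addr_ge0 ?(ltW alpha_gt0)//.
rewrite mom_rec// -/c -!EFinM -EFinD lee_fin le_eqVlt; apply/orP; left; apply/eqP.
by field; rewrite gt_eqF.
Qed.

End moments.

(** * Bounds on ratios of moments *)

Section moment_bounds.
Context {R : realType}.
Variable alpha : R.
Hypothesis alpha_ge1 : 1 <= alpha.
Implicit Types (u t x : R).

Let alpha_gt0 : 0 < alpha. Proof. exact: lt_le_trans alpha_ge1. Qed.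
Let aN0 : alpha != 0. Proof. by rewrite gt_eqF. Qed.

(** The substitution y = x^alpha / alpha identifies this with Gamma(u) / alpha. *)
Let G u := alpha `^ (- u) * mom alpha (alpha * u - 1).

Let u_ge0 u : alpha^-1 <= u -> 0 <= alpha * u - 1.
Proof. by rewrite subr_ge0 -ler_pdivrMl// mulr1. Qed.

(* G satisfies the functional equation of the Gamma function and is log-convex. *)
Lemma mom_kershaw x t : alpha^-1 <= x -> 0 <= t <= 1 ->
  G (x + t) * (x + t / 2) `^ (1 - t) <= G (x + 1).
Proof.
apply: kershaw.
- by rewrite invr_gt0.
- by move=> u /u_ge0 u0; rewrite mulr_gt0 ?powR_gt0 ?mom_gt0.
- move=> u /u_ge0 u0; rewrite /G mulrDr mulr1 addrAC mom_rec// subrK.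
  rewrite opprD powRD ?aN0 ?implybT// powR_inv1 ?(ltW alpha_gt0)//.
  by field.
- move=> u s uu /andP[s0 s1]; have u0 := u_ge0 uu.
  have upos : 0 <= u by apply: le_trans uu; rewrite invr_ge0 ltW.
  rewrite /G mulrDr addrAC opprD powRD ?aN0 ?implybT//.
  have := @mom_interp _ alpha alpha_ge1 _ s u0; rewrite s0 s1 subrK => /(_ isT).
  rewrite powRM ?(ltW alpha_gt0)// (powRN _ s) => H.
  have as0 : 0 < alpha `^ s by rewrite powR_gt0.
  rewrite -!mulrA; apply: ler_wpM2l; first exact: powR_ge0.
  by rewrite ler_pdivrMl// (mulrC (mom _ _)) mulrA.
Qed.

(** Kershaw's inequality at x = 1, t = 2 / alpha: the left value comes from M(1 + alpha) = 2 M(1),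
    the right one from M(2 alpha - 1) = alpha, and 1 + t/2 is (1 + alpha) / alpha. *)
Lemma mom1_le : 2 <= alpha -> mom alpha 1 <= alpha / (2 * (1 + alpha) `^ (1 - 2 / alpha)).
Proof.
move=> a2; have h1 : alpha^-1 <= 1 by rewrite invf_le1.
have t0 : 0 <= 2 / alpha by rewrite divr_ge0// ltW.
have t1 : 2 / alpha <= 1 by rewrite ler_pdivrMr// mul1r.
have := @mom_kershaw 1 (2 / alpha) h1; rewrite t0 t1 => /(_ isT).
set t := 2 / alpha.
have E1 : G (1 + t) = alpha `^ (- t) / alpha * (2 * mom alpha 1).
  rewrite /G (_ : alpha * (1 + t) - 1 = 1 + alpha); last by rewrite /t; field.
  rewrite mom_rec// opprD powRD ?aN0 ?implybT// powR_inv1 ?(ltW alpha_gt0)//.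
  by rewrite -natr1; ring.
have E2 : G (1 + 1) = alpha^-1 * alpha^-1 * alpha.
  rewrite /G (_ : alpha * (1 + 1) - 1 = alpha - 1 + alpha); last by ring.
  rewrite mom_rec ?subr_ge0// subrK mom_alphaB1// mulr1 opprD powRD ?aN0 ?implybT//.
  by rewrite powR_inv1// ltW.
have E3 : 1 + t / 2 = (1 + alpha) / alpha by rewrite /t; field.
rewrite E1 E2 E3 powRM ?invr_ge0 ?addr_ge0 ?(ltW alpha_gt0)//.
have -> : alpha^-1 `^ (1 - t) = alpha `^ t / alpha.
  rewrite -[alpha^-1](powR_inv1 (ltW alpha_gt0)) -powRrM mulN1r opprB.
  by rewrite powRD ?aN0 ?implybT// powR_inv1// ltW.
rewrite powRN.
have p1 : 0 < (1 + alpha) `^ (1 - t) by rewrite powR_gt0// ltr_wpDl.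
have p2 : 0 < alpha `^ t by rewrite powR_gt0.
have -> : (alpha `^ t)^-1 / alpha * (2 * mom alpha 1) *
    ((1 + alpha) `^ (1 - t) * (alpha `^ t / alpha)) =
    alpha^-1 * alpha^-1 * (mom alpha 1 * (2 * (1 + alpha) `^ (1 - t))).
  by field; rewrite !gt_eqF.
by rewrite ler_pM2l ?mulr_gt0 ?invr_gt0// ler_pdivlMr ?mulr_gt0.
Qed.

(** Kershaw's inequality at x = 3/alpha - 1, t = 2 - 2/alpha: x + 1 corresponds to M(2), x + t to
    M(alpha) = M(0), and x + t/2 is 2/alpha. The condition alpha <= 2 places x in the admissible
    range. *)
Lemma mom0_le2 : alpha <= 2 -> mom alpha 0 <= 2 `^ (1 - 2 / alpha) * mom alpha 2.
Proof.
move=> a2.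
have x0 : alpha^-1 <= 3 / alpha - 1.
  rewrite -subr_ge0 (_ : _ - _ = (2 - alpha) / alpha); last by field.
  by rewrite divr_ge0 ?subr_ge0// ltW.
have t0 : 0 <= 2 - 2 / alpha.
  by rewrite subr_ge0 ler_pdivrMr// ler_peMr.
have t1 : 2 - 2 / alpha <= 1.
  have : 1 <= 2 / alpha by rewrite ler_pdivlMr// mul1r.
  lra.
have := mom_kershaw x0; move=> /(_ (2 - 2 / alpha)); rewrite t0 t1 => /(_ isT).
have -> : 3 / alpha - 1 + (2 - 2 / alpha) = alpha^-1 + 1 by field.
have -> : 3 / alpha - 1 + (2 - 2 / alpha) / 2 = 2 / alpha by field.
have -> : 1 - (2 - 2 / alpha) = 2 / alpha - 1 by ring.
rewrite subrK /G.
have -> : alpha * (alpha^-1 + 1) - 1 = 0 + alpha by field.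
have -> : alpha * (3 / alpha) - 1 = 2 by field.
rewrite mom_rec// add0r mul1r.
set b := 2 / alpha.
have -> : - (alpha^-1 + 1) = b + (- (3 / alpha) - 1) by rewrite /b; field.
have -> : alpha `^ (b + (- (3 / alpha) - 1)) =
    alpha `^ b * (alpha `^ (- (3 / alpha)) * alpha^-1).
  by rewrite !powRD ?aN0 ?implybT// powR_inv1// ltW.
move=> H.
have p3 : 0 < alpha `^ (- (3 / alpha)) by rewrite powR_gt0.
move: H; rewrite [X in X <= _](_ : _ = alpha `^ (- (3 / alpha)) *
   (alpha `^ b / alpha * (2 / alpha) `^ (b - 1) * mom alpha 0)); last by rewrite /b; ring.
rewrite ler_pM2l//.
have -> : alpha `^ b / alpha * (2 / alpha) `^ (b - 1) = 2 `^ (b - 1).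
  rewrite -[alpha `^ b / alpha]mulr1 -{1}(powR_inv1 (ltW alpha_gt0)) -powRD ?aN0 ?implybT//.
  rewrite mulr1 -powRM ?(ltW alpha_gt0) ?divr_ge0 ?(ltW alpha_gt0)//.
  by rewrite mulrC divfK.
have -> : 1 - b = - (b - 1) by rewrite opprB.
by rewrite powRN ler_pdivlMl ?powR_gt0.
Qed.

(** Interpolation from the moment 2 up to M(alpha) = M(0); the base 3 is the factor p + 1 at p =
    2. *)
Lemma mom0_le3 : 2 <= alpha -> mom alpha 0 <= 3 `^ (1 - 2 / alpha) * mom alpha 2.
Proof.
move=> a2; have t0 : 0 <= 1 - 2 / alpha by rewrite subr_ge0 ler_pdivrMr// mul1r.
have t1 : 1 - 2 / alpha <= 1 by rewrite gerBl divr_ge0// ltW.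
have := @mom_interp _ alpha alpha_ge1 2 (1 - 2 / alpha); rewrite t0 t1 => /(_ (ler0n _ 2) isT).
have -> : 2 + alpha * (1 - 2 / alpha) = 0 + alpha by field.
by rewrite mom_rec// add0r mul1r (_ : 2 + 1 = 3)//; ring.
Qed.

End moment_bounds.

(** * Constants in the Hardy inequality *)

Section hardy_constant_ge2.
Context {R : realType}.
Local Notation leb := (@lebesgue_measure R).
Variable alpha : R.
Hypothesis alpha_ge1 : 1 <= alpha.
Implicit Types (x s r e : R).

Let alpha_gt0 : 0 < alpha. Proof. exact: lt_le_trans alpha_ge1. Qed.
Let w := expw alpha 1.

Lemma ge0_le_integralZ (D : set R) (p : R) (f h : R -> \bar R) : measurable D -> 0 <= p ->
  measurable_fun D f -> measurable_fun D h ->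
  (forall x, D x -> 0 <= f x)%E -> (forall x, D x -> 0 <= h x)%E ->
  (forall x, D x -> f x <= p%:E * h x)%E ->
  (\int[leb]_(x in D) f x <= p%:E * \int[leb]_(x in D) h x)%E.
Proof.
move=> mD p0 mf mh f0 h0 fh; rewrite -ge0_integralZl//.
apply: ge0_le_integral => //.
by apply: emeasurable_funM => //; exact: measurable_cst.
Qed.

Lemma mom_split p r : 0 <= p -> 0 < r ->
  ((mom alpha p)%:E = \int[leb]_(x in `[0%R, r[) (momf alpha p x)%:E +
    \int[leb]_(x in `[r, +oo[) (momf alpha p x)%:E)%E.
Proof.
move=> p0 r0; rewrite -momE// /emom -ge0_integral_setU//=.
- congr integral; apply/seteqP; split=> x /=; rewrite !in_itv/= ?andbT.
    by move=> x0; rewrite x0 /=; case: (ltP x r); [left|right].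
  by case=> [/andP[]//|]; apply: le_trans; exact: ltW.
- by apply: measurable_funTS; exact: measurable_momf.
- by move=> x _; rewrite lee_fin momf_ge0.
- apply/disj_set2P/seteqP; split=> x //=; rewrite !in_itv/= andbT => -[/andP[_]].
  by rewrite ltNge => /negP.
Qed.

Lemma powR1_split x p q : 0 < x -> p + q = 1 -> x = x `^ p * x `^ q.
Proof.
move=> x0 pq; rewrite -(@powRD _ x p q) ?pq ?(gt_eqF x0) ?implybT//.
by rewrite (@powRr1 _ x (ltW x0)).
Qed.

Lemma momf_ler_tail r x : 2 <= alpha -> 0 < r -> r <= x ->
  momf alpha 1 x <= r `^ (2 - alpha) * momf alpha (alpha - 1) x.
Proof.
move=> a2 r0 rx; have x0 : 0 < x by exact: lt_le_trans rx.
rewrite /momf mulrA; apply: ler_wpM2r; first exact: expw_ge0.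
rewrite (gtr0_norm x0) (@powRr1 _ x (ltW x0)).
have E : 2 - alpha + (alpha - 1) = 1 by ring.
rewrite {1}(powR1_split x0 E); apply: ler_wpM2r; first exact: powR_ge0.
have Ep y : y `^ (2 - alpha) = (y `^ (alpha - 2))^-1 by rewrite -powRN opprB.
rewrite (Ep x) (Ep r) lef_pV2 ?posrE ?powR_gt0//.
by apply: ge0_ler_powR; rewrite ?nnegrE ?subr_ge0 ?(ltW x0) ?(ltW r0).
Qed.

Lemma momf_ler_head r x : 2 <= alpha -> 0 <= x -> x <= r ->
  momf alpha (alpha - 1) x <= r `^ (alpha - 2) * momf alpha 1 x.
Proof.
move=> a2 x0 xr; rewrite /momf mulrA; apply: ler_wpM2r; first exact: expw_ge0.
have E : alpha - 2 + 1 = alpha - 1 by ring.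
have E2 : x `^ (alpha - 1) = x `^ (alpha - 2) * x `^ 1.
  by rewrite -(@powRD_ge0 _ x (alpha - 2) 1) ?E ?subr_ge0.
rewrite (ger0_norm x0) E2; apply: ler_wpM2r; first exact: powR_ge0.
by apply: ge0_ler_powR; rewrite ?nnegrE ?subr_ge0 ?(le_trans x0 xr).
Qed.

(* The weight x ^ (2 - alpha) by which the densities of the moments 1 and
   alpha - 1 differ is decreasing, so that the tail fraction of the former
   density is at most the tail fraction w r of the latter. *)
Lemma tail_le_of_comparison (p q m d : R) (A B C : \bar R) :
  m%:E = (A + B)%E -> 1%:E = (C + d%:E)%E -> (B <= (q * d)%:E)%E ->
  (C <= p%:E * A)%E -> (0 <= A)%E -> (0 <= B)%E -> (0 <= C)%E ->
  p * q = 1 -> 0 <= q -> 0 <= p -> 0 < d -> (B <= (m * d)%:E)%E.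
Proof.
case: A => [a| |]; case: B => [b| |]; case: C => [c| |] //.
rewrite -!EFinD -!EFinM !lee_fin => -[->] -[S2] bw ca a0 b0 c0 pq q0 p0 d0.
(* The cross-multiplied comparison of b / (a + b) with d / (c + d), obtained by multiplying the two
   bounds, since [p * q = 1]. *)
have H : b * c <= a * d.
  apply: le_trans (ler_pM b0 c0 bw ca) _.
  by rewrite mulrACA (mulrC q) pq mul1r mulrC.
have : b * (c + d) <= (a + b) * d by rewrite mulrDr mulrDl lerD.
by rewrite -S2 mulr1.
Qed.

Lemma btw_int1 x : btw_int (fun=> 1%R) x = (`|x| `^ 1)%:E.
Proof.
rewrite (_ : (fun=> 1%R) = (fun s : R => `|s| `^ 0)); last by apply/funext => y; rewrite powRr0.
by rewrite btw_int_powR// add0r divr1.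
Qed.

(** The constant M(1) is the limit of the left-hand side as s tends to 0, where w(s) tends to 1; no
    smaller constant serves for the weight 1. *)
Lemma hardy_const_ge2 s : 2 <= alpha -> s != 0 ->
  (\int[leb]_x ((w x)%:E * btw_int (fun=> 1%R) x * (btwE x s)%:E)
    <= (mom alpha 1 * (1 * w s))%:E)%E.
Proof.
move=> a2 s0.
have -> : (\int[leb]_x ((w x)%:E * btw_int (fun=> 1%R) x * (btwE x s)%:E) =
    \int[leb]_(x in `[`|s|%R, +oo[) (momf alpha 1 x)%:E)%E.
  rewrite -(@btw_tail _ (EFin \o momf alpha 1) s).
  - by apply: eq_integral => x _; rewrite btw_int1 -EFinM (mulrC (w x)).
  - exact: measurable_momf.
  - by move=> x; rewrite lee_fin momf_ge0.
  - by move=> x; rewrite /= /momf normrN expwN.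
  - exact: s0.
have r0 : 0 < `|s| by rewrite normr_gt0.
have -> : w s = w `|s| by rewrite /w /expw normr_id.
move: `|s| r0 => r r0 {s s0}.
have mm p D : measurable D -> measurable_fun D (fun x => (momf alpha p x)%:E).
  by move=> mD; apply: measurable_funTS; exact: measurable_momf.
have m0 p D x : D x -> (0 <= (momf alpha p x)%:E)%E by rewrite lee_fin momf_ge0.
have a10 : 0 <= alpha - 1 by rewrite subr_ge0.
have S1 := mom_split ler01 r0; have S2 := mom_split a10 r0.
rewrite (mom_alphaB1 alpha_ge1) (momf_tail alpha_ge1 (ltW r0)) in S2.
have r_tail : (\int[leb]_(x in `[r, +oo[) (momf alpha 1 x)%:E <=
    (r `^ (2 - alpha))%:E * (w r)%:E)%E.
  rewrite -(momf_tail alpha_ge1 (ltW r0)).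
  apply: ge0_le_integralZ (m0 _ _) (m0 _ _) _;
    [exact: measurable_itv|exact: powR_ge0|exact: mm|exact: mm|].
  by move=> x; rewrite /= in_itv/= andbT -EFinM lee_fin; exact: momf_ler_tail.
have r_head : (\int[leb]_(x in `[0%R, r[) (momf alpha (alpha - 1) x)%:E <=
    (r `^ (alpha - 2))%:E * \int[leb]_(x in `[0%R, r[) (momf alpha 1 x)%:E)%E.
  apply: ge0_le_integralZ (m0 _ _) (m0 _ _) _;
    [exact: measurable_itv|exact: powR_ge0|exact: mm|exact: mm|].
  move=> x; rewrite /= in_itv/= -EFinM lee_fin => /andP[x0 xr].
  exact: momf_ler_head (ltW xr).
have pp : r `^ (alpha - 2) * r `^ (2 - alpha) = 1.
  rewrite -(@powRD _ r (alpha - 2) (2 - alpha)) ?(gt_eqF r0) ?implybT//.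
  by rewrite (_ : alpha - 2 + (2 - alpha) = 0) ?powRr0//; ring.
have i0 p D : (0 <= \int[leb]_(x in D) (momf alpha p x)%:E)%E.
  by apply: integral_ge0 => x; exact: m0.
rewrite mul1r.
exact: (tail_le_of_comparison S1 S2 r_tail r_head (i0 _ _) (i0 _ _) (i0 _ _) pp
  (powR_ge0 _ _) (powR_ge0 _ _) (expw_gt0 _ _ _)).
Qed.

End hardy_constant_ge2.

Section hardy_constant_le2.
Context {R : realType}.
Local Notation leb := (@lebesgue_measure R).
Variable alpha : R.
Hypothesis alpha_ge1 : 1 <= alpha.
Implicit Types (x s r e : R).

Let alpha_gt0 : 0 < alpha. Proof. exact: lt_le_trans alpha_ge1. Qed.
Let w := expw alpha 1.

Hypothesis alpha_le2 : alpha <= 2.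

(** For a weight g = exp(k |x|^alpha / alpha), the function (1 - k) x^(alpha - 1) g has derivative
    (1 - k) ((alpha - 1) x^(alpha - 2) + k x^(2 alpha - 2)) g. With this k the inner factor is
    smallest at x = 1, where it equals alpha/2; as 1 - k = alpha/2, this produces alpha^2 / 4. *)
Let k := 1 - alpha / 2.
Let g := expw alpha (- k).

(* The derivative of psi dominates alpha^2 / 4 * g by the weighted
   arithmetic-geometric mean inequality applied to x^(alpha - 2) and
   x^(2 alpha - 2). *)
Let psi x := alpha / 2 * (`|x| `^ (alpha - 1) * g x).
Let dpsi x := alpha / 2 * ((alpha - 1) * `|x| `^ (alpha - 1 - 1) * g x +
  `|x| `^ (alpha - 1) * (k * `|x| `^ (alpha - 1) * g x)).

Let k_ge0 : 0 <= k.
Proof. by rewrite /k subr_ge0 ler_pdivrMr// mul1r. Qed.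

Let is_derive_g x : 0 < x -> is_derive x 1 g (k * `|x| `^ (alpha - 1) * g x).
Proof.
move=> x0; have := is_derive_expw alpha_ge1 (- k) x0.
by rewrite !mulNr opprK.
Qed.

Let is_derive_psi x : 0 < x -> is_derive x 1 psi (dpsi x).
Proof.
move=> x0; apply: derZ; apply: derM; last exact: is_derive_g.
exact: is_derive_normr_powR.
Qed.

Let derivable_dpsi x : 0 < x -> derivable dpsi x 1.
Proof.
move=> x0.
have h1 := is_derive_normr_powR (alpha - 1 - 1) x0.
have h2 := is_derive_normr_powR (alpha - 1) x0.
have h3 := is_derive_g x0.
have h4 := derZ (alpha / 2) (derD (derM (derZ (alpha - 1) h1) h3) (derM h2 (derM (derZ k h2) h3))).
exact: ex_derive.
Qed.

Let continuous_dpsi c d r : 0 < d -> {within `[d, r], continuous (fun x => c * dpsi x)}.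
Proof.
move=> d0; apply: derivable_within_continuous => s; rewrite in_itv/= => /andP[ds _].
have h := derivableP (derivable_dpsi (lt_le_trans d0 ds)).
by have h' := derZ c h; exact: ex_derive.
Qed.

Let g_le_dpsi x : 0 < x -> g x <= 4 / alpha ^+ 2 * dpsi x.
Proof.
move=> x0; rewrite /dpsi gtr0_norm//.
have g0 : 0 < g x by exact: expw_gt0.
(* With this weight, [4 / alpha ^+ 2 * dpsi x] is ((1 - t) x^(alpha - 2) + t x^(2 alpha - 2)) g(x).
   Factoring out x^(alpha - 2) leaves [powR_le_affine] for x^alpha, and [alpha * t = 2 - alpha]. *)
pose t := (2 - alpha) / alpha.
have t01 : 0 <= t <= 1.
  by rewrite /t divr_ge0 ?subr_ge0 ?(ltW alpha_gt0)//= ler_pdivrMr// mul1r; have := alpha_ge1; lra.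
have y0 : 0 < x `^ (2 - alpha) by rewrite powR_gt0.
have := @powR_le_affine _ (x `^ alpha) t (powR_ge0 _ _) t01.
rewrite -powRrM (_ : alpha * t = 2 - alpha); last by rewrite /t; field; rewrite gt_eqF.
have -> : x `^ (alpha - 1 - 1) = (x `^ (2 - alpha))^-1.
  by rewrite -powRN; congr (_ `^ _); ring.
have -> : x `^ alpha = x `^ (alpha - 1) * x `^ (alpha - 1) * x `^ (2 - alpha).
  by rewrite -!powRD ?(gt_eqF x0) ?implybT//; congr (_ `^ _); ring.
move: (x `^ (2 - alpha)) (x `^ (alpha - 1)) y0 => y z y0.
move=> H.
rewrite [leRHS](_ : _ = y^-1 * (1 - t + t * (z * z * y)) * g x); last first.
  by rewrite /k /t; field; rewrite !gt_eqF.
rewrite -[leLHS]mul1r; apply: ler_wpM2r; first exact: ltW.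
by rewrite ler_pdivlMl// mulr1.
Qed.

Let g_nondecreasing x r : 0 <= x <= r -> g x <= g r.
Proof.
move=> /andP[x0 xr]; rewrite /g /expw ler_expR lerN2 !mulNr lerN2.
apply: ler_wpM2l => //; rewrite ler_pM2r ?invr_gt0//.
by rewrite ge0_ler_powR ?nnegrE ?normr_ge0 ?(ltW alpha_gt0)// !ger0_norm// (le_trans x0).
Qed.

Let mg D : measurable D -> measurable_fun D (fun x => (g x)%:E).
Proof.
move=> mD; apply: measurable_funTS; apply/measurable_EFinP.
by apply: continuous_measurable_fun; exact: continuous_expw.
Qed.

(** Integrates [g_le_dpsi]. Since [dpsi] may blow up at 0, the fundamental theorem is used on [d, r]
    only; the piece [0, d] costs at most d g(r), made smaller than e. *)
Let btw_int_g_le x : x != 0 -> (btw_int g x <= (4 / alpha ^+ 2 * psi x)%:E)%E.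
Proof.
move=> x0; rewrite btw_int_even; last 3 first.
- by apply: continuous_measurable_fun; exact: continuous_expw.
- by move=> s; exact: expw_ge0.
- by move=> s; rewrite /g expwN.
have -> : psi x = psi `|x| by rewrite /psi /g /expw normr_id.
have {x0} : 0 < `|x| by rewrite normr_gt0.
move: `|x| => r r0.
have C0 : 0 < 4 / alpha ^+ 2 by rewrite divr_gt0// exprn_gt0.
have gr0 : 0 < g r by exact: expw_gt0.
apply/lee_addgt0Pr => e e0.
have [d [d0 dr de]] : exists d, [/\ 0 < d, d < r & d <= e / g r].
  exists (Num.min (r / 2) (e / g r)); split.
  - by rewrite lt_min !divr_gt0.
  - by rewrite gt_min ltr_pdivrMr// mulrC ltr_pMl// ltr1n.
  - by rewrite ge_min lexx orbT.
have -> : `[0, r]%classic = (`[0, d] `|` `]d, r])%classic.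
  apply/seteqP; split=> y /=; rewrite !in_itv/=.
    by move=> /andP[y0 yr]; rewrite y0 yr; case: (leP y d); [left|right].
  case=> /andP[h1 h2]; first by rewrite h1 (le_trans h2)// ltW.
  by rewrite h2 (le_trans (ltW d0) (ltW h1)).
rewrite ge0_integral_setU//=; last 3 first.
- by apply: mg; exact: measurableU.
- by move=> s _; rewrite lee_fin expw_ge0.
- apply/disj_set2P/seteqP; split=> s //=; rewrite !in_itv/= => -[/andP[_ h] /andP[]].
  by rewrite ltNge h.
rewrite addeC; apply: leeD; last first.
  apply: (@le_trans _ _ (\int[leb]_(s in `[0%R, d]) (g r)%:E)%E).
    apply: ge0_le_integral.
    - exact: measurable_itv.
    - by move=> s _; rewrite lee_fin expw_ge0.
    - exact: mg.
    - exact: measurable_cst.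
    - by move=> s /=; rewrite in_itv/= => /andP[s0 sd]; rewrite lee_fin g_nondecreasing// s0 (le_trans sd)// ltW.
  rewrite integral_cst//= lebesgue_measure_itv/= lte_fin d0 -EFinB -EFinM lee_fin subr0.
  by rewrite mulrC -ler_pdivlMr//.
rewrite integral_itv_obnd_cbnd; last exact: mg.
apply: (@le_trans _ _ (\int[leb]_(s in `[d, r]) (4 / alpha ^+ 2 * dpsi s)%:E)%E).
  apply: ge0_le_integral.
  - exact: measurable_itv.
  - by move=> s _; rewrite lee_fin expw_ge0.
  - exact: mg.
  - apply/measurable_EFinP.
    by apply: subspace_continuous_measurable_fun => //; exact: continuous_dpsi.
  - move=> s /=; rewrite in_itv/= => /andP[ds _]; rewrite lee_fin g_le_dpsi//.
    exact: (lt_le_trans d0 ds).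
rewrite (@continuous_FTC2 _ _ (fun s => 4 / alpha ^+ 2 * psi s))//.
- rewrite -EFinB lee_fin lerBlDr lerDl mulr_ge0 ?(ltW C0)//.
  by rewrite mulr_ge0 ?divr_ge0 ?(ltW alpha_gt0)// mulr_ge0 ?powR_ge0 ?expw_ge0.
- exact: continuous_dpsi.
- have cs s : 0 < s -> {for s, continuous (fun s => 4 / alpha ^+ 2 * psi s)}.
    move=> s0; apply/differentiable_continuous/derivable1_diffP.
    by have h := derZ (4 / alpha ^+ 2) (is_derive_psi s0); exact: ex_derive.
  split; [|exact: cvg_at_right_filter (cs d d0)|exact: cvg_at_left_filter (cs r r0)].
  move=> s; rewrite in_itv/= => /andP[ds _].
  by have h := derZ (4 / alpha ^+ 2) (is_derive_psi (lt_trans d0 ds)); exact: ex_derive.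
- move=> s; rewrite in_itv/= => /andP[ds _].
  have h := derZ (4 / alpha ^+ 2) (is_derive_psi (lt_trans d0 ds)).
  by rewrite derive1E (derive_val (is_derive := h)).
Qed.

Lemma hardy_const_le2 s : s != 0 ->
  (\int[leb]_x ((w x)%:E * btw_int g x * (btwE x s)%:E)
    <= (4 / alpha ^+ 2 * (g s * w s))%:E)%E.
Proof.
move=> s0; have C0 : 0 < 4 / alpha ^+ 2 by rewrite divr_gt0// exprn_gt0.
have a20 : 0 < alpha / 2 by rewrite divr_gt0.
have gw x : g x * w x = expw alpha (alpha / 2) x.
  by rewrite /g /w /expw -expRD; congr expR; rewrite /k; field; rewrite gt_eqF.
(* This is [psi * w], whose tail integral is explicit because it is minus the derivative of [g * w]
   on the positive half-line. *)
pose h x := (alpha / 2 * `|x| `^ (alpha - 1) * expw alpha (alpha / 2) x)%:E.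
have mh : measurable_fun setT h.
  apply/measurable_EFinP; apply: measurable_funM.
    by apply: measurable_funM => //; exact: measurable_normr_powR.
  by apply: continuous_measurable_fun; exact: continuous_expw.
have h0 x : (0 <= h x)%E.
  by rewrite lee_fin mulr_ge0 ?expw_ge0// mulr_ge0 ?powR_ge0// ltW.
have mgT : measurable_fun setT g by apply: continuous_measurable_fun; exact: continuous_expw.
have mB : measurable_fun setT (btw_int g).
  by apply: measurable_btw_int => // x; exact: expw_ge0.
have mw : measurable_fun setT w by apply: continuous_measurable_fun; exact: continuous_expw.
apply: (@le_trans _ _ (\int[leb]_x ((4 / alpha ^+ 2)%:E * (h x * (btwE x s)%:E)))%E).
  apply: ae_ge0_le_integral => //.
  - move=> x _; rewrite !mule_ge0 ?lee_fin ?expw_ge0//.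
    by apply: btw_int_ge0 => y; exact: expw_ge0.
  - apply: emeasurable_funM; last by apply/measurable_EFinP; exact: measurable_btwE_l.
    by apply: emeasurable_funM => //; exact/measurable_EFinP.
  - move=> x _; apply: mule_ge0; first by rewrite lee_fin ltW.
    by apply: mule_ge0; [exact: h0|rewrite lee_fin].
  - apply: emeasurable_funM => //; apply: emeasurable_funM => //.
    by apply/measurable_EFinP; exact: measurable_btwE_l.
  - exists [set 0]; split=> //; first exact: lebesgue_measure_set1.
    move=> x /=; apply: contra_notP => /eqP x0 _.
    rewrite muleA; apply: lee_wpmul2r; first by rewrite lee_fin.
    apply: le_trans (lee_wpmul2l _ (btw_int_g_le x0)) _; first by rewrite lee_fin expw_ge0.
    rewrite /h -!EFinM lee_fin -gw /psi le_eqVlt; apply/orP; left; apply/eqP; ring.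
rewrite ge0_integralZl//; last 3 first.
- by apply: emeasurable_funM => //; apply/measurable_EFinP; exact: measurable_btwE_l.
- by move=> x _; apply: mule_ge0; [exact: h0|rewrite lee_fin].
- by rewrite lee_fin ltW.
rewrite btw_tail//; last by move=> x; rewrite /h normrN expwN.
rewrite integral_tail// -EFinM lee_fin gw.
by rewrite /expw normr_id.
Qed.

Lemma btw_int_expw_lty x : (btw_int g x < +oo)%E.
Proof.
have [->|x0] := eqVneq x 0; last by apply: le_lt_trans (btw_int_g_le x0) _; rewrite ltry.
rewrite btw_int_even; last 3 first.
- by apply: continuous_measurable_fun; exact: continuous_expw.
- by move=> s; exact: expw_ge0.
- by move=> s; rewrite /g expwN.
by rewrite normr0 set_itv1 integral_set1 ltry.
Qed.

End hardy_constant_le2.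

(** * The exponential power distribution *)

Section density.
Context d (T : measurableType d) (R : realType).
Variables (mu nu : {measure set T -> \bar R}) (g : T -> R).
Hypothesis mg : measurable_fun setT g.
Hypothesis g0 : forall x, 0 <= g x.
Hypothesis nuE : forall A, measurable A -> nu A = (\int[mu]_(x in A) (g x)%:E)%E.

Import HBNNSimple.

Lemma integral_density_nnsfun (h : {nnsfun T >-> R}) :
  (\int[nu]_x (h x)%:E = \int[mu]_x ((h x)%:E * (g x)%:E))%E.
Proof.
rewrite integralT_nnsfun sintegralE.
transitivity (\int[mu]_x (\sum_(y \in range h)
    (y%:E * ((\1_(h @^-1` [set y]) x)%:E * (g x)%:E))))%E; last first.
  apply: eq_integral => x _; rewrite (fimfunE h x) -fsumEFin//.
  rewrite ge0_mule_fsuml => [|y]; last exact: nnfun_muleindic_ge0.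
  by apply: eq_fsbigr => y _; rewrite EFinM muleA.
have mE y : measurable_fun setT (fun x => ((\1_(h @^-1` [set y]) x)%:E * (g x)%:E)%E).
  by apply: emeasurable_funM; apply/measurable_EFinP.
have E0 y x : (0 <= y%:E * ((\1_(h @^-1` [set y]) x)%:E * (g x)%:E))%E.
  rewrite muleA; apply: mule_ge0; last by rewrite lee_fin.
  exact: nnfun_muleindic_ge0.
rewrite ge0_integral_fsum//; last by move=> y; apply: emeasurable_funM.
apply: eq_fsbigr => y; rewrite inE => -[z _ <-].
have hz : (0 <= (h z)%:E)%E by rewrite lee_fin fun_ge0.
rewrite ge0_integralZl//; last by move=> x _; apply: mule_ge0; rewrite lee_fin.
congr (_ * _)%E; rewrite nuE//.
rewrite [LHS]integral_mkcond; apply: eq_integral => x _.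
by rewrite patchE indicE; case: ifP => _; rewrite ?mul1e ?mul0e.
Qed.

Lemma ge0_integral_density (f : T -> \bar R) : measurable_fun setT f ->
  (forall x, 0 <= f x)%E -> (\int[nu]_x f x = \int[mu]_x (f x * (g x)%:E))%E.
Proof.
move=> mf f0; pose h := nnsfun_approx measurableT mf.
have mh n : measurable_fun setT (fun x => (h n x)%:E) by apply/measurable_EFinP.
have hf x : (fun n => (h n x)%:E) @ \oo --> f x by exact: cvg_nnsfun_approx.
have hnd x a b : (a <= b)%N -> ((h a x)%:E <= (h b x)%:E)%E.
  by move=> ab; rewrite lee_fin; exact/lefP/nd_nnsfun_approx.
transitivity (limn (fun n => \int[nu]_x (h n x)%:E)%E).
  rewrite -monotone_convergence//.
  - by apply: eq_integral => x _; apply/esym/cvg_lim => //; exact: hf.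
  - by move=> n x _; rewrite lee_fin.
  - by move=> x _ a b; exact: hnd.
under eq_fun do rewrite integral_density_nnsfun.
rewrite -monotone_convergence//.
- by apply: eq_integral => x _; apply/cvg_lim => //; apply: cvgeZr => //; exact: hf.
- by move=> n; apply: emeasurable_funM => //; apply/measurable_EFinP.
- by move=> n x _; rewrite mule_ge0 ?lee_fin.
- by move=> x _ a b ab; rewrite lee_wpmul2r ?lee_fin//; have := hnd x a b ab; rewrite lee_fin.
Qed.

End density.

(** * Finiteness and positivity of Gamma on (0, 1] *)

Section Gamma_pos.
Context {R : realType}.
Local Notation leb := (@lebesgue_measure R).
Variable z : R.
Hypotheses (z_gt0 : 0 < z) (z_le1 : z <= 1).

Let f (t : R) := t `^ (z - 1) * expR (- t).

Let f_ge0 t : 0 <= f t. Proof. by rewrite mulr_ge0 ?powR_ge0 ?expR_ge0. Qed.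

Let mf : measurable_fun setT (EFin \o f).
Proof.
apply/measurable_EFinP; apply: measurable_funM; first exact: measurable_powR.
by apply: measurableT_comp => //; exact: measurable_oppr.
Qed.

(** The singularity at 0 is approached by the segments [1/(n + 1), 1], on each of which the
    primitive t^z / z gives the bound. *)
Lemma integral_powR_obnd1 : (\int[leb]_(t in `]0%R, 1%R]) (t `^ (z - 1))%:E <= (z^-1)%:E)%E.
Proof.
pose F n : set R := `[n.+1%:R^-1, 1]%classic.
have F_U : \bigcup_n F n = `]0%R, 1%R]%classic.
  apply/seteqP; split=> t /=.
    move=> [n _]; rewrite /F /= !in_itv/= => /andP[nt ->]; rewrite andbT.
    by rewrite (lt_le_trans _ nt).
  rewrite in_itv/= => /andP[t0 t1]; exists (Num.truncn t^-1) => //.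
  rewrite /F /= in_itv/= t1 andbT invf_ple ?posrE//.
  by rewrite ltW// truncnS_gt.
rewrite -F_U.
have mp : measurable_fun setT (fun t : R => (t `^ (z - 1))%:E).
  by apply/measurable_EFinP; exact: measurable_powR.
have cF : (\int[leb]_(t in F n) (t `^ (z - 1))%:E)%E @[n --> \oo] -->
    (\int[leb]_(t in \bigcup_n F n) (t `^ (z - 1))%:E)%E.
  apply: ge0_nondecreasing_set_cvg_integral.
  - move=> n m nm; apply/subsetPset => t; rewrite /F /= !in_itv/= => /andP[nt ->].
    by rewrite andbT (le_trans _ nt)// lef_pV2 ?posrE// ler_nat.
  - by move=> n; exact: measurable_itv.
  - by move=> n; exact: measurable_funTS.
  - by move=> n t _; rewrite lee_fin powR_ge0.
rewrite -(cvg_lim _ cF)//; apply: lime_le; first by apply/cvg_ex; eexists; exact: cF.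
apply: nearW => n; rewrite /F.
have : 0 < n.+1%:R^-1 :> R by rewrite invr_gt0.
have : n.+1%:R^-1 <= 1 :> R by rewrite invf_le1// ler1n.
move: (n.+1%:R^-1) => e; rewrite le_eqVlt => /predU1P[-> _|e1 e0].
  by rewrite set_itv1 integral_set1 lee_fin invr_ge0 ltW.
have dF (t : R) : 0 < t -> is_derive t 1 (fun t : R => z^-1 * t `^ z) (z^-1 * (z * t `^ (z - 1))).
  by move=> t0; apply: derZ; exact: is_derive1_powR.
have cG (t : R) : 0 < t -> {for t, continuous (fun t : R => z^-1 * t `^ z)}.
  move=> t0; apply/differentiable_continuous/derivable1_diffP.
  by have h := dF _ t0; exact: ex_derive.
rewrite (@continuous_FTC2 _ _ (fun t => z^-1 * t `^ z))//.
- rewrite powR1 mulr1 -EFinB lee_fin gerBl.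
  by rewrite mulr_ge0 ?powR_ge0// invr_ge0 ltW.
- apply: derivable_within_continuous => t; rewrite in_itv/= => /andP[et _].
  have h := is_derive1_powR (z - 1) (lt_le_trans e0 et); exact: ex_derive.
- split; [|exact: cvg_at_right_filter (cG _ e0)|exact: cvg_at_left_filter (cG _ ltr01)].
  move=> t; rewrite in_itv/= => /andP[et _].
  by have h := dF _ (lt_trans e0 et); exact: ex_derive.
- move=> t; rewrite in_itv/= => /andP[et _].
  have h := dF _ (lt_trans e0 et).
  by rewrite derive1E (derive_val (is_derive := h)) mulrA mulVf ?mul1r// gt_eqF.
Qed.

Lemma integral_Gamma_lty : (\int[leb]_(t in `]0%R, +oo[) (f t)%:E < +oo)%E.
Proof.
have -> : `]0, +oo[%classic = (`]0, 1] `|` `]1, +oo[)%classic :> set R.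
  apply/seteqP; split=> t /=; rewrite !in_itv/= ?andbT.
    by move=> ->; case: (leP t 1); [left|right].
  by case=> [/andP[]//|]; exact: lt_trans.
rewrite ge0_integral_setU//=; last 3 first.
- exact: measurable_funTS.
- by move=> t _; rewrite lee_fin.
- apply/disj_set2P/seteqP; split=> t //=; rewrite !in_itv/= andbT => -[/andP[_]].
  by rewrite leNgt => /negP.
apply: lte_add_pinfty.
  apply: (@le_lt_trans _ _ (z^-1)%:E); last exact: ltry.
  apply: le_trans integral_powR_obnd1.
  apply: ge0_le_integral => //.
  - by move=> t _; rewrite lee_fin.
  - exact: measurable_funTS.
  - by apply: measurable_funTS; apply/measurable_EFinP; exact: measurable_powR.
  - move=> t /=; rewrite in_itv/= => /andP[t0 _]; rewrite lee_fin /f.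
    by rewrite ler_piMr ?powR_ge0// -[leRHS]expR0 ler_expR oppr_le0 ltW.
have T := @integral_tail R 1 (lexx 1) 1 1 ltr01 ler01.
apply: (@le_lt_trans _ _ (\int[leb]_(x in `[1%R, +oo[) (1 * `|x| `^ (1 - 1) * expw 1 1 x)%:E)%E); last first.
  by rewrite T ltry.
apply: (@le_trans _ _ (\int[leb]_(x in `[1%R, +oo[) (f x)%:E)%E).
  apply: ge0_subset_integral => //.
  - exact: measurable_funTS.
  - by move=> t _; rewrite lee_fin.
  - by move=> t /=; rewrite !in_itv/= !andbT; exact: ltW.
apply: ge0_le_integral => //.
- by move=> t _; rewrite lee_fin.
- exact: measurable_funTS.
- apply: measurable_funTS; apply/measurable_EFinP; apply: measurable_funM.
    by apply: measurable_funM => //; exact: measurable_normr_powR.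
  by apply: continuous_measurable_fun; exact: continuous_expw.
- move=> t /=; rewrite in_itv/= andbT => t1; rewrite lee_fin /f /expw.
  have t0 : 0 < t by rewrite (lt_le_trans ltr01).
  rewrite subrr powRr0 !mul1r gtr0_norm// divr1 (@powRr1 _ t (ltW t0)).
  rewrite -[leRHS]mul1r; apply: ler_wpM2r; first exact: expR_ge0.
  by rewrite -[leRHS](powRr0 t) ler_powR// subr_le0.
Qed.

(** A real-valued integral defaults to 0 when the integral is infinite, so positivity requires
    finiteness first. *)
Lemma Gamma_gt0 : 0 < Gamma z.
Proof.
rewrite /Gamma /Rintegral -/f -lte_fin fineK; last first.
  rewrite ge0_fin_numE ?integral_Gamma_lty//.
  by apply: integral_ge0 => t _; rewrite lee_fin; exact: f_ge0.
apply: (@lt_le_trans _ _ (\int[leb]_(t in `[1%R, 2%R]) (2 `^ (z - 1) * expR (- 2))%:E)%E).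
  rewrite integral_cst//= lebesgue_measure_itv/= lte_fin ltr1n -EFinB -EFinM lte_fin.
  by rewrite !mulr_gt0 ?expR_gt0 ?powR_gt0// subr_gt0 ltr1n.
apply: (@le_trans _ _ (\int[leb]_(t in `[1%R, 2%R]) (f t)%:E)%E).
  apply: ge0_le_integral => //.
  - exact: measurable_funTS.
  - move=> t; rewrite /= in_itv/= => /andP[t1 t2]; rewrite lee_fin /f.
    have t0 : 0 < t by rewrite (lt_le_trans ltr01).
    apply: ler_pM; rewrite ?powR_ge0 ?expR_ge0// ?ler_expR ?lerN2//.
    have E (y : R) : y `^ (z - 1) = (y `^ (1 - z))^-1 by rewrite -powRN opprB.
    rewrite (E 2) (E t) lef_pV2 ?posrE ?powR_gt0//.
    by apply: ge0_ler_powR; rewrite ?nnegrE ?subr_ge0// ltW.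
apply: ge0_subset_integral => //.
- exact: measurable_funTS.
- by move=> t _; rewrite lee_fin.
- by move=> t /=; rewrite !in_itv/= => /andP[t1 _]; rewrite andbT (lt_le_trans ltr01).
Qed.

End Gamma_pos.

Section exp_power_measure.
Context {R : realType}.
Local Notation leb := (@lebesgue_measure R).
Variable alpha : R.
Hypothesis alpha_ge1 : 1 <= alpha.

Let alpha_gt0 : 0 < alpha. Proof. exact: lt_le_trans alpha_ge1. Qed.
Let w := expw alpha 1.

Definition exp_power_cst : R := (2 * alpha `^ (alpha^-1 - 1) * Gamma alpha^-1)^-1.
Local Notation kappa := exp_power_cst.

Lemma exp_power_cst_gt0 : 0 < kappa.
Proof.
rewrite invr_gt0 !mulr_gt0 ?powR_gt0//; apply: Gamma_gt0.
  by rewrite invr_gt0.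
by rewrite invf_le1.
Qed.

Lemma ge0_integral_exp_power (f : R -> \bar R) : measurable_fun setT f ->
  (forall x, 0 <= f x)%E ->
  (\int[exp_power alpha]_x f x = kappa%:E * \int[leb]_x ((w x)%:E * f x))%E.
Proof.
move=> mf f0.
have mw : measurable_fun setT (fun x => (w x)%:E).
  by apply/measurable_EFinP; apply: continuous_measurable_fun; exact: continuous_expw.
rewrite (@ge0_integral_density _ _ _ leb (exp_power alpha) (exp_power_pdf alpha))//.
- rewrite -ge0_integralZl//.
  + apply: eq_integral => x _; rewrite /exp_power_pdf -/kappa /w /expw mul1r.
    by rewrite muleA -EFinM muleC.
  + by apply: emeasurable_funM.
  + by move=> x _; rewrite mule_ge0// lee_fin expw_ge0.
  + by rewrite lee_fin ltW// exp_power_cst_gt0.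
- exact: measurable_exp_power_pdf.
- exact: exp_power_pdf_ge0.
Qed.

Lemma exp_power_moment p : 0 <= p ->
  (\int[exp_power alpha]_x (`|x| `^ p)%:E = (kappa * (2 * mom alpha p))%:E)%E.
Proof.
move=> p0; rewrite ge0_integral_exp_power//.
- rewrite (EFinM kappa) (EFinM 2) -momE// -integral_momfT//; congr (_ * _)%E.
  by apply: eq_integral => x _; rewrite -EFinM mulrC.
by apply/measurable_EFinP; exact: measurable_normr_powR.
Qed.

Lemma exp_powerT : exp_power alpha setT = (kappa * (2 * mom alpha 0))%:E.
Proof.
rewrite -(exp_power_moment (lexx 0)) -[LHS]mul1e -integral_cst//.
by apply: eq_integral => x _; rewrite powRr0.
Qed.

End exp_power_measure.

(** * Classical derivatives as weak derivatives *)

Section weak_derivative_C1.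
Context {R : realType}.
Local Notation leb := (@lebesgue_measure R).

Lemma test_function_supp (phi : R -> R) : test_function phi ->
  exists2 M : R, 0 < M & forall x, M <= `|x| -> phi x = 0 /\ derive1 phi x = 0.
Proof.
move=> [_ /compact_bounded[M0 [M0r M0P]]].
pose M := `|M0| + 1; have M1 : M0 < M.
  by rewrite /M (le_lt_trans (ler_norm _))// ltrDl.
have out x : M < `|x| -> phi x = 0.
  move=> Mx; apply/eqP; apply: contraTT Mx => px; rewrite -leNgt.
  by apply: (M0P _ M1); exact: subset_closure.
(* Beyond the enlarged radius [phi] vanishes on a neighbourhood of x, so its derivative vanishes
   there too. *)
exists (M + 1) => [|x Mx]; first by rewrite ltr_wpDl// addr_ge0.
have Mx' : M < `|x| by rewrite (lt_le_trans _ Mx)// ltrDl.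
split; first exact: out.
rewrite derive1E (@near_eq_derive _ _ _ _ (cst 0)) ?derive_cst//.
have : \forall y \near x, M < `|y|.
  by have := @norm_continuous R R x => /cvgr_gt /(_ _ Mx').
by apply: filterS => y; exact: out.
Qed.

Lemma continuous_locally_integrable (f : R -> R) : continuous f -> locally_integrable setT f.
Proof.
move=> cf; split=> [||K _ cK]; [exact: continuous_measurable_fun|exact: openT|].
have /integrableP[_] := @continuous_compact_integrable R f K cK (continuous_subspaceT cf).
by [].
Qed.

Lemma Rintegral_supp (h : R -> R) (M : R) : (forall x, M <= `|x| -> h x = 0) ->
  \int[leb]_x h x = \int[leb]_(x in `[- M, M]) h x.
Proof.
move=> h0; rewrite [RHS]Rintegral_mkcond; apply: eq_Rintegral => x _.
rewrite patchE mem_setE/= in_itv/= -ler_norml.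
by case: leP => // Mx; rewrite h0// ltW.
Qed.

(** The fundamental theorem for [f * phi] on a segment at whose ends [phi] vanishes. It places the
    constant 1 and the identity in the form domain. *)
Lemma weak_derivative_C1 (f g : R -> R) : (forall x : R, is_derive x 1 f (g x)) ->
  continuous g -> weak_derivative f g.
Proof.
move=> dF cg.
have cf : continuous f.
  by move=> x; apply/differentiable_continuous/derivable1_diffP; have h := dF x; exact: ex_derive.
split; [exact: continuous_locally_integrable|exact: continuous_locally_integrable|].
move=> phi tphi; have [M M0 supp] := test_function_supp tphi.
have dphi (x : R) : is_derive x 1 phi (derive1 phi x).
  by rewrite derive1E; apply: derivableP; exact: (tphi.1 0%N x).
have cphi : continuous phi.
  by move=> x; apply/differentiable_continuous/derivable1_diffP; exact: (tphi.1 0%N x).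
have cdphi : continuous (derive1 phi).
  by move=> x; apply/differentiable_continuous/derivable1_diffP; exact: (tphi.1 1%N x).
have ch : continuous (fun x => f x * derive1 phi x).
  by move=> x; apply: continuousM; [exact: cf|exact: cdphi].
have ck : continuous (fun x => g x * phi x).
  by move=> x; apply: continuousM; [exact: cg|exact: cphi].
have csum : continuous (fun x : R => f x * derive1 phi x + g x * phi x).
  by move=> x; apply: cvgD; [exact: ch|exact: ck].
have ih (u : R -> R) : continuous u -> leb.-integrable `[- M, M] (EFin \o u).
  move=> cu; apply: continuous_compact_integrable; first exact: segment_compact.
  exact: continuous_subspaceT.
rewrite (@Rintegral_supp _ M); last by move=> x /supp[_ ->]; rewrite mulr0.
rewrite (@Rintegral_supp (fun x => g x * phi x) M); last by move=> x /supp[-> _]; rewrite mulr0.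
apply/eqP; rewrite -addr_eq0 -RintegralD//; [|exact: ih|exact: ih].
have MM : - M < M by rewrite gtrN.
have dfphi (x : R) : is_derive x 1 (fun x => f x * phi x) (f x * derive1 phi x + g x * phi x).
  by rewrite addrC; exact: derM.
have cfphi : continuous (fun x => f x * phi x).
  by move=> x; apply: continuousM; [exact: cf|exact: cphi].
rewrite /Rintegral (@continuous_FTC2 _ _ (fun x => f x * phi x) _ _ MM) /=.
- by rewrite !(supp _ _).1 ?normrN ?(gtr0_norm M0)// !mulr0 subrr.
- exact: (continuous_subspaceT csum).
- split; [|exact: cvg_at_right_filter (cfphi _)|exact: cvg_at_left_filter (cfphi _)].
  by move=> x _; have h := dfphi x; exact: ex_derive.
- move=> x _; have h := dfphi x.
  by rewrite derive1E (derive_val (is_derive := h)).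
Qed.

End weak_derivative_C1.

(** * The generator *)

Section exp_power_generator.
Context {R : realType}.
Local Notation leb := (@lebesgue_measure R).
Variable alpha : R.
Hypothesis alpha_ge1 : 1 <= alpha.
Local Notation mu := (exp_power alpha).
Local Notation ip := (L2inner mu).
Local Notation kappa := (exp_power_cst alpha).
Let w := expw alpha 1.
Let one : R -> R := fun=> 1.
Let idR : R -> R := fun x => x.

Lemma L2_exp_power_powR (p : R) (f : R -> R) : 0 <= p -> measurable_fun setT f ->
  (forall x, f x ^+ 2 = `|x| `^ p) ->
  L2 mu f /\ ip f f = kappa * (2 * mom alpha p).
Proof.
move=> p0 mf fp; have E := exp_power_moment alpha_ge1 p0.
have f2 : L2 mu f.
  apply/L2E; split=> //; apply/integrableP; split.
    by apply/measurable_EFinP; exact: measurable_funX.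
  apply: (@le_lt_trans _ _ (\int[mu]_x (`|x| `^ p)%:E)%E); last by rewrite E ltry.
  rewrite le_eqVlt; apply/orP; left; apply/eqP.
  by apply: eq_integral => x _; rewrite /= fp ger0_norm// powR_ge0.
split=> //; apply: EFin_inj; rewrite -E (L2innerE f2).
by apply: eq_integral => x _; rewrite fp.
Qed.

Lemma exp_power_one : L2 mu one /\ ip one one = kappa * (2 * mom alpha 0).
Proof.
apply: L2_exp_power_powR => // [|x]; first exact: measurable_cst.
by rewrite powRr0 expr1n.
Qed.

Lemma exp_power_id : L2 mu idR /\ ip idR idR = kappa * (2 * mom alpha 2).
Proof.
apply: L2_exp_power_powR => // [|x]; first exact: measurable_id.
by rewrite (@powR_mulrn _ _ 2)// real_normK// num_real.
Qed.

(** Oddness: reflection exchanges the positive and negative parts, whose integrals are finite and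
    thus cancel. *)
Lemma exp_power_id_one : ip idR one = 0.
Proof.
have [i2 _] := exp_power_id; have [L2o _] := exp_power_one.
have i1 := L2_integrableM i2 L2o.
rewrite /L2inner /Rintegral integralE.
rewrite -(_ : \int[mu]_x ((fun x => (x * 1)%:E)^\+ x) = \int[mu]_x ((fun x => (x * 1)%:E)^\- x))%E.
  by rewrite subee// integrable_pos_fin_num.
have mx : measurable_fun setT (fun x : R => (x * 1)%:E).
  by apply/measurable_EFinP; apply: measurable_funM => //.
rewrite !ge0_integral_exp_power//; [|exact: measurable_funeneg|exact: measurable_funepos].
congr (_ * _)%E.
rewrite -(@ge0_integralT_reflect _ (fun x => (expw alpha 1 x)%:E * (fun x => (x * 1)%:E)^\- x)%E).
- apply: eq_integral => x _; rewrite expwN; congr (_ * _)%E.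
  by rewrite funeposE funenegE mulNr EFinN oppeK.
- apply: emeasurable_funM; last exact: measurable_funeneg.
  by apply/measurable_EFinP; apply: continuous_measurable_fun; exact: continuous_expw.
- by move=> x; rewrite mule_ge0// lee_fin expw_ge0.
Qed.

Lemma H1_one : H1 mu one (fun=> 0).
Proof.
have L20 : L2 mu (fun=> 0).
  apply/L2E; split=> //; rewrite (_ : EFin \o _ = cst 0%E); first exact: integrable0.
  by apply/funext => x /=; rewrite expr0n.
split=> //; first exact: exp_power_one.1.
by apply: weak_derivative_C1 => x; exact: cst_continuous.
Qed.

Lemma H1_id : H1 mu idR one.
Proof.
split; [exact: exp_power_id.1| |exact: exp_power_one.1].
by apply: weak_derivative_C1 => x; exact: cst_continuous.
Qed.

(** For f orthogonal to constants, <f, f> <= <f - c, f - c> for every c. With c from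
    [weak_derivative_AC], |f - c| is bounded by the quantity that [hardy] controls. *)
Lemma exp_power_poincare (g : R -> R) (C : R) (f f' : R -> R) : 0 <= C ->
  measurable_fun setT g -> (forall s, 0 < g s) -> (forall x, btw_int g x < +oo)%E ->
  (forall s, s != 0 ->
    (\int[leb]_x ((w x)%:E * btw_int g x * (btwE x s)%:E) <= (C * (g s * w s))%:E)%E) ->
  H1 mu f f' -> ip f one = 0 -> ip f f <= C * ip f' f'.
Proof.
move=> C0 mg g0 gfin wC [f2 ff' f'2] f1.
have [L2o _] := exp_power_one.
have [c fc] := weak_derivative_AC ff'.
have mf := L2_measurable f2; have mf' := L2_measurable f'2.
have mw : measurable_fun setT w by apply: continuous_measurable_fun; exact: continuous_expw.
have w0 x : 0 <= w x by exact: expw_ge0.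
have k0 : 0 < kappa by exact: exp_power_cst_gt0.
have h := hardy C0 mw w0 mg g0 gfin wC mf'.
have co2 : L2 mu (- c *: one) by exact: (V_L2 (- c *: L2_of L2o)).
have fc2 : L2 mu (f + - c *: one) by exact: (V_L2 (L2_of f2 + - c *: L2_of L2o)).
have E1 : ip (f + - c *: one) (f + - c *: one) = ip f f + c ^+ 2 * ip one one.
  rewrite L2innerDl// L2innerZl// !(L2innerC mu _ (f + _)) !L2innerDl// !L2innerZl//.
  by rewrite (L2innerC mu one f) f1; ring.
apply: (@le_trans _ _ (ip (f + - c *: one) (f + - c *: one))).
  by rewrite E1 lerDl mulr_ge0 ?sqr_ge0// L2inner_ge0.
rewrite -lee_fin EFinM !L2innerE// !ge0_integral_exp_power//.
- rewrite muleCA; apply: lee_wpmul2l; first by rewrite lee_fin ltW.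
  apply: (@le_trans _ _ (C%:E * \int[leb]_x (f' x ^+ 2 * w x)%:E)%E); last first.
    rewrite le_eqVlt; apply/orP; left; apply/eqP; congr (_ * _)%E.
    by apply: eq_integral => x _; rewrite -EFinM mulrC.
  apply: le_trans h; apply: ae_ge0_le_integral => //.
  + by move=> x _; rewrite -EFinM lee_fin mulr_ge0 ?sqr_ge0.
  + by apply: emeasurable_funM; apply/measurable_EFinP => //; apply: measurable_funX; exact: L2_measurable fc2.
  + by move=> x _; apply: mule_ge0; rewrite ?lee_fin// mule_ge0 ?btw_int_ge0.
  + apply: emeasurable_funM; first exact/measurable_EFinP.
    have mb : measurable_fun setT (btw_int (fun s => `|f' s|)).
      by apply: measurable_btw_int => //; exact: measurableT_comp.
    exact: emeasurable_funM.
  + apply: (@filterS _ _ (ae_filter_ringOfSetsType leb) _ _ _ fc) => x fcx _; apply: lee_wpmul2l; first by rewrite lee_fin.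
    have -> : ((f + - c *: one) x ^+ 2)%:E = (`|f x - c|%:E * `|f x - c|%:E)%E.
      rewrite -EFinM -expr2 real_normK ?num_real//; congr ((_ + _) ^+ 2)%:E.
      exact: mulr1.
    by apply: lee_pmul => //; rewrite lee_fin.
- by apply/measurable_EFinP; exact: measurable_funX.
- by move=> x; rewrite lee_fin sqr_ge0.
- by apply/measurable_EFinP; apply: measurable_funX; exact: L2_measurable fc2.
- by move=> x; rewrite lee_fin sqr_ge0.
Qed.

Variable L : operator (measurableTypeR R) R.
Hypothesis hL : is_exp_power_generator alpha L.

Lemma exp_power_spectral_gap (g : R -> R) (C U : R) : 0 < C -> 0 <= U ->
  measurable_fun setT g -> (forall s, 0 < g s) -> (forall x, btw_int g x < +oo)%E ->
  (forall s, s != 0 ->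
    (\int[leb]_x ((w x)%:E * btw_int g x * (btwE x s)%:E) <= (C * (g s * w s))%:E)%E) ->
  mom alpha 0 <= U * mom alpha 2 ->
  C^-1 <= spectral_gap mu (opp_operator L) <= U.
Proof.
move=> C0 U0 mg g0 gfin wC mU.
have [[_ L_sa] _ LD] := hL.
have [L2o oE] := exp_power_one; have [i2 iE] := exp_power_id.
have k0 : 0 < kappa by exact: exp_power_cst_gt0.
have m0 : 0 < mom alpha 0 by exact: mom_gt0.
have m2 : 0 < mom alpha 2 by exact: mom_gt0.
apply: (@spectral_gap_bounds _ _ _ mu _ L C^-1 U idR (ip one one)) => //.
- by have := ltry (kappa * (2 * mom alpha 0)); rewrite -(exp_powerT alpha_ge1).
(* The constant 1 is not a test function. It enters the domain through the adjoint: the form pairs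
   it to zero with every u, because its weak derivative is 0. *)
- apply/L_sa; split; [exact: L2o|by have [] := H1_one|] => u v Luv.
  have [u' [_ /(_ _ _ H1_one)]] := LD _ _ Luv.
  rewrite (L2innerC mu v) => /(canRL opprK) ->.
  rewrite /L2inner; under eq_Rintegral do rewrite mul0r.
  under [in RHS]eq_Rintegral do rewrite mulr0.
  by rewrite !Rintegral_cst// ?mul0r ?oppr0.
- by rewrite oE !mulr_gt0.
- by rewrite invr_gt0.
- move=> f h Lfh f1; have [f' [Hf D]] := LD _ _ Lfh.
  rewrite (L2innerC mu h) (D _ _ Hf) ler_pdivrMl//.
  exact: (exp_power_poincare (ltW C0) mg g0 gfin wC Hf f1).
- exact: exp_power_id_one.
- by rewrite iE !mulr_gt0.
- rewrite oE iE (_ : U * _ = kappa * (2 * (U * mom alpha 2))); last by ring.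
  by rewrite !ler_pM2l.
(* The identity need only belong to $H^1$: the form gives <L f, x> = - <f', 1>, and Cauchy-Schwarz
   bounds its square by <f', f'> times the energy <1, 1> of x. *)
- move=> f h Lfh; have [f' [Hf D]] := LD _ _ Lfh.
  have -> : - ip h f = ip f' f' by rewrite (L2innerC mu h) (D _ _ Hf).
  have -> : ip h idR = - ip one f'.
    by rewrite (L2innerC mu h); apply: (canRL opprK); exact: D H1_id.
  rewrite sqrrN mulrC; have [_ _ f'2] := Hf.
  exact: (dot_CS (@V_dotC _ _ _ mu) (@V_dotDl _ _ _ mu) (@V_dotZl _ _ _ mu)
    (@V_dot_ge0 _ _ _ mu) (L2_of L2o) (L2_of f'2)).
Qed.

End exp_power_generator.

Theorem theorem2p1 (R : realType) (alpha : R)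
    (L : operator (measurableTypeR R) R)
    (halpha : 1 <= alpha)
    (hL : is_exp_power_generator alpha L) :
  let lambda1 := spectral_gap (exp_power alpha) (opp_operator L) in
  (alpha <= 2 ->
     alpha ^+ 2 / 4 <= lambda1 <= 2 `^ (1 - 2 / alpha)) /\
  (2 <= alpha ->
     2 * (1 + alpha) `^ (1 - 2 / alpha) / alpha <= lambda1
       <= 3 `^ (1 - 2 / alpha)).
Proof.
move=> lambda1; have a0 : 0 < alpha by exact: lt_le_trans halpha.
split=> a2.
- have C0 : 0 < 4 / alpha ^+ 2 by rewrite divr_gt0// exprn_gt0.
  rewrite -[_ / 4]invrK invf_div.
  apply: (exp_power_spectral_gap halpha hL C0 _ _ _ _ (hardy_const_le2 halpha a2)).
  + exact: powR_ge0.
  + by apply: continuous_measurable_fun; exact: continuous_expw.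
  + by move=> s; exact: expw_gt0.
  + exact: btw_int_expw_lty.
  + exact: mom0_le2.
- have m1 : 0 < mom alpha 1 by exact: mom_gt0.
  have /andP[lo ->] : (mom alpha 1)^-1 <= lambda1 <= 3 `^ (1 - 2 / alpha).
    apply: (@exp_power_spectral_gap _ _ halpha _ hL (fun=> 1)) => //.
    + by move=> x; rewrite btw_int1// ltry.
    + by move=> s; exact: hardy_const_ge2.
    + exact: mom0_le3.
  rewrite andbT (le_trans _ lo)// -[leLHS]invrK lef_pV2 ?posrE// ?invr_gt0.
    by rewrite invf_div; exact: mom1_le.
  by rewrite divr_gt0// mulr_gt0// powR_gt0// addr_gt0.
Qed.
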